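(* Let $N\ge 2$ and let $(\xi_t)_{t\ge0}=(\xi_t(1),\dots,\xi_t(N))_{t\ge 0}$ be the Markov process on $\mathbb{R}^N$ with generator \[ \mathcal{L} f(\xi)=\frac{1}{2} \sum_{i=1}^{N} \partial^2_{x_i} f(\xi) + \frac{1}{2 (N-1)} \sum_{i=1}^{N} \sum_{j \neq i} \left(f(\theta_{ij}(\xi))-f(\xi)\right),\qquad f\in C^2_0(\mathbb{R}^N), \] where $\theta_{ij}(\xi)(k)=\max\{\xi(i),\xi(j)\}$ if $k\in\{i,j\}$ and $\theta_{ij}(\xi)(k)=\xi(k)$ otherwise, started from a (possibly random) initial configuration $\xi_0$ with law $\rho^N_0$. Let $F_N(x,t)=\frac1N\#\{i:\xi_t(i)\le x\}$ be the cumulative distribution function of the empirical measure $\mu^N_t=\frac1N\sum_{i=1}^N\delta_{\xi_t(i)}$. Let $u_0$ be a distribution function on $\mathbb{R}$ such that $\lim_{N\to\infty}\|F_N(\cdot,0)-u_0\|_\infty=0$ in probability, and let $u$ be the solution of the F-KPP equation \[ \partial_t u=\tfrac12\partial_x^2 u+u^2-u,\quad x\in\mathbb{R},\ t>0,\qquad u(0,x)=u_0(x). \] Then for every $t>0$, \[ \lim_{N\to\infty}\|F_N(\cdot,t)-u(\cdot,t)\|_\infty=0\quad\text{in probability}. \]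
   Context: $C^2_0(\mathbb{R}^N)$ denotes twice differentiable functions with compact support; $\|\cdot\|_\infty$ is the sup norm over $x\in\mathbb{R}$. Informally, the process consists of $N$ particles performing independent standard Brownian motions; each particle carries a rate-one Poisson clock and when it rings it picks another particle uniformly at random, and if the chosen particle is to its right it jumps onto its position. *)

(* Defs.v *)
From HB Require Import structures.
From mathcomp Require Import all_boot all_order all_algebra.
From mathcomp Require Import all_classical all_reals all_analysis.
Set Implicit Arguments. Unset Strict Implicit. Unset Printing Implicit Defensive.
Import Order.TTheory GRing.Theory Num.Theory.
Import numFieldNormedType.Exports.
Local Open Scope classical_set_scope.
Local Open Scope ring_scope.

Section Defs.
Variable R : realType.

Definition evec {N : nat} (i : 'I_N) : 'rV[R]_N := delta_mx ord0 i.

Definition theta {N : nat} (i j : 'I_N) (x : 'rV[R]_N) : 'rV[R]_N :=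
  \row_k (if (k == i) || (k == j) then Num.max (x ord0 i) (x ord0 j) else x ord0 k).

Definition C2c {N : nat} (f : 'rV[R]_N -> R) : Prop :=
  [/\ (forall x i, derivable f x (evec i)),
      (forall x i j, derivable ('D_(evec i) f) x (evec j)),
      (forall i j, continuous ('D_(evec j) ('D_(evec i) f)))
    & exists M : R, forall x, M < `|x| -> f x = 0].

Definition gen {N : nat} (f : 'rV[R]_N -> R) (x : 'rV[R]_N) : R :=
  2^-1 * (\sum_(i < N) 'D_(evec i) ('D_(evec i) f) x)
  + (2 * (N.-1)%:R)^-1 *
      (\sum_(i < N) \sum_(j < N | j != i) (f (theta i j x) - f x)).

(* events of the natural filtration at time s (a generating pi-system) *)
Definition cyl_event {N : nat} {d} {Omega : measurableType d}
  (xi : R -> Omega -> 'rV[R]_N) (s : R) (A : set Omega) : Prop :=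
  exists (n : nat) (r : 'I_n -> R) (idx : 'I_n -> 'I_N) (B : 'I_n -> set R),
    [/\ (forall k, 0 <= r k <= s), (forall k, measurable (B k))
      & A = [set w | forall k, B k (xi (r k) w ord0 (idx k))]].

(* xi solves the martingale problem for L on [0,oo), with cadlag paths:
   the Markov process with generator L (any initial law). *)
Definition is_L_process {N : nat} {d} {Omega : measurableType d}
  (P : probability Omega R) (xi : R -> Omega -> 'rV[R]_N) : Prop :=
  [/\ (forall t i, 0 <= t -> measurable_fun setT (fun w => xi t w ord0 i)),
      (forall w i t, 0 <= t ->
         (fun r => xi r w ord0 i) @ t^'+ --> xi t w ord0 i),
      (forall w i t, 0 < t ->
         cvg ((fun r => xi r w ord0 i) @ t^'-))
    & forall f : 'rV[R]_N -> R, C2c f ->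
      forall s t : R, 0 <= s -> s <= t ->
      forall A, cyl_event xi s A ->
        (\int[P]_(w in A)
           (f (xi t w) - f (xi s w)
            - Rintegral (@lebesgue_measure R) `[s, t] (fun r => gen f (xi r w)))%:E
         = 0)%E].

Definition FN {N : nat} (x : 'rV[R]_N) (y : R) : R :=
  (#|[set i : 'I_N | x ord0 i <= y]|)%:R / N%:R.

Definition supnorm (g : R -> R) : \bar R :=
  ereal_sup [set (`|g y|)%:E | y in setT].

(* convergence in (outer) probability to 0 of nonnegative extended reals *)
Definition cvg_in_prob0 (d : nat -> measure_display)
  (Omega : forall N, measurableType (d N))
  (P : forall N, probability (Omega N) R) (Z : forall N, Omega N -> \bar R) : Prop :=
  forall eps delta : R, 0 < eps -> 0 < delta ->
    exists N0 : nat, forall N, (N0 <= N)%N ->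
      exists A : set (Omega N), [/\ measurable A,
        [set w | (eps%:E < Z N w)%E] `<=` A & (P N A < delta%:E)%E].

Definition distribution_function (F : R -> R) : Prop :=
  [/\ {homo F : x y / x <= y},
      (forall x, F x @[y --> x^'+] --> F x),
      F x @[x --> -oo] --> (0:R)
    & F x @[x --> +oo] --> (1:R)].

Definition FKPP_solution (u : R -> R -> R) (u0 : R -> R) : Prop :=
  [/\ (forall t x, 0 < t ->
        [/\ derivable (fun s => u s x) t 1,
            derivable (u t) x 1,
            derivable (derive1 (u t)) x 1
          & derive1 (fun s => u s x) t
            = 2^-1 * derive1 (derive1 (u t)) x + u t x ^+ 2 - u t x]),
      (forall t x, 0 < t ->
        {for (t, x), continuous (fun p : R * R => u p.1 p.2)}),
      (forall T, 0 < T -> exists M : R,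
        forall t x, 0 < t <= T -> `|u t x| <= M)
    & forall x, {for x, continuous u0} -> u t x @[t --> 0^'+] --> u0 x].

End Defs.

(* Main.v *)
(* Let f_x be the empirical distribution function of the particles smoothed by
   the logistic kernel at scale e, and u the F-KPP solution shifted by a small
   time.  Dynkin's formula makes D(t, x) = E[(f_x - u)^2 + e f_x^2] a subsolution,
   up to an error vanishing with e and 1/N, of a linear heat equation with
   bounded potential: the jump part of the generator gives f^2 - f up to an
   error of the size of e times the derivative of f_x, and this error is absorbed
   by the term - e (d f_x / dx)^2 produced by the summand e f_x^2.  Initially D is
   small except near the jumps of u0 and where the shifted solution is far from
   u0, a set seen only in L^1; sums of narrow Gaussians with small total mass
   dominate it there and the maximum principle on a large box shows that D is
   small at every later time.  Hence f_x converges to u in mean square at each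
   point.  Mass cannot escape to infinity (compare scales e and r >> 1), so
   u(t, .) is a continuous distribution function, and monotonicity upgrades
   pointwise convergence at finitely many points to the sup norm. *)

Require Import Defs.
From HB Require Import structures.
From mathcomp Require Import all_boot all_order all_algebra.
From mathcomp Require Import all_classical all_reals all_analysis.
From mathcomp Require Import measurable_realfun ring lra.
Set Implicit Arguments. Unset Strict Implicit. Unset Printing Implicit Defensive.
Import Order.TTheory GRing.Theory Num.Theory.
Import numFieldNormedType.Exports.
Local Open Scope classical_set_scope.
Local Open Scope ring_scope.

(** * Bounded C2 observables *)

(** The mean of [f_x] satisfies no closed equation, because the jump part is quadratic. The square
    of [f_x - u] does obey a closed inequality, since its reaction terms factor as
    [2 (f + u - 1) (f - u) ^+ 2]. The hypotheses on [u] give neither uniform convergence to [u0] at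
    time 0 nor bounds on its space derivatives: hence the time shift, the L^1 control of the initial
    data, and the summand in [f_x] alone, whose gradient is explicit. Monotonicity of [u] and its
    values in [0, 1] are read off from the particles. The kernel is logistic because its derivative
    is [h - h ^+ 2]: for numbers [h_i] in [0, 1], the normalised sum of the [|h_i - h_j|] differs
    from its mean-field value by at most the mean of the [h_i - h_i ^+ 2], which is [e] times the
    gradient of [f_x], plus a term of order 1/N. The parameters are chosen in a fixed order: box,
    time shift, mesh of the box, smoothing scale [e], number of particles. *)

Section C2b.
Variables (R : realType) (N : nat).

(* Row vectors carry no sigma-algebra here: measurability of an observable is
   tested along random vectors with measurable coordinates. *)
Definition rvmeas (f : 'rV[R]_N -> R) : Prop := forall d (T : measurableType d) (Y : T -> 'rV[R]_N),
  (forall i, measurable_fun setT (fun w => Y w ord0 i)) ->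
  measurable_fun setT (f \o Y).

Definition bmeas (f : 'rV[R]_N -> R) : Prop := (exists M : R, forall x, `|f x| <= M) /\ rvmeas f.

Definition good (f : 'rV[R]_N -> R) : Prop := continuous f /\ bmeas f.

Lemma rvmeas_cst c : rvmeas (fun=> c).
Proof. by move=> d T Y mY; exact: measurable_cst. Qed.

Lemma rvmeasD f g : rvmeas f -> rvmeas g -> rvmeas (fun x => f x + g x).
Proof. by move=> mf mg d T Y mY; apply: measurable_funD; [exact: mf|exact: mg]. Qed.

Lemma rvmeasM f g : rvmeas f -> rvmeas g -> rvmeas (fun x => f x * g x).
Proof. by move=> mf mg d T Y mY; apply: measurable_funM; [exact: mf|exact: mg]. Qed.

Lemma bmeas_cst c : bmeas (fun=> c).
Proof. by split; [exists (`|c|)|exact: rvmeas_cst]. Qed.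

Lemma bmeasD f g : bmeas f -> bmeas g -> bmeas (fun x => f x + g x).
Proof.
move=> [[M Mf] mf] [[K Kg] mg]; split; last exact: rvmeasD.
by exists (M + K) => x; rewrite (le_trans (ler_normD _ _))// lerD.
Qed.

Lemma bmeasM f g : bmeas f -> bmeas g -> bmeas (fun x => f x * g x).
Proof.
move=> [[M Mf] mf] [[K Kg] mg]; split; last exact: rvmeasM.
by exists (M * K) => x; rewrite normrM ler_pM.
Qed.

Lemma bmeasN f : bmeas f -> bmeas (fun x => - f x).
Proof.
move=> bf; have -> : (fun x => - f x) = (fun x => (-1) * f x).
  by apply/funext => x; rewrite mulN1r.
by apply: bmeasM => //; exact: bmeas_cst.
Qed.

Lemma bmeasB f g : bmeas f -> bmeas g -> bmeas (fun x => f x - g x).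
Proof. by move=> bf bg; apply: bmeasD => //; exact: bmeasN. Qed.

Lemma bmeas_sum (I : Type) (r : seq I) (Q : pred I) (F : I -> 'rV[R]_N -> R) :
  (forall i, bmeas (F i)) -> bmeas (fun x => \sum_(i <- r | Q i) F i x).
Proof.
move=> bF; elim: r => [|i r IH].
  by rewrite (_ : (fun x => _) = fun=> 0); [exact: bmeas_cst|apply/funext => x; rewrite big_nil].
case: (boolP (Q i)) => Qi.
  rewrite (_ : (fun x => _) = fun x => F i x + \sum_(i <- r | Q i) F i x).
    by apply: bmeasD.
  by apply/funext => x; rewrite big_cons Qi.
rewrite (_ : (fun x => _) = fun x => \sum_(i <- r | Q i) F i x)//.
by apply/funext => x; rewrite big_cons (negbTE Qi).
Qed.

Lemma bmeas_theta f i j : bmeas f -> bmeas (fun x => f (theta i j x)).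
Proof.
move=> [[M Mf] mf]; split; first by exists M.
move=> d T Y mY; apply: (mf _ _ (fun w => theta i j (Y w))) => k.
rewrite (_ : (fun w => _) = if (k == i) || (k == j) then
    (fun w => Num.max (Y w ord0 i) (Y w ord0 j)) else fun w => Y w ord0 k).
  by case: ifP => _; [apply: measurable_maxr; exact: mY|exact: mY].
by apply/funext => w; rewrite /theta mxE; case: ifP.
Qed.

Lemma good_cst c : good (fun=> c).
Proof. by split; [exact: cst_continuous|exact: bmeas_cst]. Qed.

Lemma goodD f g : good f -> good g -> good (fun x => f x + g x).
Proof.
move=> [cf bf] [cg bg]; split; last exact: bmeasD.
by move=> x; apply: (@continuousD _ _ _ f g x); [exact: cf|exact: cg].
Qed.

Lemma goodM f g : good f -> good g -> good (fun x => f x * g x).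
Proof.
move=> [cf bf] [cg bg]; split; last exact: bmeasM.
by move=> x; apply: (@continuousM _ _ f g x); [exact: cf|exact: cg].
Qed.

(** The derivatives are part of the data, so that [gen] becomes an explicit formula on sums and
    products. Boundedness takes the place of the compact support in [C2c]. *)
Definition C2b (f : 'rV[R]_N -> R) (f1 : 'I_N -> 'rV[R]_N -> R) (f2 : 'I_N -> 'I_N -> 'rV[R]_N -> R) :=
  [/\ forall i x, is_derive x (evec R i) f (f1 i x),
      forall i j x, is_derive x (evec R j) (f1 i) (f2 i j x),
      good f, forall i, good (f1 i) & forall i j, good (f2 i j)].

Lemma C2b_cst c : C2b (fun=> c) (fun _ _ => 0) (fun _ _ _ => 0).
Proof.
split => [i x|i j x| |i|i j]; try exact: good_cst.
  exact: is_derive_cst.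
exact: is_derive_cst.
Qed.

Lemma C2bD f f1 f2 g g1 g2 : C2b f f1 f2 -> C2b g g1 g2 ->
  C2b (fun x => f x + g x) (fun i x => f1 i x + g1 i x)
    (fun i j x => f2 i j x + g2 i j x).
Proof.
move=> [df df1 gf gf1 gf2] [dg dg1 gg gg1 gg2]; split => [i x|i j x| |i|i j]; last 3 first.
- exact: goodD.
- exact: goodD.
- exact: goodD.
- exact: is_deriveD.
- exact: is_deriveD.
Qed.

Lemma C2bM f f1 f2 g g1 g2 : C2b f f1 f2 -> C2b g g1 g2 ->
  C2b (fun x => f x * g x) (fun i x => f x * g1 i x + g x * f1 i x)
    (fun i j x => f x * g2 i j x + g1 i x * f1 j x + (g x * f2 i j x + f1 i x * g1 j x)).
Proof.
move=> [df df1 gf gf1 gf2] [dg dg1 gg gg1 gg2]; split => [i x|i j x| |i|i j]; last 3 first.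
- exact: goodM.
- by apply: goodD; exact: goodM.
- by do 2 (apply: goodD => //); exact: goodM.
- exact: is_deriveM.
- by apply: is_deriveD; exact: is_deriveM.
Qed.

Lemma C2bN f f1 f2 : C2b f f1 f2 ->
  C2b (fun x => - f x) (fun i x => - f1 i x) (fun i j x => - f2 i j x).
Proof.
move=> H; have E g : (fun x : 'rV[R]_N => - g x) = (fun x => (-1) * g x + g x * 0).
  by apply/funext => x; rewrite mulN1r mulr0 addr0.
have gN g : good g -> good (fun x => - g x).
  by move=> gg; rewrite E; apply: goodD; apply: goodM => //; exact: good_cst.
case: H => [df df1 gf gf1 gf2]; split => [i x|i j x| |i|i j]; try exact: gN.
- exact: is_deriveN.
- exact: is_deriveN.
Qed.

Lemma C2b_sum (I : Type) (r : seq I) (F : I -> 'rV[R]_N -> R) F1 F2 :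
  (forall k, C2b (F k) (F1 k) (F2 k)) ->
  C2b (fun x => \sum_(k <- r) F k x) (fun i x => \sum_(k <- r) F1 k i x)
    (fun i j x => \sum_(k <- r) F2 k i j x).
Proof.
move=> bF; elim: r => [|k r IH].
  have -> : (fun x => \sum_(k <- [::]) F k x) = fun=> 0 by apply/funext => x; rewrite big_nil.
  have -> : (fun i x => \sum_(k <- [::]) F1 k i x) = fun _ _ => 0.
    by apply/funext => i; apply/funext => x; rewrite big_nil.
  have -> : (fun i j x => \sum_(k <- [::]) F2 k i j x) = fun _ _ _ => 0; last exact: C2b_cst.
  by apply/funext => i; apply/funext => j; apply/funext => x; rewrite big_nil.
have -> : (fun x => \sum_(l <- k :: r) F l x) = fun x => F k x + \sum_(k <- r) F k x.
  by apply/funext => x; rewrite big_cons.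
have -> : (fun i x => \sum_(l <- k :: r) F1 l i x) = fun i x => F1 k i x + \sum_(k <- r) F1 k i x.
  by apply/funext => i; apply/funext => x; rewrite big_cons.
have -> : (fun i j x => \sum_(l <- k :: r) F2 l i j x) = fun i j x => F2 k i j x + \sum_(k <- r) F2 k i j x; last exact: C2bD.
by apply/funext => i; apply/funext => j; apply/funext => x; rewrite big_cons.
Qed.

Definition is_C2b (f : 'rV[R]_N -> R) := exists f1 f2, C2b f f1 f2.

Lemma is_C2b_cst c : is_C2b (fun=> c).
Proof. by do 2 eexists; exact: C2b_cst. Qed.

Lemma is_C2bD f g : is_C2b f -> is_C2b g -> is_C2b (fun x => f x + g x).
Proof. by move=> [f1 [f2 h]] [g1 [g2 k]]; do 2 eexists; exact: C2bD h k. Qed.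

Lemma is_C2bM f g : is_C2b f -> is_C2b g -> is_C2b (fun x => f x * g x).
Proof. by move=> [f1 [f2 h]] [g1 [g2 k]]; do 2 eexists; exact: C2bM h k. Qed.

Lemma is_C2bN f : is_C2b f -> is_C2b (fun x => - f x).
Proof.
move=> bf; have -> : (fun x => - f x) = (fun x => (-1) * f x).
  by apply/funext => x; rewrite mulN1r.
by apply: is_C2bM => //; exact: is_C2b_cst.
Qed.

Lemma is_C2bB f g : is_C2b f -> is_C2b g -> is_C2b (fun x => f x - g x).
Proof. by move=> bf bg; apply: is_C2bD => //; exact: is_C2bN. Qed.

Lemma is_C2bX f n : is_C2b f -> is_C2b (fun x => f x ^+ n).
Proof.
move=> bf; elim: n => [|n IH]; first exact: is_C2b_cst.
rewrite (_ : (fun x => f x ^+ n.+1) = fun x => f x * f x ^+ n); first exact: is_C2bM.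
by apply/funext => x; rewrite exprS.
Qed.

Lemma is_C2b_sum (I : Type) (r : seq I) (F : I -> 'rV[R]_N -> R) :
  (forall i, is_C2b (F i)) -> is_C2b (fun x => \sum_(i <- r) F i x).
Proof.
move=> bF; elim: r => [|i r IH].
  by rewrite (_ : (fun x => _) = fun=> 0); [exact: is_C2b_cst|apply/funext => x; rewrite big_nil].
rewrite (_ : (fun x => _) = fun x => F i x + \sum_(i <- r) F i x).
  by apply: is_C2bD.
by apply/funext => x; rewrite big_cons.
Qed.

Lemma is_C2b_prod (I : Type) (r : seq I) (F : I -> 'rV[R]_N -> R) :
  (forall i, is_C2b (F i)) -> is_C2b (fun x => \prod_(i <- r) F i x).
Proof.
move=> bF; elim: r => [|i r IH].
  by rewrite (_ : (fun x => _) = fun=> 1); [exact: is_C2b_cst|apply/funext => x; rewrite big_nil].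
rewrite (_ : (fun x => _) = fun x => F i x * \prod_(i <- r) F i x).
  by apply: is_C2bM.
by apply/funext => x; rewrite big_cons.
Qed.

Lemma is_C2b_bmeas f : is_C2b f -> bmeas f.
Proof. by move=> [f1 [f2 [_ _ [_ ?]]]]. Qed.

Lemma is_derive_coord (g : R -> R) (dg : R) (i j : 'I_N) (x : 'rV[R]_N) :
  is_derive (x ord0 i) 1 g dg ->
  is_derive x (evec R j) (fun y => g (y ord0 i)) (if j == i then dg else 0).
Proof.
case: (eqVneq j i) => [->|ji] dgi; last first.
  have E h : ((h *: evec R j + x) ord0 i) = x ord0 i.
    by rewrite !mxE (eq_sym i j) (negbTE ji) andbF mulr0 add0r.
  have D : (fun h : R => h^-1 *: (((fun y => g (y ord0 i)) \o shift x) (h *: evec R j) - g (x ord0 i))) = fun=> 0.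
    by apply/funext => h; rewrite /= E subrr scaler0.
  apply: DeriveDef; first by rewrite /derivable D; exact: is_cvg_cst.
  by rewrite /derive D; exact: lim_cst.
have D : (fun h : R => h^-1 *: (((fun y => g (y ord0 i)) \o shift x) (h *: evec R i) - g (x ord0 i)))
   = (fun h : R => h^-1 *: ((g \o shift (x ord0 i)) (h *: 1) - g (x ord0 i))).
  by apply/funext => h; rewrite /= !mxE !eqxx /GRing.scale.
case: dgi => cg vg.
by apply: DeriveDef; rewrite /derivable /derive D.
Qed.

Lemma good_coord (g : R -> R) (M : R) (i : 'I_N) : continuous g -> (forall y, `|g y| <= M) ->
  good (fun x => g (x ord0 i)).
Proof.
move=> cg Mg; split; last split.
- by move=> x; apply: continuous_comp; [exact: coord_continuous|exact: cg].
- by exists M.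
- move=> d T Y mY; apply: (measurableT_comp (f := g)); last exact: mY.
  exact: continuous_measurable_fun.
Qed.

Lemma C2b_coord (g g1 g2 : R -> R) (M : R) (i : 'I_N) :
  (forall y : R, is_derive y 1 g (g1 y)) -> (forall y : R, is_derive y 1 g1 (g2 y)) ->
  continuous g2 -> (forall y, `|g y| <= M /\ `|g1 y| <= M /\ `|g2 y| <= M) ->
  C2b (fun x => g (x ord0 i)) (fun j x => if j == i then g1 (x ord0 i) else 0)
    (fun j k x => if j == i then if k == i then g2 (x ord0 i) else 0 else 0).
Proof.
move=> dg dg1 cg2 Mg.
have cg : continuous g.
  by move=> y; apply/differentiable_continuous/derivable1_diffP; apply: ex_derive.
have cg1 : continuous g1.
  by move=> y; apply/differentiable_continuous/derivable1_diffP; apply: ex_derive.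
split => [j x|j k x||j|j k].
- exact: is_derive_coord.
- case: (eqVneq j i) => _; last exact: is_derive_cst.
  exact: is_derive_coord.
- by apply: (@good_coord _ M) => // y; case: (Mg y).
- case: eqVneq => _; last exact: good_cst.
  by apply: (@good_coord _ M) => // y; case: (Mg y) => _ [].
- case: eqVneq => _; last exact: good_cst.
  case: eqVneq => _; last exact: good_cst.
  by apply: (@good_coord _ M) => // y; case: (Mg y) => _ [].
Qed.

Lemma is_C2b_coord (g g1 g2 : R -> R) (M : R) (i : 'I_N) :
  (forall y : R, is_derive y 1 g (g1 y)) -> (forall y : R, is_derive y 1 g1 (g2 y)) ->
  continuous g2 -> (forall y, `|g y| <= M /\ `|g1 y| <= M /\ `|g2 y| <= M) ->
  is_C2b (fun x => g (x ord0 i)).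
Proof. by move=> dg dg1 cg2 Mg; do 2 eexists; exact: C2b_coord dg dg1 cg2 Mg. Qed.

Lemma C2b_D f f1 f2 : C2b f f1 f2 -> forall i, 'D_(evec R i) f = f1 i.
Proof. by move=> [df _ _ _ _] i; apply/funext => x; apply: derive_val. Qed.

Lemma C2b_DD f f1 f2 : C2b f f1 f2 -> forall i j, 'D_(evec R j) ('D_(evec R i) f) = f2 i j.
Proof.
move=> H i j; rewrite (C2b_D H); case: H => [_ df1 _ _ _].
by apply/funext => x; apply: derive_val.
Qed.

Lemma C2b_C2c f f1 f2 (M : R) : C2b f f1 f2 -> (forall x, M < `|x| -> f x = 0) -> C2c f.
Proof.
move=> H fM; split.
- by move=> x i; case: H => df _ _ _ _; apply: (@ex_derive _ _ _ _ _ _ _ (df i x)).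
- move=> x i j; rewrite (C2b_D H); case: H => _ df1 _ _ _.
  exact: (@ex_derive _ _ _ _ _ _ _ (df1 i j x)).
- by move=> i j; rewrite (C2b_DD H); case: H => _ _ _ _ gf2; case: (gf2 i j).
- by exists M.
Qed.

Lemma genE f f1 f2 : C2b f f1 f2 -> forall x, gen f x =
  2^-1 * (\sum_(i < N) f2 i i x)
  + (2 * (N.-1)%:R)^-1 *
      (\sum_(i < N) \sum_(j < N | j != i) (f (theta i j x) - f x)).
Proof.
move=> H x; rewrite /gen; congr (_ * _ + _).
by apply: eq_bigr => i _; exact: (congr1 (fun h => h x) (C2b_DD H i i)).
Qed.

Lemma genN f x : is_C2b f -> gen (fun x => - f x) x = - gen f x.
Proof.
move=> [f1 [f2 H]]; rewrite (genE H) (genE (C2bN H)) opprD -!mulrN; congr (_ * _ + _ * _).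
  by rewrite sumrN.
rewrite -sumrN; apply: eq_bigr => i _; rewrite -sumrN; apply: eq_bigr => j _.
by rewrite opprB opprK addrC.
Qed.

Lemma bmeas_gen (f : 'rV[R]_N -> R) : is_C2b f -> bmeas (gen f).
Proof.
move=> [f1 [f2 H]]; have -> := funext (genE H).
case: H => _ _ [_ bf] _ gf2.
apply: bmeasD.
  apply: bmeasM; first exact: bmeas_cst.
  by apply: bmeas_sum => i; case: (gf2 i i).
apply: bmeasM; first exact: bmeas_cst.
apply: bmeas_sum => i; apply: bmeas_sum => j; apply: bmeasB => //.
exact: bmeas_theta.
Qed.

End C2b.

(** * Compactly supported cutoff functions *)

Section cutoff.
Variables (R : realType).

Definition pos_part (z : R) : R := Num.max 0 z.

Lemma continuous_pos_part : continuous pos_part.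
Proof. by move=> x; apply: continuous_max; [exact: cvg_cst|exact: cvg_id]. Qed.

Lemma pos_part_sqr (y : R) : is_derive y 1 (fun z => pos_part z ^+ 2) (2 * pos_part y).
Proof.
have [y0|y0|->] := ltrgt0P y.
- have h : is_derive y 1 ((@id R) ^+ 2) (2 * pos_part y).
    by apply: is_derive_eq; rewrite /pos_part max_r ?ltW// /GRing.scale/=; ring.
  apply: near_eq_is_derive h.
  have : \forall x \near y, 0 < x by exact: lt_nbhsr.
  by apply: filterS => x x0; rewrite /pos_part max_r// ltW.
- have h : is_derive y 1 (fun=> 0 : R) (2 * pos_part y).
    by rewrite /pos_part max_l ?ltW// mulr0; exact: is_derive_cst.
  apply: near_eq_is_derive h.
  have : \forall x \near y, x < 0 by exact: lt_nbhsl.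
  by apply: filterS => x x0; rewrite /pos_part max_l ?expr0n// ltW.
(* At 0 the square equals [pos_part z * z], with the continuous slope [pos_part], which vanishes
   there. *)
- rewrite {2}/pos_part maxxx mulr0; apply/is_derive1_caratheodory; exists pos_part; split.
  + move=> z; rewrite subr0 {2}/pos_part maxxx expr0n subr0 expr2 /pos_part.
    by case: (leP 0 z) => _ //; rewrite !mul0r.
  + exact: continuous_pos_part.
  + by rewrite /pos_part maxxx.
Qed.

Lemma pos_part_cube (y : R) : is_derive y 1 (fun z => pos_part z ^+ 3) (3 * pos_part y ^+ 2).
Proof.
have -> : (fun z => pos_part z ^+ 3) = id * (fun z => pos_part z ^+ 2).
  apply/funext => z; rewrite /GRing.mul /= exprS /pos_part.
  by case: (leP 0 z) => _ //; rewrite expr0n /= !mulr0.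
have h := pos_part_sqr y.
apply: is_derive_eq; rewrite /GRing.scale /=.
by rewrite /pos_part; case: (leP 0 y) => _ //; ring.
Qed.

(** Three is the least integer power of the positive part that is twice continuously differentiable
    at the edge. *)
Definition bump (y : R) : R := pos_part (1 - y ^+ 2) ^+ 3.

Lemma is_C2b_bump N (i : 'I_N) : is_C2b (fun x : 'rV[R]_N => bump (x ord0 i)).
Proof.
pose g1 (y : R) := - 6 * (y * pos_part (1 - y ^+ 2) ^+ 2).
pose g2 (y : R) := - 6 * (pos_part (1 - y ^+ 2) ^+ 2 - 4 * y ^+ 2 * pos_part (1 - y ^+ 2)).
have dq (y : R) : is_derive y 1 (fun z : R => 1 - z ^+ 2) (- (2 * y)).
  have -> : (fun z : R => 1 - z ^+ 2) = (fun=> 1) - (@id R) ^+ 2 by [].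
  by apply: is_derive_eq; rewrite /GRing.scale /=; ring.
have cq (n : nat) : continuous (fun y : R => pos_part (1 - y ^+ 2)).
  move=> y; apply: (@continuous_comp _ _ _ (fun z : R => 1 - z ^+ 2) pos_part); last exact: continuous_pos_part.
  by apply/differentiable_continuous/derivable1_diffP; apply: ex_derive.
have dq2 (y : R) : is_derive y 1 (fun z : R => pos_part (1 - z ^+ 2) ^+ 2) (- (4 * y) * pos_part (1 - y ^+ 2)).
  have := @is_derive1_comp _ (fun z => pos_part z ^+ 2) (fun z : R => 1 - z ^+ 2) y _ _ (pos_part_sqr _) (dq y).
  by rewrite (_ : _ * _ = - (4 * y) * pos_part (1 - y ^+ 2)) //; ring.
(* The second derivative decides: it is at most [6 * 5] in modulus. *)
apply: (@is_C2b_coord _ _ bump g1 g2 30 i).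
- move=> y.
  have := @is_derive1_comp _ (fun z => pos_part z ^+ 3) (fun z : R => 1 - z ^+ 2) y _ _ (pos_part_cube _) (dq y).
  by rewrite (_ : _ * _ = g1 y) // /g1; ring.
- move=> y.
  have h : is_derive y 1 (id * (fun z : R => pos_part (1 - z ^+ 2) ^+ 2)) (pos_part (1 - y ^+ 2) ^+ 2 + y * (- (4 * y) * pos_part (1 - y ^+ 2))).
    by have := dq2 y => ?; apply: is_derive_eq; rewrite /GRing.scale /=; ring.
  have := @is_deriveZ _ _ _ _ (- 6) y 1 _ h.
  rewrite (_ : _ *: _ = g2 y) // /g2 /GRing.scale /=; ring.
- move=> y; apply: cvgM; first exact: cvg_cst.
  apply: cvgB.
    by apply: (@cvg_comp _ _ _ (fun y : R => pos_part (1 - y ^+ 2)) (fun z => z ^+ 2)); [exact: cq|exact: exprn_continuous].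
  apply: cvgM; last exact: cq.
  apply: cvgM; first exact: cvg_cst.
  exact: exprn_continuous.
- move=> y.
  have [y1|y1] := leP (y ^+ 2) 1; last first.
    have p0 : pos_part (1 - y ^+ 2) = 0 by rewrite /pos_part max_l// subr_le0 ltW.
    rewrite /bump /g1 /g2 p0 !expr0n /= !mulr0 subrr mulr0 normr0; lra.
  have p1 : pos_part (1 - y ^+ 2) = 1 - y ^+ 2 by rewrite /pos_part max_r// subr_ge0.
  have y0 : 0 <= y ^+ 2 by exact: sqr_ge0.
  have ya : `|y| <= 1 by rewrite -(@ler_pXn2r _ 2)// ?nnegrE// expr1n real_normK ?num_real.
  move: y1 y0 p1; rewrite /bump /g1 /g2; move: (y ^+ 2) => a y1 y0 ->.
  split; last split.
  + rewrite ger0_norm; last by apply: exprn_ge0; lra.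
    by apply: (@le_trans _ _ 1); [apply: exprn_ile1; lra|lra].
  + rewrite normrM [`|y * _|]normrM normrN [`|6|]ger0_norm// [`|(1 - a) ^+ 2|]ger0_norm ?sqr_ge0//.
    have : `|y| * (1 - a) ^+ 2 <= 1.
      by apply: mulr_ile1; rewrite ?exprn_ge0 ?exprn_ile1//; lra.
    lra.
  + rewrite normrM normrN [`|6|]ger0_norm//.
    have : `|(1 - a) ^+ 2 - 4 * a * (1 - a)| <= 5.
      rewrite ler_norml; apply/andP; split; nra.
    lra.
Qed.

Lemma C2b_cutoff N : exists chi : 'rV[R]_N -> R,
  [/\ is_C2b chi, chi 0 = 1 & forall x, 1 < `|x| -> chi x = 0].
Proof.
exists (fun x => \prod_(i < N) bump (x ord0 i)); split.
- by apply: is_C2b_prod => i; exact: is_C2b_bump.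
- by apply: big1 => i _; rewrite /bump /pos_part mxE expr0n /= subr0 max_r// expr1n.
- move=> x x1.
  (* The norm of a row vector is the modulus of one of its coordinates; the factor of the product at
     that coordinate vanishes. *)
  have /mx_norm_neq0[[i j] /= E] : mx_norm x != 0.
    by apply/eqP => x0; move: x1; rewrite /Num.Def.normr/= x0 ltr10.
  rewrite (bigD1 j)//= (_ : bump _ = 0) ?mul0r// /bump /pos_part max_l ?expr0n//.
  rewrite subr_le0 -real_normK ?num_real//; rewrite (ord1 i) in E; rewrite -E.
  exact: exprn_ege1 (ltW x1).
Qed.

Lemma is_derive_scale N (f : 'rV[R]_N -> R) (k : R) x v df : 0 < k ->
  is_derive (k *: x) v f df -> is_derive x v (fun y => f (k *: y)) (k * df).
Proof.
move=> k0 [cf vf].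
have c0 : (fun h : R => k * h) @ 0^' --> 0^'.
  move=> A [e /= e0 Ae]; exists (e / k); first by rewrite /= divr_gt0.
  move=> h /= hk h0; apply: Ae; last by rewrite /= mulf_neq0// gt_eqF.
  move: hk; rewrite /ball_ /= !sub0r !normrN normrM (gtr0_norm k0).
  by rewrite ltr_pdivlMr// mulrC.
have E : (fun h => h^-1 *: (((fun y => f (k *: y)) \o shift x) (h *: v) - f (k *: x))) @ 0^'
  --> k * df.
  have := cvgM (cvg_cst (F := (0 : R)^') k) (cvg_comp _ _ c0 cf).
  rewrite /derive in vf; rewrite vf => /(_ _ _); apply: cvg_trans; apply: near_eq_cvg.
  near=> h.
  transitivity (k * ((k * h)^-1 * (f ((k * h) *: v + k *: x) - f (k *: x)))); first by [].
  rewrite -scalerA -scalerDr invfM !mulrA mulfV ?mul1r// gt_eqF//.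
by apply: DeriveDef; [apply/cvg_ex; exists (k * df)|exact/cvg_lim].
Unshelve. all: by end_near. Qed.

Lemma good_scale N (f : 'rV[R]_N -> R) (k c : R) : good f -> good (fun x => c * f (k *: x)).
Proof.
move=> [cf [[M Mf] mf]]; apply: goodM; first exact: good_cst.
split; last split.
- by move=> x; apply: (@continuous_comp _ _ _ (fun x : 'rV[R]_N => k *: x) f); [exact: scaler_continuous|exact: cf].
- by exists M.
- move=> d T Y mY; apply: (mf _ _ (fun w => k *: Y w)) => i.
  rewrite (_ : (fun w => _) = fun w => k * Y w ord0 i); last by apply/funext => w; rewrite mxE.
  by apply: measurable_funM; [exact: measurable_cst|exact: mY].
Qed.

Lemma C2b_scale N (f : 'rV[R]_N -> R) f1 f2 (k : R) : 0 < k -> C2b f f1 f2 ->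
  C2b (fun x => f (k *: x)) (fun i x => k * f1 i (k *: x)) (fun i j x => k * (k * f2 i j (k *: x))).
Proof.
move=> k0 [df df1 gf gf1 gf2]; split => [i x|i j x||i|i j].
- exact: is_derive_scale.
- have h := is_derive_scale k0 (df1 i j (k *: x)).
  exact: (@is_deriveZ _ _ _ _ k x _ _ h).
- rewrite (_ : (fun x => _) = fun x => 1 * f (k *: x)); last by apply/funext => x; rewrite mul1r.
  exact: good_scale.
- exact: good_scale.
- rewrite (_ : (fun x => _) = fun x => (k * k) * f2 i j (k *: x)); last by apply/funext => x; rewrite mulrA.
  exact: good_scale.
Qed.

End cutoff.

(** * Bounded integrands on sets of finite measure *)

Section bounded_integrals.
Context d (T : measurableType d) (R : realType) (mu : {measure set T -> \bar R}).
Variables (D : set T) (mD : measurable D) (muD : (mu D < +oo)%E).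

Lemma bounded_integrable (f : T -> R) (M : R) : measurable_fun D f ->
  (forall x, D x -> `|f x| <= M) -> mu.-integrable D (EFin \o f).
Proof.
move=> mf Mf; apply: measurable_bounded_integrable => //.
exists M; split; first exact: num_real.
by move=> K MK x Dx /=; rewrite (le_trans (Mf _ Dx))// ltW.
Qed.

Lemma bounded_cvg_Rintegral (f_ : nat -> T -> R) (f : T -> R) (M : R) :
  (forall n, measurable_fun D (f_ n)) -> measurable_fun D f ->
  (forall n x, D x -> `|f_ n x| <= M) -> (forall x, D x -> f_ ^~ x @ \oo --> f x) ->
  Rintegral mu D (f_ n) @[n --> \oo] --> Rintegral mu D f.
Proof.
move=> mf_ mf Mf_ f_f.
have Mf x : D x -> `|f x| <= M.
  move=> Dx; have h : `|f_ n x| @[n --> \oo] --> `|f x| by apply: cvg_norm; exact: f_f.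
  rewrite -(cvg_lim (@Rhausdorff R) h); apply: limr_le; first exact: cvgP h.
  by apply: nearW => n; exact: Mf_.
have E x (Dx : D x) : (f_ n x)%:E @[n --> \oo] --> (f x)%:E.
  by apply: cvg_EFin; [exact: nearW|exact: f_f].
have [_ _ h] := @dominated_convergence _ _ _ mu D mD (fun n x => (f_ n x)%:E)
  (fun x => (f x)%:E) (cst M%:E)
  (fun n => (measurable_EFinP _ _).2 (mf_ n)) ((measurable_EFinP _ _).2 mf)
  (aeW _ E)
  (bounded_integrable (M := `|M|) (@measurable_cst _ _ _ _ _ M) (fun x _ => lexx _))
  (aeW _ (fun x n Dx => Mf_ n x Dx)).
rewrite /Rintegral; apply: fine_cvg; rewrite fineK//.
by apply: integrable_fin_num => //; exact: bounded_integrable Mf.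
Qed.

End bounded_integrals.

(** * Expectations and Dynkin's formula *)

Section process.
Context (R : realType) (N : nat) d (Omega : measurableType d).
Variables (P : probability Omega R) (xi : R -> Omega -> 'rV[R]_N).
Hypothesis HL : is_L_process P xi.

Definition Ex (f : 'rV[R]_N -> R) (t : R) : R := Rintegral P setT (fun w => f (xi t w)).

Lemma measurable_xi (f : 'rV[R]_N -> R) t : bmeas f -> 0 <= t -> measurable_fun setT (fun w => f (xi t w)).
Proof.
by move=> [_ mf] t0; apply: (mf _ _ (xi t)) => i; case: HL => + _ _ _; exact.
Qed.

Lemma integrable_xi (f : 'rV[R]_N -> R) t : bmeas f -> 0 <= t ->
  P.-integrable setT (EFin \o (fun w => f (xi t w))).
Proof.
move=> bf t0; have [M Mf] := bf.1.
apply: (@bounded_integrable _ _ _ P setT measurableT _ _ M) => //.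
  by rewrite [X in (X < _)%E](_ : _ = 1%E) ?ltry//; exact: probability_setT.
exact: measurable_xi.
Qed.

Lemma ExD f g t : bmeas f -> bmeas g -> 0 <= t ->
  Ex (fun x => f x + g x) t = Ex f t + Ex g t.
Proof. by move=> bf bg t0; rewrite /Ex RintegralD//; exact: integrable_xi. Qed.

Lemma ExB f g t : bmeas f -> bmeas g -> 0 <= t ->
  Ex (fun x => f x - g x) t = Ex f t - Ex g t.
Proof. by move=> bf bg t0; rewrite /Ex RintegralB//; exact: integrable_xi. Qed.

Lemma ExZ c f t : bmeas f -> 0 <= t -> Ex (fun x => c * f x) t = c * Ex f t.
Proof. by move=> bf t0; rewrite /Ex RintegralZl//; exact: integrable_xi. Qed.

Lemma Ex_cst c t : Ex (fun=> c) t = c.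
Proof. by rewrite /Ex Rintegral_cst// [X in fine X](_ : _ = 1%E) ?mulr1//; exact: probability_setT. Qed.

Lemma Ex_le f g t : bmeas f -> bmeas g -> 0 <= t -> (forall x, f x <= g x) ->
  Ex f t <= Ex g t.
Proof. by move=> bf bg t0 fg; apply: le_Rintegral => //; exact: integrable_xi. Qed.

Lemma Ex_norm_le f t M : bmeas f -> 0 <= t -> (forall x, `|f x| <= M) -> `|Ex f t| <= M.
Proof.
move=> bf t0 fM; rewrite ler_norml -(Ex_cst (- M) t) -{2}(Ex_cst M t); apply/andP; split;
  apply: Ex_le => //; try (by exact: bmeas_cst);
  by move=> x; have := fM x; rewrite ler_norml => /andP[].
Qed.

Lemma Ex_cvg (f_ : nat -> 'rV[R]_N -> R) f t M : 0 <= t -> (forall n, bmeas (f_ n)) -> bmeas f ->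
  (forall n x, `|f_ n x| <= M) -> (forall x, f_ ^~ x @ \oo --> f x) ->
  Ex (f_ n) t @[n --> \oo] --> Ex f t.
Proof.
move=> t0 bf_ bf Mf_ f_f; apply: (@bounded_cvg_Rintegral _ _ _ _ _ measurableT _ _ _ M).
- by rewrite [X in (X < _)%E](_ : _ = 1%E) ?ltry//; exact: probability_setT.
- by move=> n; exact: measurable_xi.
- exact: measurable_xi.
- by move=> n x _; exact: Mf_.
- by move=> w _; exact: f_f.
Qed.

(** Time is clamped at 0 to make the process a function on all of [R * Omega]. *)
Let X (z : R * Omega) := xi (Num.max 0 z.1) z.2.

(** Discretised time. The successor keeps the grid point strictly to the right of the clamped time,
    as convergence along [^'+] demands. *)
Let grid (n : nat) (r : R) : R := (Num.trunc (n.+1%:R * Num.max 0 r)).+1%:R / n.+1%:R.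

Let grid_gt n r : Num.max 0 r < grid n r <= Num.max 0 r + n.+1%:R^-1.
Proof.
have m0 : 0 <= Num.max 0 r by rewrite le_max lexx.
have /truncn_itv/andP[h1 h2] : 0 <= n.+1%:R * Num.max 0 r by rewrite mulr_ge0.
rewrite /grid ltr_pdivlMr// ler_pdivrMr// mulrDl mulVf// mulrC h2/=.
by rewrite -[leLHS]natr1 lerD2r.
Qed.

Let cvg_grid r : grid n r @[n --> \oo] --> (Num.max 0 r)^'+.
Proof.
move=> A [e /= e0 Ae].
have : \forall n \near \oo, (n.+1%:R^-1 : R) < e.
  by apply: (near_infty_natSinv_lt (PosNum e0)).
apply: filterS => n ne; have /andP[h1 h2] := grid_gt n r.
apply: Ae => //; rewrite /ball_ /= distrC ger0_norm ?subr_ge0 ?ltW//.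
rewrite ltrBlDl (le_lt_trans h2)// ltrD2l//.
Qed.

Let measurable_grid n i : measurable_fun setT (fun z : R * Omega => xi (grid n z.1) z.2 ord0 i).
Proof.
pose E (k : nat) := [set z : R * Omega | k%:R <= n.+1%:R * Num.max 0 z.1 < k.+1%:R].
have mq : measurable_fun setT (fun z : R * Omega => n.+1%:R * Num.max 0 z.1).
  apply: measurable_funM; first exact: measurable_cst.
  by apply: measurable_maxr; [exact: measurable_cst|exact: measurable_fst].
have mE k : measurable (E k).
  rewrite (_ : E k = setT `&` (fun z : R * Omega => n.+1%:R * Num.max 0 z.1) @^-1` `[k%:R, k.+1%:R[).
    by apply: mq => //; exact: measurable_itv.
  by rewrite setTI; apply/seteqP; split => z /=; rewrite in_itv.
have -> : setT = \bigcup_k E k.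
  apply/seteqP; split => // z _; exists (Num.trunc (n.+1%:R * Num.max 0 z.1)) => //.
  by apply: truncn_itv; rewrite mulr_ge0// le_max lexx.
apply/measurable_fun_bigcup => // k.
apply: (@eq_measurable_fun _ _ _ _ _ (fun z => xi (k.+1%:R / n.+1%:R) z.2 ord0 i)).
  by move=> z; rewrite inE => Ek; rewrite /grid (truncn_def Ek).
apply: (measurable_funS measurableT) => //.
apply: (measurableT_comp (f := fun w => xi (k.+1%:R / n.+1%:R) w ord0 i)).
  by case: HL => + _ _ _; apply; rewrite divr_ge0.
exact: measurable_snd.
Qed.

(** Joint measurability comes from right-continuity: the process is the pointwise limit of
    discretised processes, each constant in time on the cells of a grid. *)
Let measurable_X i : measurable_fun setT (fun z => X z ord0 i).
Proof.
apply: (measurable_fun_cvg (fun n => measurable_grid n i)) => z _.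
have h : (fun r => xi r z.2 ord0 i) @ (Num.max 0 z.1)^'+ --> X z ord0 i.
  by case: HL => _ + _ _; apply; rewrite le_max lexx.
exact: (cvg_comp _ _ (cvg_grid (r := z.1)) h).
Qed.

Lemma measurable_path (g : 'rV[R]_N -> R) w (D : set R) : measurable D -> (forall r, D r -> 0 <= r) ->
  bmeas g -> measurable_fun D (fun r => g (xi r w)).
Proof.
move=> mD D0 [_ mg].
apply: (@eq_measurable_fun _ _ _ _ _ (fun r => g (X (r, w)))).
  by move=> r; rewrite inE => /D0 r0; rewrite /X /= max_r.
apply: (measurable_funS measurableT) => //.
apply: (measurableT_comp (f := g \o X)); first exact: mg.
exact: measurable_pair2.
Qed.

Lemma path_integrable (g : 'rV[R]_N -> R) w s t : 0 <= s -> bmeas g ->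
  lebesgue_measure.-integrable `[s, t] (EFin \o (fun r => g (xi r w))).
Proof.
move=> s0 bg; have [M Mg] := bg.1.
apply: (@bounded_integrable _ _ _ _ _ _ _ _ M) => //.
  by rewrite /= lebesgue_measure_itv /=; case: ifP => _; rewrite ?ltry.
by apply: measurable_path => //= r; rewrite in_itv /= => /andP[sr _]; rewrite (le_trans s0).
Qed.

Lemma Ex_fubini (g : 'rV[R]_N -> R) s t : bmeas g -> 0 <= s ->
  [/\ measurable_fun setT (fun w => Rintegral lebesgue_measure `[s, t] (fun r => g (xi r w))),
      measurable_fun `[s, t] (Ex g)
    & Rintegral P setT (fun w => Rintegral lebesgue_measure `[s, t] (fun r => g (xi r w)))
      = Rintegral lebesgue_measure `[s, t] (Ex g)].
Proof.
move=> bg s0; have [M Mg] := bg.1.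
pose A : set (R * Omega) := `[s, t]%classic `*` setT.
have mA : measurable A by exact: measurableX.
pose F := (EFin \o (g \o X)) \_ A.
have iF : ((@lebesgue_measure R) \x P)%E.-integrable setT F.
  apply: (proj1 (@integrable_mkcond _ _ R ((@lebesgue_measure R) \x P)%E A (EFin \o (g \o X)) mA)).
  apply: (@bounded_integrable _ _ _ _ _ _ _ _ M) => //.
  - rewrite [X in (X < _)%E](_ : _ = ((@lebesgue_measure R) `[s, t]%classic * P setT)%E); last first.
      by apply: product_measure1E.
    rewrite [X in (_ * X)%E](_ : _ = 1%E) ?mule1; last exact: probability_setT.
    by rewrite lebesgue_measure_itv /=; case: ifP => _; rewrite ?ltry.
  - by apply: (measurable_funS measurableT) => //; case: bg => _; apply.
  - by move=> z _; exact: Mg.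
have FA r w : F (r, w) = ((fun r => (g (xi r w))%:E) \_ `[s, t]) r.
  rewrite /F /patch /A /=.
  have -> : ((r, w) \in `[s, t]%classic `*` setT) = (r \in `[s, t]%classic).
    by apply/idP/idP; rewrite !inE /= => h; [case: h|split].
  case: ifPn => //; rewrite inE /= in_itv /= => /andP[sr _].
  by rewrite /X /= max_r// (le_trans s0).
have IG w : (\int[lebesgue_measure]_r F (r, w) =
   \int[lebesgue_measure]_(r in `[s, t]) (g (xi r w))%:E)%E.
  by rewrite [RHS]integral_mkcond; apply: eq_integral => r _; rewrite FA.
have IF r : (\int[P]_w F (r, w) = ((fun r => (Ex g r)%:E) \_ `[s, t]) r)%E.
  rewrite /patch; case: ifPn => rst.
    under eq_integral do rewrite FA /patch rst.
    rewrite /Ex /Rintegral fineK//; apply: integrable_fin_num => //.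
    apply: integrable_xi => //.
    by move: rst; rewrite inE /= in_itv /= => /andP[sr _]; rewrite (le_trans s0).
  under eq_integral do rewrite FA /patch (negbTE rst).
  by rewrite integral0.
have mG := measurable_fubini_G iF; have mF := measurable_fubini_F iF.
split.
- rewrite (_ : (fun w => _) = fine \o fubini_G lebesgue_measure F).
    exact: measurableT_comp.
  by apply/funext => w; rewrite /= /fubini_G IG.
- have : measurable_fun setT ((fun r => (Ex g r)%:E) \_ `[s, t]).
    by rewrite (_ : _ \_ _ = fubini_F P F)//; apply/funext => r; rewrite /fubini_F IF.
  by move/(measurable_restrictT _ (measurable_itv _)) => h; apply/measurable_EFinP.
- rewrite /Rintegral; congr fine.
  transitivity (\int[P]_w \int[lebesgue_measure]_r F (r, w))%E.
    apply: eq_integral => w _; rewrite IG fineK//.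
    by apply: integrable_fin_num => //; exact: path_integrable.
  rewrite -(Fubini iF) [RHS]integral_mkcond.
  by apply: eq_integral => r _; exact: IF.
Qed.

End process.

Lemma cvgr_sum (R : realFieldType) (T I : Type) (F : set_system T) {FF : Filter F} (r : seq I) (Q : pred I)
    (f : I -> T -> R) (l : I -> R) : (forall i, f i x @[x --> F] --> l i) ->
  \sum_(i <- r | Q i) f i x @[x --> F] --> \sum_(i <- r | Q i) l i.
Proof.
move=> fl; elim: r => [|i r IH].
  rewrite big_nil (_ : (fun x => _) = fun=> 0); first exact: cvg_cst.
  by apply/funext => x; rewrite big_nil.
rewrite big_cons; case: ifP => Qi.
  rewrite (_ : (fun x => _) = fun x => f i x + \sum_(i <- r | Q i) f i x); first exact: cvgD.
  by apply/funext => x; rewrite big_cons Qi.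
rewrite (_ : (fun x => _) = fun x => \sum_(i <- r | Q i) f i x)//.
by apply/funext => x; rewrite big_cons Qi.
Qed.

(** * From compactly supported to bounded observables *)

Section cutoff_limit.
Variables (R : realType) (N : nat).

Lemma fin_bound (I : finType) (T : Type) (h : I -> T -> R) :
  (forall i, exists M, forall x, `|h i x| <= M) -> exists M, forall i x, `|h i x| <= M.
Proof.
move=> /choice[m hm]; exists (\sum_i `|m i|) => i x.
rewrite (le_trans (hm i x))// (le_trans (ler_norm _))//.
by rewrite (bigD1 i)//= lerDl sumr_ge0.
Qed.

Lemma C2b_bound (f : 'rV[R]_N -> R) f1 f2 : C2b f f1 f2 -> exists M,
  [/\ 0 <= M, forall x, `|f x| <= M, forall i x, `|f1 i x| <= M & forall i j x, `|f2 i j x| <= M].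
Proof.
move=> [_ _ [_ [[M Mf] _]] g1 g2].
have [M1 H1] : exists M, forall i x, `|f1 i x| <= M.
  by apply: fin_bound => i; case: (g1 i) => _ [].
have [M2 H2] : exists M, forall (ij : 'I_N * 'I_N) x, `|f2 ij.1 ij.2 x| <= M.
  by apply: fin_bound => ij; case: (g2 ij.1 ij.2) => _ [].
have M0 : 0 <= M by rewrite (le_trans _ (Mf 0)).
exists (M + `|M1| + `|M2|); split.
- by rewrite !addr_ge0.
- by move=> x; rewrite (le_trans (Mf x))// -addrA lerDl addr_ge0.
- move=> i x; rewrite (le_trans (H1 i x))// (le_trans (ler_norm _))//.
  by rewrite addrAC lerDr addr_ge0.
- move=> i j x; rewrite (le_trans (H2 (i, j) x))// (le_trans (ler_norm _))//.
  by rewrite lerDr addr_ge0.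
Qed.

Lemma cvg_natSinvM (h : nat -> R) (M : R) : (forall n, `|h n| <= M) ->
  n.+1%:R^-1 * h n @[n --> \oo] --> 0.
Proof.
move=> hM; have h0 : n.+1%:R^-1 * M @[n --> \oo] --> 0.
  by rewrite -(mul0r M); apply: cvgM; [exact: cvg_harmonic|exact: cvg_cst].
have h1 : - (n.+1%:R^-1 * M) @[n --> \oo] --> 0 by rewrite -oppr0; exact: cvgN.
apply: squeeze_cvgr h1 h0; apply: nearW => n.
rewrite -ler_norml normrM ger0_norm ?invr_ge0//.
by rewrite ler_wpM2l ?invr_ge0.
Qed.

(** The martingale problem is posed for [C2c] only, whereas the smoothed distribution function does
    not vanish at infinity. With a cutoff dilated by [n.+1], each derivative that falls on the
    cutoff gains a factor [n.+1^-1]; hence uniform bounds and pointwise convergence of the generator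
    too. *)
Lemma gen_cutoff (f : 'rV[R]_N -> R) : is_C2b f -> exists F : nat -> 'rV[R]_N -> R, exists M : R,
  [/\ forall n, is_C2b (F n), forall n, C2c (F n),
      forall n x, `|F n x| <= M /\ `|gen (F n) x| <= M,
      forall x, F ^~ x @ \oo --> f x & forall x, (fun n => gen (F n) x) @ \oo --> gen f x].
Proof.
move=> [f1 [f2 Hf]].
have [chi [[c1 [c2 Hc]] chi0 chi1]] := C2b_cutoff R N.
pose k (n : nat) : R := n.+1%:R^-1.
have k0 n : 0 < k n by rewrite invr_gt0.
have k1 n : k n <= 1 by rewrite invf_le1// ler1n.
pose F n x := f x * chi (k n *: x).
have HF n := C2bM Hf (C2b_scale (k0 n) Hc).
have [Mf [Mf0 bf bf1 bf2]] := C2b_bound Hf.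
have [Mc [Mc0 bc bc1 bc2]] := C2b_bound Hc.
have cchi : continuous chi by case: Hc => _ _ [].
have cchix x : chi (k n *: x) @[n --> \oo] --> (1 : R).
  rewrite -chi0; apply: (@cvg_comp _ _ _ (fun n => k n *: x) chi); last exact: cchi.
  rewrite -(scale0r x); apply: cvgZr_tmp; exact: cvg_harmonic.
have ckM (h : 'rV[R]_N -> R) x : (exists M, forall y, `|h y| <= M) -> k n * h (k n *: x) @[n --> \oo] --> (0 : R).
  by move=> [M hM]; apply: (@cvg_natSinvM _ M).
(* Four terms from the product rule for a second derivative, two values of the observable per jump;
   the jump sum is completed by its diagonal. *)
pose C := 2^-1 * (\sum_(i < N) (4 * (Mf * Mc))) + `|(2 * (N.-1)%:R)^-1 : R| * (\sum_(i < N) \sum_(j < N) (2 * (Mf * Mc))).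
have nM (a b A B : R) : 0 <= A -> `|a| <= A -> `|b| <= B -> `|a * b| <= A * B.
  by move=> A0 aA bB; rewrite normrM ler_pM.
have nk (a : R) n A : `|a| <= A -> `|k n * a| <= A.
  move=> aA; rewrite normrM gtr0_norm// (le_trans _ aA)//.
  by rewrite -[leRHS]mul1r ler_wpM2r.
exists F; exists (`|C| + Mf * Mc); split.
- by move=> n; do 2 eexists; exact: HF.
- move=> n; apply: (@C2b_C2c _ _ _ _ _ n.+1%:R (HF n)) => x xn.
  rewrite [X in _ * X]chi1 ?mulr0// normrZ gtr0_norm//.
  by rewrite /k mulrC ltr_pdivlMr// mul1r.
- move=> n x; split.
    by rewrite (@le_trans _ _ (Mf * Mc))// ?lerDr// /F nM.
  rewrite (genE (HF n)) (@le_trans _ _ C)//; last by rewrite (le_trans (ler_norm C))// lerDl mulr_ge0.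
  rewrite (le_trans (ler_normD _ _))// /C; apply: lerD; rewrite normrM.
    rewrite ger0_norm// ler_wpM2l// (le_trans (ler_norm_sum _ _ _))//; apply: ler_sum => i _.
    have a1 : `|f x * (k n * (k n * c2 i i (k n *: x)))| <= Mf * Mc by apply: nM => //; do 2 apply: (@nk _ n).
    have a2 : `|f1 i x * (k n * c1 i (k n *: x))| <= Mf * Mc by apply: nM => //; apply: (@nk _ n).
    have a3 : `|chi (k n *: x) * f2 i i x| <= Mf * Mc by rewrite mulrC; apply: nM.
    have a4 : `|k n * c1 i (k n *: x) * f1 i x| <= Mf * Mc by rewrite mulrC; apply: nM => //; apply: (@nk _ n).
    rewrite (le_trans (ler_normD _ _))// (_ : 4 = 1 + 1 + (1 + 1)); last by ring.
    rewrite !mulrDl !mul1r; apply: lerD; rewrite (le_trans (ler_normD _ _))//; exact: lerD.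
  rewrite ler_wpM2l// (le_trans (ler_norm_sum _ _ _))//; apply: ler_sum => i _.
  rewrite (le_trans (ler_norm_sum _ _ _))//.
  rewrite [leRHS](bigID (fun j => j != i))/= -[leLHS]addr0; apply: lerD; last first.
    by apply: sumr_ge0 => j _; rewrite !mulr_ge0.
  apply: ler_sum => j _; rewrite (le_trans (ler_normB _ _))//.
  by rewrite mulrDl mul1r; apply: lerD; apply: nM.
- by move=> x; rewrite -[X in _ --> X]mulr1; apply: cvgM; [exact: cvg_cst|exact: cchix].
- move=> x; rewrite (genE Hf); have -> : (fun n => gen (F n) x) = _ := funext (fun n => genE (HF n) x).
  apply: cvgD; apply: cvgM; try exact: cvg_cst.
    apply: cvgr_sum => i.
    rewrite -[X in _ --> X]add0r; apply: cvgD.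
      rewrite -[X in _ --> X]addr0 -[X in _ --> X + _](mulr0 (f x)) -[X in _ --> _ + X](mul0r (f1 i x)).
      apply: cvgD; apply: cvgM; try exact: cvg_cst.
        have h n : `|k n * c2 i i (k n *: x)| <= Mc by exact: nk.
        exact: (cvg_natSinvM h).
      by apply: ckM; exists Mc.
    rewrite -[X in _ --> X]addr0 -[X in _ --> X + _]mul1r -[X in _ --> _ + X](mulr0 (f1 i x)).
    apply: cvgD; apply: cvgM; try exact: cvg_cst; first exact: cchix.
    by apply: ckM; exists Mc.
  apply: cvgr_sum => i; apply: cvgr_sum => j.
  rewrite -[X in _ --> X - _]mulr1 -[X in _ --> _ - X]mulr1.
  by apply: cvgB; apply: cvgM; try exact: cvg_cst; exact: cchix.
Qed.

End cutoff_limit.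

Section dynkin.
Context (R : realType) (N : nat) d (Omega : measurableType d).
Variables (P : probability Omega R) (xi : R -> Omega -> 'rV[R]_N).
Hypothesis HL : is_L_process P xi.

Local Notation E := (Ex P xi).

Lemma dynkin_C2c f s t : is_C2b f -> C2c f -> 0 <= s -> s <= t ->
  E f t - E f s = Rintegral lebesgue_measure `[s, t] (E (gen f)).
Proof.
move=> bf cf s0 st; have t0 := le_trans s0 st.
have bmf := is_C2b_bmeas bf; have bg := bmeas_gen bf.
have [mI _ <-] := Ex_fubini HL t bg s0.
have [_ _ _ mart] := HL.
(* The whole space is the cylinder event with no constraint. *)
have cT : cyl_event xi s setT.
  exists 0%N; exists (fun=> 0); exists (fun i : 'I_0 => False_rect 'I_N (notF (ltn_ord i))); exists (fun=> setT).
  by split; [case|move=> k; exact: measurableT|apply/seteqP; split].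
have := mart f cf s t s0 st setT cT; move/(congr1 fine).
have [M Mg] := bg.1.
have iI : P.-integrable setT (EFin \o (fun w => Rintegral lebesgue_measure `[s, t] (fun r => gen f (xi r w)))).
  apply: (@bounded_integrable _ _ _ _ _ measurableT _ _ (M * (t - s))) => //.
    by rewrite [X in (X < _)%E](_ : _ = 1%E) ?ltry//; exact: probability_setT.
  move=> w _; apply: (le_trans (le_normr_Rintegral _ _)) => //; first exact: (path_integrable HL).
  rewrite (_ : t - s = fine ((@lebesgue_measure R) `[s, t]%classic)); last first.
    by rewrite lebesgue_measure_itv /= lte_fin; case: ltgtP st => //= ->; rewrite subrr.
  rewrite -Rintegral_cst//; apply: le_Rintegral => //.
  - by apply: integrable_norm; exact: (path_integrable HL).
  - apply: (@bounded_integrable _ _ _ _ _ _ _ _ `|M|) => //.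
    by rewrite /= lebesgue_measure_itv /=; case: ifP => _; rewrite ?ltry.
have i1 := integrable_xi HL bmf t0; have i2 := integrable_xi HL bmf s0.
rewrite -[LHS]/(Rintegral P setT _) RintegralB//; last exact: (integrableB measurableT i1 i2).
rewrite RintegralB// => /eqP; rewrite subr_eq0 => /eqP.
by [].
Qed.

(** Both sides pass to the limit along the cutoffs by dominated convergence, first in [Omega], then
    in time. *)
Lemma dynkin f s t : is_C2b f -> 0 <= s -> s <= t ->
  E f t - E f s = Rintegral lebesgue_measure `[s, t] (E (gen f)).
Proof.
move=> bf s0 st; have t0 := le_trans s0 st.
have [F [M [bF cF MF Ff gF]]] := gen_cutoff bf.
have mF n := is_C2b_bmeas (bF n).
have h1 : E (F n) t - E (F n) s @[n --> \oo] --> E f t - E f s.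
  apply: cvgB; apply: (@Ex_cvg _ _ _ _ _ _ HL _ _ _ M) => //; try exact: is_C2b_bmeas;
  by move=> n x; case: (MF n x).
have h2 : Rintegral lebesgue_measure `[s, t] (E (gen (F n))) @[n --> \oo] -->
   Rintegral lebesgue_measure `[s, t] (E (gen f)).
  have r0 r : `[s, t]%classic r -> 0 <= r by rewrite /= in_itv /= => /andP[sr _]; exact: le_trans sr.
  apply: (@bounded_cvg_Rintegral _ _ _ _ _ _ _ _ _ M) => //.
  - by rewrite /= lebesgue_measure_itv /=; case: ifP => _; rewrite ?ltry.
  - by move=> n; have [] := Ex_fubini HL t (bmeas_gen (bF n)) s0.
  - by have [] := Ex_fubini HL t (bmeas_gen bf) s0.
  - move=> n r /r0 rr; apply: (Ex_norm_le HL) => //; first exact: bmeas_gen.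
    by move=> x; case: (MF n x).
  - move=> r /r0 rr; apply: (@Ex_cvg _ _ _ _ _ _ HL _ _ _ M) => //.
    + by move=> n; exact: bmeas_gen.
    + exact: bmeas_gen.
    + by move=> n x; case: (MF n x).
have h3 : E (F n) t - E (F n) s @[n --> \oo] --> Rintegral lebesgue_measure `[s, t] (E (gen f)).
  rewrite (_ : (fun n => _) = fun n => Rintegral lebesgue_measure `[s, t] (E (gen (F n)))) //.
  by apply/funext => n; exact: dynkin_C2c.
by rewrite -(cvg_lim (@Rhausdorff R) h1) -(cvg_lim (@Rhausdorff R) h3).
Qed.

Lemma Rintegral_cst_itv s t (c : R) : s <= t -> Rintegral (@lebesgue_measure R) `[s, t] (fun=> c) = (t - s) * c.
Proof.
move=> st; rewrite Rintegral_cst//= mulrC; congr (_ * _).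
by rewrite lebesgue_measure_itv /= lte_fin; case: ltgtP st => //= ->; rewrite subrr.
Qed.

Lemma Ex_incr_le_cst f c s t : is_C2b f -> 0 <= s -> s <= t ->
  (forall r, s <= r <= t -> E (gen f) r <= c) -> E f t - E f s <= (t - s) * c.
Proof.
move=> bf s0 st fc; rewrite dynkin// -Rintegral_cst_itv//.
have [M Mg] := (bmeas_gen bf).1.
have fin : ((@lebesgue_measure R) `[s, t]%classic < +oo)%E.
  by rewrite /= lebesgue_measure_itv /=; case: ifP => _; rewrite ?ltry.
apply: le_Rintegral => //.
- have [_ m _] := Ex_fubini HL t (bmeas_gen bf) s0.
  apply: (@bounded_integrable _ _ _ _ _ _ _ _ M) => // r.
  rewrite /= in_itv /= => /andP[sr _]; apply: (Ex_norm_le HL) => //; first exact: bmeas_gen.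
  exact: le_trans sr.
- exact: (@bounded_integrable _ _ _ _ _ _ _ _ `|c|).
Qed.

Lemma Ex_lipschitz f : is_C2b f -> exists2 C, 0 <= C &
  forall s t, 0 <= s -> s <= t -> `|E f t - E f s| <= (t - s) * C.
Proof.
move=> bf; have [M Mg] := (bmeas_gen bf).1; have [K Kg] := (bmeas_gen (is_C2bN bf)).1.
have bmf := is_C2b_bmeas bf.
have M0 : 0 <= M by rewrite (le_trans _ (Mg 0)).
have K0 : 0 <= K by rewrite (le_trans _ (Kg 0)).
exists (M + K); first exact: addr_ge0.
move=> s t s0 st; have t0 := le_trans s0 st.
have r0 r : s <= r <= t -> 0 <= r by move=> /andP[sr _]; exact: le_trans sr.
rewrite ler_norml; apply/andP; split.
  rewrite lerNl opprB.
  have EN r : 0 <= r -> E (fun x => - f x) r = - E f r.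
    move=> r00; rewrite -[RHS]mulN1r -(ExZ HL)//; congr Ex.
    by apply/funext => x; rewrite mulN1r.
  rewrite (_ : _ - _ = E (fun x => - f x) t - E (fun x => - f x) s); last by rewrite !EN// opprK addrC.
  apply: Ex_incr_le_cst => //; first exact: is_C2bN.
  move=> r /r0 rr; rewrite (le_trans (ler_norm _))// (@le_trans _ _ K)//; last by rewrite lerDr.
  by apply: (Ex_norm_le HL) => //; exact/bmeas_gen/is_C2bN.
apply: Ex_incr_le_cst => // r /r0 rr; rewrite (le_trans (ler_norm _))// (@le_trans _ _ M)//; last by rewrite lerDl.
by apply: (Ex_norm_le HL) => //; exact/bmeas_gen.
Qed.

(** [gen f] involves the maxima in [theta] and need not be smooth. A smooth majorant [Q] has a
    Lipschitz expectation, by Dynkin's formula; evaluating it at the right end of the interval costs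
    only a term quadratic in the length. This stands in for a time derivative. *)
Lemma Ex_incr_le f Q : is_C2b f -> is_C2b Q -> (forall x, gen f x <= Q x) ->
  exists2 C, 0 <= C & forall s t, 0 <= s -> s <= t ->
    E f t - E f s <= (t - s) * E Q t + C * (t - s) ^+ 2.
Proof.
move=> bf bQ fQ; have [C C0 HC] := Ex_lipschitz bQ; exists C => // s t s0 st.
rewrite expr2 mulrA (mulrC C) -mulrA -mulrDr; apply: Ex_incr_le_cst => // r /andP[sr rt].
have rr := le_trans s0 sr.
apply: (@le_trans _ _ (E Q r)).
  by apply: (Ex_le HL) => //; [exact: bmeas_gen|exact: is_C2b_bmeas].
have := HC r t rr rt; rewrite ler_norml => /andP[h _].
have : (t - r) * C <= C * (t - s) by rewrite mulrC ler_wpM2l// lerB.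
lra.
Qed.

End dynkin.

(** * Taylor estimates with explicit remainders *)

Section taylor.
Variable R : realType.

Lemma bounded_derive_incr (phi dphi : R -> R) (B k : R) : 0 <= k ->
  (forall t : R, is_derive t 1 phi (dphi t)) -> (forall t, 0 <= t <= k -> `|dphi t| <= B) ->
  `|phi k - phi 0| <= B * k.
Proof.
move=> k0 dp bp.
have [|c] := MVT_segment k0 (fun x _ => dp x).
  apply/continuous_subspaceT => x.
  by apply/differentiable_continuous/derivable1_diffP; apply: ex_derive.
rewrite in_itv /= subr0 => ck ->.
by rewrite normrM (ger0_norm k0) ler_wpM2r// bp.
Qed.

(** The mean value inequality is applied twice along [z + s * t] with [s] of modulus one, which
    covers both signs of [k]; it gives the constant [C] rather than [C / 2]. *)
Lemma taylor1_bound (g g1 g2 : R -> R) (C z k : R) :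
  (forall t : R, is_derive t 1 g (g1 t)) -> (forall t : R, is_derive t 1 g1 (g2 t)) ->
  (forall t, `|g2 t| <= C) ->
  `|g (z + k) - g z - k * g1 z| <= C * k ^+ 2.
Proof.
move=> dg dg1 bg2.
have C0 : 0 <= C by rewrite (le_trans _ (bg2 0)).
have d1 (s t : R) : is_derive t 1 (fun t : R => g1 (z + s * t)) (s * g2 (z + s * t)).
  have := @is_derive1_comp _ g1 (fun t => z + s * t) t (g2 (z + s * t)) s (dg1 _).
  have h : is_derive t 1 (fun t : R => z + s * t) s.
    have -> : (fun t : R => z + s * t) = (fun=> z) + s \*: (@id R) by [].
    by apply: is_derive_eq; rewrite add0r /GRing.scale /= mulr1.
  by move=> /(_ h); rewrite mulrC.
have d0 (s t : R) : is_derive t 1 (fun t : R => g (z + s * t) - g z - s * t * g1 z) (s * g1 (z + s * t) - s * g1 z).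
  have h : is_derive t 1 (fun t : R => z + s * t) s.
    have -> : (fun t : R => z + s * t) = (fun=> z) + s \*: (@id R) by [].
    by apply: is_derive_eq; rewrite add0r /GRing.scale /= mulr1.
  have h1 := @is_derive1_comp _ g (fun t => z + s * t) t (g1 (z + s * t)) s (dg _) h.
  have -> : (fun t : R => g (z + s * t) - g z - s * t * g1 z) = (g \o (fun t => z + s * t)) - (fun=> g z) - (s * g1 z) \*: (@id R).
    apply/funext => u; change (g (z + s * u) - g z - s * u * g1 z = g (z + s * u) - g z - (s * g1 z) * u); ring.
  by apply: is_derive_eq; rewrite subr0 /GRing.scale /= mulr1 mulrC.
have key (s h : R) : `|s| = 1 -> 0 <= h -> `|g (z + s * h) - g z - s * h * g1 z| <= C * h ^+ 2.
  move=> s1 h0.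
  have := @bounded_derive_incr _ _ (C * h) h h0 (d0 s).
  have -> : g (z + s * 0) - g z - s * 0 * g1 z = 0 by rewrite mulr0 addr0; ring.
  have -> : C * h * h = C * h ^+ 2 by ring.
  rewrite subr0; apply => t /andP[t0 th].
  rewrite -mulrBr normrM s1 mul1r.
  have := @bounded_derive_incr _ _ C t t0 (d1 s).
  rewrite mulr0 addr0 => h1; rewrite (le_trans (h1 _)) ?ler_wpM2l//.
  by move=> u _; rewrite normrM s1 mul1r.
have [k0|k0] := leP 0 k.
  by have := key 1 k (normr1 _) k0; rewrite !mul1r.
have := key (-1) (- k) _ _; rewrite !mulrNN !mul1r sqrrN; apply; rewrite ?normrN1 ?oppr_ge0 ?ltW//.
Qed.

Lemma second_diff_bound (g g1 g2 g3 : R -> R) (C z k : R) : 0 <= k ->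
  (forall t : R, is_derive t 1 g (g1 t)) -> (forall t : R, is_derive t 1 g1 (g2 t)) ->
  (forall t : R, is_derive t 1 g2 (g3 t)) -> (forall t, `|g3 t| <= C) ->
  `|g (z + k) + g (z - k) - 2 * g z - k ^+ 2 * g2 z| <= 2 * C * k ^+ 3.
Proof.
move=> k0 dg dg1 dg2 bg3.
have C0 : 0 <= C by rewrite (le_trans _ (bg3 0)).
have dl (s t : R) : is_derive t 1 (fun t : R => z + s * t) s.
  have -> : (fun t : R => z + s * t) = (fun=> z) + s \*: (@id R) by [].
  by apply: is_derive_eq; rewrite add0r /GRing.scale /= mulr1.
have dd (h h1 : R -> R) (s t : R) : (forall t : R, is_derive t 1 h (h1 t)) ->
    is_derive t 1 (fun t : R => h (z + s * t)) (s * h1 (z + s * t)).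
  move=> dh; have := @is_derive1_comp _ h (fun t => z + s * t) t (h1 (z + s * t)) s (dh _) (dl s t).
  by rewrite mulrC.
(* The symmetric remainder and its derivative vanish at 0, so two mean value inequalities reduce the
   claim to the variation of [g2]. *)
pose phi (t : R) := g (z + 1 * t) + g (z + (-1) * t) - 2 * g z - t ^+ 2 * g2 z.
pose dphi (t : R) := g1 (z + 1 * t) - g1 (z + (-1) * t) - 2 * t * g2 z.
have dphiP (t : R) : is_derive t 1 phi (dphi t).
  have h1 := dd g g1 1 t dg; have h2 := dd g g1 (-1) t dg.
  have -> : phi = ((fun t => g (z + 1 * t)) + (fun t => g (z + (-1) * t))) - (fun=> 2 * g z) - (g2 z) \*: ((@id R) ^+ 2).
    apply/funext => u; change (g (z + 1 * u) + g (z + (-1) * u) - 2 * g z - u ^+ 2 * g2 z = g (z + 1 * u) + g (z + (-1) * u) - 2 * g z - g2 z * u ^+ 2); ring.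
  by apply: is_derive_eq; rewrite /dphi /GRing.scale /=; ring.
have ddphiP (t : R) : is_derive t 1 dphi (g2 (z + 1 * t) + g2 (z + (-1) * t) - 2 * g2 z).
  have h1 := dd g1 g2 1 t dg1; have h2 := dd g1 g2 (-1) t dg1.
  have -> : dphi = ((fun t => g1 (z + 1 * t)) - (fun t => g1 (z + (-1) * t))) - (2 * g2 z) \*: (@id R).
    apply/funext => u; change (g1 (z + 1 * u) - g1 (z + (-1) * u) - 2 * u * g2 z = g1 (z + 1 * u) - g1 (z + (-1) * u) - (2 * g2 z) * u); ring.
  by apply: is_derive_eq; rewrite /GRing.scale /=; ring.
have := @bounded_derive_incr phi dphi (2 * C * k ^+ 2) k k0 dphiP.
have -> : phi 0 = 0 by rewrite /phi !mulr0 addr0; ring.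
have -> : 2 * C * k ^+ 2 * k = 2 * C * k ^+ 3 by ring.
rewrite subr0 /phi mul1r mulN1r; apply => t /andP[t0 tk].
have := @bounded_derive_incr dphi _ (2 * C * k) t t0 ddphiP.
have -> : dphi 0 = 0 by rewrite /dphi !mulr0 addr0; ring.
rewrite subr0 => h.
rewrite (le_trans (h _))//; last first.
  by rewrite expr2 !mulrA ler_wpM2l// !mulr_ge0.
move=> u /andP[u0 ut].
have b1 (s : R) : `|s| = 1 -> `|g2 (z + s * u) - g2 z| <= C * k.
  move=> s1; have := @bounded_derive_incr _ _ C u u0 (fun t => dd g2 g3 s t dg2).
  rewrite mulr0 addr0 => h1; rewrite (le_trans (h1 _)) ?ler_wpM2l ?(le_trans ut)//.
  by move=> v _; rewrite normrM s1 mul1r.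
have -> : g2 (z + 1 * u) + g2 (z + -1 * u) - 2 * g2 z = (g2 (z + 1 * u) - g2 z) + (g2 (z + -1 * u) - g2 z) by ring.
rewrite (le_trans (ler_normD _ _))//.
have := b1 1 (normr1 _); have := b1 (-1) (normrN1 _); lra.
Qed.

End taylor.

(** * Logistic smoothing of the empirical distribution function *)

Section logistic.
Variable R : realType.
Implicit Types p : {poly R}.

Definition logi (y : R) : R := (1 + expR (- y))^-1.

Lemma logi_gt0 y : 0 < logi y.
Proof. by rewrite invr_gt0 addr_gt0// expR_gt0. Qed.

Lemma logi_lt1 y : logi y < 1.
Proof. by rewrite invf_lt1 ?ltrDl ?expR_gt0// addr_gt0// expR_gt0. Qed.

Lemma logiN y : logi (- y) = 1 - logi y.
Proof.
rewrite /logi opprK expRN.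
have e0 := expR_gt0 y; have e1 : 1 + expR y != 0 by rewrite gt_eqF// addr_gt0.
by field; rewrite gt_eqF//= gt_eqF// addr_gt0.
Qed.

Lemma logi_nd : {homo logi : x y / x <= y}.
Proof.
move=> x y xy; rewrite /logi lef_pV2 ?posrE ?addr_gt0 ?expR_gt0//.
by rewrite lerD2l ler_expR lerN2.
Qed.

Lemma logi0 : logi 0 = 2^-1.
Proof. by rewrite /logi oppr0 expR0. Qed.

Lemma logi_ge_expR y : 1 - expR (- y) <= logi y.
Proof.
rewrite /logi; have e0 := expR_gt0 (- y).
by rewrite -[leRHS]mul1r ler_pdivlMr ?addr_gt0//; nra.
Qed.

Lemma logi_le_expR y : logi y <= expR y.
Proof. by have := logi_ge_expR (- y); rewrite opprK logiN; lra. Qed.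

Definition Vp : {poly R} := 'X - 'X^2.

(** The derivation of the polynomial ring that sends ['X] to ['X - 'X^2]; it represents
    differentiation of the functions [p.[logi y]]. *)
Definition dp p : {poly R} := p^`() * Vp.

Lemma is_derive_logi (y : R) : is_derive y 1 logi (logi y - logi y ^+ 2).
Proof.
have e0 := expR_gt0 (- y).
have n0 : (fun z => 1 + expR (- z)) y != 0 :> R by rewrite gt_eqF// addr_gt0.
have d1 : is_derive y 1 (fun z : R => 1 + expR (- z)) (- expR (- y)).
  have h := @is_derive1_comp _ expR -%R y _ _ (is_derive_expR _) (is_deriveNid _ _).
  have -> : (fun z : R => 1 + expR (- z)) = (fun=> 1) + (expR \o -%R) by [].
  by apply: is_derive_eq; rewrite add0r mulrN1.
have := @is_deriveV _ (fun z => 1 + expR (- z)) y _ _ n0 d1.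
rewrite (_ : _ *: _ = logi y - logi y ^+ 2)// /GRing.scale /= /logi.
by field; rewrite gt_eqF// addr_gt0.
Qed.

Lemma is_derive_poly_logi p (y : R) : is_derive y 1 (fun z => p.[logi z]) (dp p).[logi y].
Proof.
have := @is_derive1_comp _ (horner p) logi y _ _ (is_derive_poly _ _) (is_derive_logi y).
by rewrite /dp /Vp hornerM hornerD hornerN hornerX hornerXn.
Qed.

Lemma poly_logi_bound p : exists M, forall y, `|p.[logi y]| <= M.
Proof.
exists (\sum_(i < size p) `|p`_i|) => y; rewrite horner_coef.
rewrite (le_trans (ler_norm_sum _ _ _))//; apply: ler_sum => i _.
rewrite normrM [X in _ * X]ger0_norm ?exprn_ge0 ?(ltW (logi_gt0 _))//.
by rewrite ler_piMr// exprn_ile1// ltW// ?logi_gt0 ?logi_lt1.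
Qed.

Lemma is_derive_poly_logi_coord p (x e y : R) :
  is_derive y 1 (fun y => p.[logi ((x - y) / e)]) (- e^-1 * (dp p).[logi ((x - y) / e)]).
Proof.
have h : is_derive y 1 (fun y : R => (x - y) / e) (- e^-1).
  have -> : (fun y : R => (x - y) / e) = e^-1 \*: ((fun=> x) - (@id R)).
    by apply/funext => u; rewrite /GRing.scale /= mulrC.
  by apply: is_derive_eq; rewrite /GRing.scale /= sub0r mulrN1.
have := @is_derive1_comp _ (fun z => p.[logi z]) (fun y => (x - y) / e) y _ _ (is_derive_poly_logi p _) h.
by rewrite mulrC.
Qed.

End logistic.

Section empirical.
Variables (R : realType) (N : nat).
Implicit Types (p : {poly R}) (xi : 'rV[R]_N).

(* Since logi' = logi - logi ^+ 2, the family [emp p] is closed under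
   differentiation: the x-derivative of [emp p] is [e^-1 * emp (dp p)]. *)
Definition emp p (e x : R) xi : R := N%:R^-1 * \sum_(i < N) p.[logi ((x - xi ord0 i) / e)].

Lemma C2b_emp p e x : C2b (emp p e x)
  (fun j xi => N%:R^-1 * (- e^-1 * (dp p).[logi ((x - xi ord0 j) / e)]))
  (fun j k xi => if k == j then N%:R^-1 * (e^-1 ^+ 2 * (dp (dp p)).[logi ((x - xi ord0 j) / e)]) else 0).
Proof.
pose g (y : R) := N%:R^-1 * p.[logi ((x - y) / e)].
pose g1 (y : R) := N%:R^-1 * (- e^-1 * (dp p).[logi ((x - y) / e)]).
pose g2 (y : R) := N%:R^-1 * (e^-1 ^+ 2 * (dp (dp p)).[logi ((x - y) / e)]).
have dg q (c y : R) : is_derive y 1 (fun y => c * q.[logi ((x - y) / e)]) (c * (- e^-1 * (dp q).[logi ((x - y) / e)])).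
  by have := is_derive_poly_logi_coord q x e y => h; exact: (@is_deriveZ _ _ _ _ c y 1 _ h).
have [M0 B0] := poly_logi_bound p.
have [M1 B1] := poly_logi_bound (dp p).
have [M2 B2] := poly_logi_bound (dp (dp p)).
have cg2 : continuous g2.
  move=> y; apply/differentiable_continuous/derivable1_diffP.
  have -> : g2 = (fun y => (N%:R^-1 * e^-1 ^+ 2) * (dp (dp p)).[logi ((x - y) / e)]).
    by apply/funext => u; rewrite /g2 mulrA.
  exact: (@ex_derive _ _ _ _ _ _ _ (dg _ _ _)).
have d1 (y : R) : is_derive y 1 g (g1 y) by exact: dg.
have d2 (y : R) : is_derive y 1 g1 (g2 y).
  have -> : g1 = (fun y => (N%:R^-1 * - e^-1) * (dp p).[logi ((x - y) / e)]).
    by apply/funext => u; rewrite /g1 mulrA.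
  have := dg (dp p) (N%:R^-1 * - e^-1) y; suff -> : g2 y = N%:R^-1 * - e^-1 * (- e^-1 * (dp (dp p)).[logi ((x - y) / e)]) by [].
  by rewrite /g2; ring.
have := @C2b_sum R N _ (index_enum 'I_N) (fun i xi => g (xi ord0 i)) _ _ (fun i =>
  @C2b_coord R N g g1 g2 (`|N%:R^-1| * `|M0| + `|N%:R^-1 * - e^-1| * `|M1| + `|N%:R^-1 * e^-1 ^+ 2| * `|M2|) i d1 d2 cg2 _).
have B y : `|g y| <= `|N%:R^-1| * `|M0| + `|N%:R^-1 * - e^-1| * `|M1| + `|N%:R^-1 * e^-1 ^+ 2| * `|M2| /\
  `|g1 y| <= `|N%:R^-1| * `|M0| + `|N%:R^-1 * - e^-1| * `|M1| + `|N%:R^-1 * e^-1 ^+ 2| * `|M2| /\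
  `|g2 y| <= `|N%:R^-1| * `|M0| + `|N%:R^-1 * - e^-1| * `|M1| + `|N%:R^-1 * e^-1 ^+ 2| * `|M2|.
  set a := `|N%:R^-1| * _; set b := _ * `|M1|; set c := _ * `|M2|.
  have a0 : 0 <= a by exact: mulr_ge0.
  have b0 : 0 <= b by exact: mulr_ge0.
  have c0 : 0 <= c by exact: mulr_ge0.
  have h1 : `|g y| <= a by rewrite /g normrM ler_wpM2l// (le_trans (B0 _))// ler_norm.
  have h2 : `|g1 y| <= b by rewrite /g1 mulrA normrM ler_wpM2l// (le_trans (B1 _))// ler_norm.
  have h3 : `|g2 y| <= c by rewrite /g2 mulrA normrM ler_wpM2l// (le_trans (B2 _))// ler_norm.
  by split; [|split]; lra.
move=> /(_ B).
have -> : (fun xi => \sum_(k <- index_enum 'I_N) g (xi ord0 k)) = emp p e x.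
  by apply/funext => xi; rewrite /emp mulr_sumr.
have -> : (fun j xi => \sum_(k <- index_enum 'I_N) if j == k then g1 (xi ord0 k) else 0) =
  (fun j xi => N%:R^-1 * (- e^-1 * (dp p).[logi ((x - xi ord0 j) / e)])).
  apply/funext => j; apply/funext => xi; rewrite (bigD1 j)//= eqxx big1 ?addr0// => k kj.
  by rewrite eq_sym (negbTE kj).
have -> // : (fun j l xi => \sum_(k <- index_enum 'I_N) if j == k then if l == k then g2 (xi ord0 k) else 0 else 0) =
  (fun j k xi => if k == j then N%:R^-1 * (e^-1 ^+ 2 * (dp (dp p)).[logi ((x - xi ord0 j) / e)]) else 0).
apply/funext => j; apply/funext => l; apply/funext => xi; rewrite (bigD1 j)//= eqxx big1 ?addr0// => k kj.
by rewrite [j == k]eq_sym (negbTE kj).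
Qed.

Lemma is_C2b_emp p e x : is_C2b (emp p e x).
Proof. by do 2 eexists; exact: C2b_emp. Qed.

End empirical.

(** * Inequalities for the jump sum *)

Section combinatorics.
Variables (R : realType) (N : nat) (h : 'I_N -> R).
Hypothesis N2 : (2 <= N)%N.
Hypothesis h01 : forall i, 0 <= h i <= 1.

Variable n : R.
Hypothesis nE : n = N%:R.

Let n2 : 2 <= n. Proof. by rewrite nE ler_nat. Qed.

Let n1 : N.-1%:R = n - 1 :> R.
Proof. by rewrite nE -[in RHS](prednK (ltnW N2)) -natr1 addrK. Qed.

Let sumc (c : R) : \sum_(i < N) c = n * c.
Proof. by rewrite sumr_const card_ord -mulr_natl nE. Qed.

(** The summand of [Sm] is [min a b - a * b], because [|a - b| = a + b - 2 * min a b]; for [a] and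
    [b] in [0, 1] it lies between 0 and [a - a ^+ 2]. This accounts for the first error term. The
    second pays for normalising by [N.-1] where the mean field has [N]. *)
Lemma gini_mean_bound :
  `|- (2 * n * N.-1%:R)^-1 * (\sum_(i < N) \sum_(j < N) `|h i - h j|)
    - ((n^-1 * \sum_(i < N) h i) ^+ 2 - n^-1 * \sum_(i < N) h i)|
  <= n^-1 * (\sum_(i < N) (h i - h i ^+ 2)) + N.-1%:R^-1.
Proof.
set S := \sum_(i < N) \sum_(j < N) _; set s := \sum_(i < N) h i; set v := \sum_(i < N) _.
pose Sm := \sum_(i < N) \sum_(j < N) (2^-1 * (h i + h j) - h i * h j - 2^-1 * `|h i - h j|).
have SmE : Sm = n * s - s ^+ 2 - 2^-1 * S.
  rewrite /Sm (eq_bigr (fun i => (2^-1 * (n * h i + s) - h i * s) - 2^-1 * \sum_(j < N) `|h i - h j|)).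
    rewrite sumrB sumrB -mulr_sumr -mulr_sumr -mulr_suml big_split /= -mulr_sumr sumc -/s -/S.
    by field.
  move=> i _; rewrite sumrB sumrB -!mulr_sumr big_split /= sumc; congr (_ - _ - _).
have Sm0 : 0 <= Sm.
  apply: sumr_ge0 => i _; apply: sumr_ge0 => j _.
  have /andP[a0 a1] := h01 i; have /andP[b0 b1] := h01 j.
  by case: (lerP (h i) (h j)) => hij; nra.
have Smv : Sm <= n * v.
  rewrite /v mulr_sumr; apply: ler_sum => i _; rewrite -sumc; apply: ler_sum => j _.
  have /andP[a0 a1] := h01 i; have /andP[b0 b1] := h01 j.
  by case: (lerP (h i) (h j)) => hij; nra.
have S0 : 0 <= S by apply: sumr_ge0 => i _; apply: sumr_ge0.
have S1 : S <= n * n.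
  rewrite -sumc; apply: ler_sum => i _; rewrite -[n]mulr1 -sumc; apply: ler_sum => j _.
  have /andP[a0 a1] := h01 i; have /andP[b0 b1] := h01 j.
  by rewrite ler_norml; apply/andP; split; lra.
rewrite n1.
have nn : 0 < n by rewrite (lt_le_trans _ n2).
have n1p : 0 < n - 1 by rewrite subr_gt0 (lt_le_trans _ n2)// ltr1n.
have -> : - (2 * n * (n - 1))^-1 * S - ((n^-1 * s) ^+ 2 - n^-1 * s) = n^-1 ^+ 2 * Sm - (2 * (n - 1))^-1 * (n^-1 ^+ 2 * S).
  rewrite SmE; field.
  by rewrite !gt_eqF.
have h1 : n^-1 ^+ 2 * Sm <= n^-1 * v.
  have -> : n^-1 * v = n^-1 ^+ 2 * (n * v) by field; rewrite gt_eqF.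
  by rewrite ler_wpM2l// exprn_ge0// invr_ge0 ltW.
have h2 : n^-1 ^+ 2 * S <= 1.
  have -> : 1 = n^-1 ^+ 2 * (n * n) by field; rewrite gt_eqF.
  by rewrite ler_wpM2l// exprn_ge0// invr_ge0 ltW.
have h3 : 0 <= n^-1 ^+ 2 * S by rewrite mulr_ge0// exprn_ge0// invr_ge0 ltW.
have h4 : 0 <= n^-1 ^+ 2 * Sm by rewrite mulr_ge0// exprn_ge0// invr_ge0 ltW.
have h5 : (2 * (n - 1))^-1 = 2^-1 * (n - 1)^-1 by rewrite invfM.
have h6 : 0 < (n - 1)^-1 by rewrite invr_gt0.
rewrite h5 ler_norml; move: h1 h2 h3 h4 h6; set q := (n - 1)^-1; set A := _ * Sm; set B := _ * S.
move=> h1 h2 h3 h4 h6; have h7 : q * B <= q by nra.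
have h8 : 0 <= q * B by nra.
by apply/andP; split; lra.
Qed.

(** Off the diagonal, [|a - b| <= (1 - a) + (1 - b)]; leaving the diagonal out of this bound makes
    the normalisation by [N.-1] give exactly the constant 1. It says that jumps carry mass to the
    right at a rate at most the mass already there. *)
Lemma gini_le_compl :
  (2 * n * N.-1%:R)^-1 * (\sum_(i < N) \sum_(j < N) `|h i - h j|)
  <= 1 - n^-1 * \sum_(i < N) h i.
Proof.
have nn : 0 < n by rewrite (lt_le_trans _ n2).
have n1p : 0 < n - 1 by rewrite subr_gt0 (lt_le_trans _ n2)// ltr1n.
set s := \sum_(i < N) h i.
have H : \sum_(i < N) \sum_(j < N) `|h i - h j| <= 2 * (n - 1) * (n - s).
  apply: (@le_trans _ _ (\sum_(i < N) \sum_(j < N | j != i) ((1 - h i) + (1 - h j)))).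
    apply: ler_sum => i _; rewrite (bigD1 i)//= subrr normr0 add0r.
    apply: ler_sum => j _.
    have /andP[a0 a1] := h01 i; have /andP[b0 b1] := h01 j.
    by rewrite ler_norml; apply/andP; split; lra.
  rewrite (eq_bigr (fun i => (n - 2) * (1 - h i) + (n - s))); last first.
    move=> i _.
    have : \sum_(j < N) (1 - h i + (1 - h j)) = (1 - h i + (1 - h i)) + \sum_(j < N | j != i) (1 - h i + (1 - h j)).
      by rewrite (bigD1 i).
    rewrite big_split /= sumc sumrB sumc -/s; lra.
  rewrite big_split /= sumc -mulr_sumr sumrB sumc -/s; lra.
rewrite n1 mulrC ler_pdivrMr; last by rewrite !mulr_gt0.
apply: (le_trans H).
by rewrite le_eqVlt; apply/orP; left; apply/eqP; field; rewrite gt_eqF.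
Qed.

End combinatorics.

(** * The generator on the smoothed distribution function *)

Section emp_generator.
Variables (R : realType) (N : nat) (e x : R).
Hypotheses (N2 : (2 <= N)%N) (e0 : 0 < e).
Implicit Types (xi : 'rV[R]_N).

Let H xi i := logi ((x - xi ord0 i) / e).

Lemma dpX : dp 'X = Vp R.
Proof. by rewrite /dp derivX mul1r. Qed.

Lemma VpE (y : R) : (Vp R).[y] = y - y ^+ 2.
Proof. by rewrite /Vp hornerD hornerN hornerX hornerXn. Qed.

Lemma dVpE (y : R) : (dp (Vp R)).[y] = (1 - 2 * y) * (y - y ^+ 2).
Proof.
by rewrite /dp hornerM VpE /Vp derivB derivX derivXn hornerD hornerN hornerMn hornerC hornerXn expr1 -mulr_natl.
Qed.

Lemma empX xi : emp 'X e x xi = N%:R^-1 * \sum_(i < N) H xi i.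
Proof. by rewrite /emp; congr (_ * _); apply: eq_bigr => i _; rewrite hornerX. Qed.

Lemma empV xi : emp (Vp R) e x xi = N%:R^-1 * \sum_(i < N) (H xi i - H xi i ^+ 2).
Proof. by rewrite /emp; congr (_ * _); apply: eq_bigr => i _; rewrite VpE. Qed.

Let H01 xi i : 0 <= H xi i <= 1.
Proof. by rewrite !ltW// ?logi_gt0// logi_lt1. Qed.

Let n0 : 0 < N%:R :> R. Proof. by rewrite ltr0n; exact: leq_trans N2. Qed.

Lemma emp_bound p a b xi : (forall y, 0 <= y <= 1 -> a <= p.[y] <= b) -> a <= emp p e x xi <= b.
Proof.
move=> pab; rewrite /emp mulrC ler_pdivlMr// ler_pdivrMr//.
have sc (c : R) : c * N%:R = \sum_(i < N) c by rewrite sumr_const card_ord mulr_natr.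
by rewrite !sc; apply/andP; split; apply: ler_sum => i _; have /andP[] := pab _ (H01 xi i).
Qed.

Lemma empX01 xi : 0 <= emp 'X e x xi <= 1.
Proof. by apply: emp_bound => y; rewrite hornerX. Qed.

Lemma empV01 xi : 0 <= emp (Vp R) e x xi <= 1.
Proof. by apply: emp_bound => y /andP[y0 y1]; rewrite VpE; nra. Qed.

Lemma empW01 xi : -1 <= emp (dp (Vp R)) e x xi <= 1.
Proof.
apply: emp_bound => y /andP[y0 y1]; rewrite dVpE.
have v0 : 0 <= y - y ^+ 2 by nra.
have v1 : y - y ^+ 2 <= 1 by nra.
by apply/andP; split; nra.
Qed.

(** The smoothed indicator decreases in the position of a particle, so moving both particles to the
    maximum replaces both values by the minimum, and [a + b - 2 * min a b = |a - b|]. *)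
Lemma emp_theta xi i j : j != i ->
  emp 'X e x (theta i j xi) - emp 'X e x xi = - (N%:R^-1 * `|H xi i - H xi j|).
Proof.
move=> ji; rewrite !empX -mulrBr -mulrN; congr (_ * _).
rewrite (bigD1 i)//= (bigD1 j)//= [X in _ - X](bigD1 i)//= [X in _ - (_ + X)](bigD1 j)//=.
have -> : \sum_(k < N | (k != i) && (k != j)) H (theta i j xi) k = \sum_(k < N | (k != i) && (k != j)) H xi k.
  by apply: eq_bigr => k /andP[ki kj]; rewrite /H /theta mxE (negbTE ki) (negbTE kj).
have -> : H (theta i j xi) i = H (theta i j xi) j.
  by rewrite /H /theta !mxE !eqxx orbT.
have -> : H (theta i j xi) j = Num.min (H xi i) (H xi j).
  rewrite /H /theta !mxE eqxx orbT.
  case: (leP (xi ord0 i) (xi ord0 j)) => hij.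
    rewrite min_r//; apply: logi_nd; rewrite ler_pM2r ?invr_gt0//; lra.
  rewrite min_l//; apply: logi_nd; rewrite ler_pM2r ?invr_gt0//; lra.
by case: (leP (H xi i) (H xi j)) => hij; [rewrite ler0_norm ?subr_le0//|rewrite gtr0_norm ?subr_gt0//]; ring.
Qed.

(** At once the sum of the second derivatives in the particles and the second derivative in [x], as
    the smoothing depends on differences [x - xi_i]: this turns the diffusion of the particles into
    a heat operator in [x]. *)
Definition lapl xi : R := e^-1 ^+ 2 * emp (dp (Vp R)) e x xi.

Definition jumpf xi : R := - (2 * N%:R * N.-1%:R)^-1 * (\sum_(i < N) \sum_(j < N) `|H xi i - H xi j|).

Let drop_diag xi : \sum_(i < N) \sum_(j < N | j != i) `|H xi i - H xi j| = \sum_(i < N) \sum_(j < N) `|H xi i - H xi j|.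
Proof. by apply: eq_bigr => i _; rewrite [RHS](bigD1 i)//= subrr normr0 add0r. Qed.

Lemma gen_emp xi : gen (emp 'X e x) xi = 2^-1 * lapl xi + jumpf xi.
Proof.
rewrite (genE (C2b_emp N 'X e x)) dpX; congr (_ * _ + _).
  rewrite /lapl /emp mulrCA !mulr_sumr; apply: eq_bigr => i _.
  by rewrite eqxx.
rewrite (eq_bigr (fun i => - N%:R^-1 * \sum_(j < N | j != i) `|H xi i - H xi j|)); last first.
  by move=> i _; rewrite mulr_sumr; apply: eq_bigr => j ji; rewrite emp_theta// mulNr.
by rewrite -mulr_sumr drop_diag mulrA /jumpf mulrN !invfM; congr (_ * _); ring.
Qed.

Lemma jumpf_le0 xi : jumpf xi <= 0.
Proof.
rewrite /jumpf mulNr oppr_le0 mulr_ge0// ?invr_ge0 ?mulr_ge0//.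
by apply: sumr_ge0 => i _; apply: sumr_ge0.
Qed.

Lemma jumpf_ge xi : - (1 - emp 'X e x xi) <= jumpf xi.
Proof. by rewrite /jumpf mulNr lerN2 empX; exact: (gini_le_compl N2 (H01 xi) erefl). Qed.

Lemma jumpf_bound xi : `|jumpf xi - (emp 'X e x xi ^+ 2 - emp 'X e x xi)| <= emp (Vp R) e x xi + N.-1%:R^-1.
Proof. by rewrite /jumpf empX empV; exact: (gini_mean_bound N2 (H01 xi) erefl). Qed.

(** The excess over the chain rule is the carre du champ: [N] partial derivatives of size at most
    [N^-1 * e^-1], and jumps of size at most [N^-1] at total rate [N / 2]. *)
Lemma gen_emp_sqr xi : gen (fun xi => emp 'X e x xi * emp 'X e x xi) xi <=
  2 * emp 'X e x xi * gen (emp 'X e x) xi + N%:R^-1 * (e^-1 ^+ 2 + 2^-1).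
Proof.
have C := C2b_emp N 'X e x; rewrite (genE (C2bM C C)) (genE C) dpX.
set f := emp 'X e x; pose D i := N%:R^-1 * (e^-1 ^+ 2 * (dp (Vp R)).[H xi i]).
set c := (2 * _)^-1; set J := (X in _ <= 2 * _ * (_ + c * X) + _).
set SR := (X in _ <= 2 * _ * (2^-1 * X + _) + _); set SL := (X in 2^-1 * X + _ <= _).
have E0 : SR = \sum_(i < N) D i by apply: eq_bigr => i _; rewrite eqxx.
have p01 : (N%:R - 1 : R) = N.-1%:R by rewrite -[in LHS](prednK (ltnW N2)) -natr1 addrK.
have p0 : 0 < N.-1%:R :> R by rewrite ltr0n -ltnS (prednK (ltnW N2)).
have c0 : 0 <= c by rewrite invr_ge0 mulr_ge0.
pose g i := N%:R^-1 * (- e^-1 * (Vp R).[H xi i]).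
have E1 : SL = 2 * (f xi * SR + \sum_(i < N) g i ^+ 2).
  rewrite E0 mulr_sumr -big_split /= mulr_sumr; apply: eq_bigr => i _; rewrite eqxx /D /g /H; ring.
have E2 : \sum_(i < N) g i ^+ 2 <= N%:R^-1 * e^-1 ^+ 2.
  have -> : N%:R^-1 * e^-1 ^+ 2 = \sum_(i < N) (N%:R^-1 * e^-1) ^+ 2.
    by rewrite sumr_const card_ord -mulr_natl; field; rewrite !gt_eqF.
  apply: ler_sum => i _; have /andP[a0 a1] := H01 xi i.
  have -> : g i ^+ 2 = (N%:R^-1 * e^-1) ^+ 2 * (Vp R).[H xi i] ^+ 2 by rewrite /g; ring.
  by rewrite ler_piMr ?sqr_ge0// VpE exprn_ile1//; nra.
have E3 : \sum_(i < N) \sum_(j < N | j != i) (f (theta i j xi) * f (theta i j xi) - f xi * f xi) <=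
   2 * f xi * J + N%:R * N.-1%:R * N%:R^-1 ^+ 2.
  have -> : N%:R * N.-1%:R * N%:R^-1 ^+ 2 = \sum_(i < N) \sum_(j < N | j != i) N%:R^-1 ^+ 2 :> R.
    rewrite (eq_bigr (fun i => N.-1%:R * N%:R^-1 ^+ 2)).
      by rewrite sumr_const card_ord -mulrA mulr_natl.
    move=> i _; have : \sum_(j < N) N%:R^-1 ^+ 2 = N%:R^-1 ^+ 2 + \sum_(j < N | j != i) N%:R^-1 ^+ 2 :> R.
      by rewrite (bigD1 i).
    by rewrite sumr_const card_ord -mulr_natl -p01; lra.
  rewrite /J !mulr_sumr -big_split /=; apply: ler_sum => i _.
  rewrite mulr_sumr -big_split /=; apply: ler_sum => j ji.
  have := emp_theta xi ji; rewrite -/f => E.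
  have -> : f (theta i j xi) = f xi - N%:R^-1 * `|H xi i - H xi j| by lra.
  have : (N%:R^-1 * `|H xi i - H xi j|) ^+ 2 <= N%:R^-1 ^+ 2.
    rewrite exprMn ler_piMr ?sqr_ge0// exprn_ile1//.
    have /andP[a0 a1] := H01 xi i; have /andP[b0 b1] := H01 xi j.
    by rewrite ler_norml; apply/andP; split; lra.
  by move: (N%:R^-1 * _) => q; nra.
apply: (@le_trans _ _ (2^-1 * (2 * (f xi * SR + N%:R^-1 * e^-1 ^+ 2)) + c * (2 * f xi * J + N%:R * N.-1%:R * N%:R^-1 ^+ 2))).
  apply: lerD; last by rewrite ler_wpM2l.
  by rewrite ler_wpM2l// E1 ler_wpM2l// lerD2l.
have -> : c * (2 * f xi * J + N%:R * N.-1%:R * N%:R^-1 ^+ 2) = 2 * f xi * (c * J) + N%:R^-1 * 2^-1.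
  by rewrite /c; field; rewrite !gt_eqF.
lra.
Qed.

End emp_generator.

Section gen_linear.
Variables (R : realType) (N : nat).
Implicit Types f g : 'rV[R]_N -> R.

Lemma genD f g x : is_C2b f -> is_C2b g -> gen (fun x => f x + g x) x = gen f x + gen g x.
Proof.
move=> [p1 [p2 Hf]] [q1 [q2 Hg]]; rewrite (genE Hf) (genE Hg) (genE (C2bD Hf Hg)).
rewrite big_split /=; set S := (X in _ + _ * X = _); set S1 := (X in _ = _ + _ * X + _); set S2 := (X in _ = _ + (_ + _ * X)).
suff -> : S = S1 + S2 by ring.
rewrite -big_split; apply: eq_bigr => i _; rewrite -big_split; apply: eq_bigr => j _ /=.
by ring.
Qed.

Lemma genZ k f x : is_C2b f -> gen (fun x => k * f x) x = k * gen f x.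
Proof.
move=> [p1 [p2 Hf]]; rewrite (genE Hf) (genE (C2bM (C2b_cst N k) Hf)).
rewrite (eq_bigr (fun i => k * p2 i i x)); last by move=> i _; ring.
rewrite -mulr_sumr; set S := (X in _ + _ * X = _); set S1 := (X in _ = _ * (_ + _ * X)).
suff -> : S = k * S1 by ring.
rewrite mulr_sumr; apply: eq_bigr => i _; rewrite mulr_sumr; apply: eq_bigr => j _; ring.
Qed.

End gen_linear.

(** * Evolution of the discrepancy *)

Section derivable_approx.
Variable R : realType.

Lemma derivable_approx (f : R -> R) (t eta : R) : derivable f t 1 -> 0 < eta ->
  exists2 dl, 0 < dl & forall h, `|h| < dl -> `|f (t + h) - f t - h * derive1 f t| <= eta * `|h|.
Proof.
move=> df eta0; have : (fun h => h^-1 *: ((f \o shift t) (h *: 1) - f t)) @ 0^' --> derive1 f t.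
  by rewrite derive1E.
move/cvgrPdist_le => /(_ _ eta0) [dl /= dl0 H]; exists dl => // h hd.
have [->|h0] := eqVneq h 0; first by rewrite addr0 subrr mul0r subr0 normr0 mulr0.
have := H h _ h0; rewrite /ball_ /= sub0r normrN => /(_ hd).
rewrite /GRing.scale /= mulr1 (addrC h) => hh.
have -> : f (t + h) - f t - h * derive1 f t = - (h * (derive1 f t - h^-1 * (f (t + h) - f t))).
  by field.
by rewrite normrN normrM mulrC ler_wpM2r.
Qed.

(** The second derivative is assumed at [x] only. One mean value inequality for the symmetric
    difference, followed by the first-order expansion of [derive1 U] at [x], is enough. *)
Lemma second_diff_approx (U : R -> R) (x eta : R) : (forall y, derivable U y 1) ->
  derivable (derive1 U) x 1 -> 0 < eta ->
  exists2 dl, 0 < dl & forall h, 0 < h < dl ->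
   `|U (x + h) + U (x - h) - 2 * U x - h ^+ 2 * derive1 (derive1 U) x| <= eta * h ^+ 2.
Proof.
move=> dU dU' eta0; have eta2 : 0 < eta / 2 by rewrite divr_gt0.
have [dl dl0 H] := derivable_approx dU' eta2.
exists dl => // h /andP[h0 hd].
pose phi (k : R) := U (x + 1 * k) + U (x + (-1) * k) - 2 * U x - k ^+ 2 * derive1 (derive1 U) x.
pose dphi (k : R) := derive1 U (x + 1 * k) - derive1 U (x + (-1) * k) - 2 * k * derive1 (derive1 U) x.
have dc (s t : R) : is_derive t 1 (fun t : R => U (x + s * t)) (s * derive1 U (x + s * t)).
  have h1 : is_derive t 1 (fun t : R => x + s * t) s.
    have -> : (fun t : R => x + s * t) = (fun=> x) + s \*: (@id R) by [].
    by apply: is_derive_eq; rewrite add0r /GRing.scale /= mulr1.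
  have h2 : is_derive (x + s * t) 1 U (derive1 U (x + s * t)) by rewrite derive1E; exact: derivableP.
  by have := @is_derive1_comp _ U (fun t => x + s * t) t _ s h2 h1; rewrite mulrC.
have dphiP (t : R) : is_derive t 1 phi (dphi t).
  have h1 := dc 1 t; have h2 := dc (-1) t.
  have -> : phi = ((fun t => U (x + 1 * t)) + (fun t => U (x + (-1) * t))) - (fun=> 2 * U x) - (derive1 (derive1 U) x) \*: ((@id R) ^+ 2).
    apply/funext => v; change (U (x + 1 * v) + U (x + (-1) * v) - 2 * U x - v ^+ 2 * derive1 (derive1 U) x = U (x + 1 * v) + U (x + (-1) * v) - 2 * U x - derive1 (derive1 U) x * v ^+ 2); ring.
  by apply: is_derive_eq; rewrite /dphi /GRing.scale /=; ring.
have := @bounded_derive_incr _ phi dphi (eta * h) h (ltW h0) dphiP.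
have -> : phi 0 = 0 by rewrite /phi !mulr0 addr0; ring.
rewrite subr0 /phi mul1r mulN1r -mulrA -expr2; apply => k /andP[k0 kh].
have kd : `|k| < dl by rewrite ger0_norm// (le_lt_trans kh).
have := H k kd; have := H (- k); rewrite normrN => /(_ kd); rewrite (ger0_norm k0).
rewrite /dphi mul1r mulN1r => H1 H2.
have -> : derive1 U (x + k) - derive1 U (x - k) - 2 * k * derive1 (derive1 U) x =
  (derive1 U (x + k) - derive1 U x - k * derive1 (derive1 U) x) - (derive1 U (x - k) - derive1 U x - - k * derive1 (derive1 U) x) by ring.
rewrite (le_trans (ler_normB _ _))//.
have : eta * k <= eta * h by rewrite ler_wpM2l// ltW.
lra.
Qed.

End derivable_approx.

(** [F], [Fp], [Fm] are the values of the smoothed distribution function at [x], [x + h], [x - h];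
    [u], [up], [um] those of the reference. For [(F - u) ^+ 2] convexity of the square is used,
    which drops the squared gradient of [F - u]. For [e * F ^+ 2] the squared gradient of [F] is
    kept: it is the term that later absorbs the jump error. *)
Lemma energy_second_diff (R : realType) (e M C1 C2 h u up um v a F Fp Fm : R) :
  0 < e -> e <= 1 -> 0 <= M -> 0 <= C2 -> 0 < h -> `|u| <= M -> 0 <= v <= 1 -> 0 <= F <= 1 ->
  `|Fp - F - h * (e^-1 * v)| <= C1 * h ^+ 2 -> `|Fm - F - - h * (e^-1 * v)| <= C1 * h ^+ 2 ->
  `|Fp + Fm - 2 * F - h ^+ 2 * a| <= C2 * h ^+ 3 ->
  h ^+ 2 * (2 * ((F - u) * a) + 2 * e * (F * a + (e^-1 * v) ^+ 2))
    + (- 2 * (up + um - 2 * u)) * (F - u) - (2 * (1 + M) * C2 + 2 * C2 + 4 * C1) * h ^+ 3 <=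
  ((Fp - up) ^+ 2 + e * Fp ^+ 2 + ((Fm - um) ^+ 2 + e * Fm ^+ 2)) - 2 * ((F - u) ^+ 2 + e * F ^+ 2).
Proof.
move=> e0 e1 M0 C20 h0 uM /andP[v0 v1] /andP[F0 F1].
set rp := Fp - F - _; set rm := Fm - F - _; set r2 := _ - h ^+ 2 * a => rpb rmb r2b.
have [u1 u2] : - M <= u /\ u <= M by move: uM; rewrite ler_norml => /andP.
have EFp : Fp = F + h * (e^-1 * v) + rp by rewrite /rp; ring.
have EFm : Fm = F - h * (e^-1 * v) + rm by rewrite /rm; ring.
have c3 : 0 <= C2 * h ^+ 3 by rewrite mulr_ge0// exprn_ge0// ltW.
have cvx : 2 * (F - u) * (h ^+ 2 * a + r2 - (up + um - 2 * u)) <= (Fp - up) ^+ 2 + (Fm - um) ^+ 2 - 2 * (F - u) ^+ 2.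
  have -> : h ^+ 2 * a + r2 = Fp + Fm - 2 * F by rewrite /r2; ring.
  rewrite -subr_ge0.
  have -> : (Fp - up) ^+ 2 + (Fm - um) ^+ 2 - 2 * (F - u) ^+ 2 - 2 * (F - u) * (Fp + Fm - 2 * F - (up + um - 2 * u))
    = ((Fp - up) - (F - u)) ^+ 2 + ((Fm - um) - (F - u)) ^+ 2 by ring.
  by rewrite addr_ge0// sqr_ge0.
have b1 : - ((1 + M) * (C2 * h ^+ 3)) <= (F - u) * r2.
  suff : `|(F - u) * r2| <= (1 + M) * (C2 * h ^+ 3) by rewrite ler_norml => /andP[].
  by rewrite normrM ler_pM// ler_norml; apply/andP; split; lra.
have b2 : - (C2 * h ^+ 3) <= e * (F * r2).
  suff : `|e * (F * r2)| <= C2 * h ^+ 3 by rewrite ler_norml => /andP[].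
  rewrite mulrA normrM (le_trans _ r2b)// ler_piMl// ger0_norm; last by rewrite mulr_ge0// ltW.
  by rewrite mulr_ile1// ltW.
have sq (r s : R) : `|r| <= C1 * h ^+ 2 -> `|s| = 1 ->
    e * (h ^+ 2 * (e^-1 * v) ^+ 2) - 2 * (C1 * h ^+ 3) <= e * (s * (h * (e^-1 * v)) + r) ^+ 2.
  move=> rb s1.
  have s2 : s ^+ 2 = 1 by rewrite -real_normK ?num_real// s1 expr1n.
  have -> : e * (s * (h * (e^-1 * v)) + r) ^+ 2 = e * (s ^+ 2 * (h ^+ 2 * (e^-1 * v) ^+ 2)) + 2 * (h * (v * (s * r))) + e * r ^+ 2.
    by field; rewrite gt_eqF.
  rewrite s2 mul1r.
  have h1 : - (C1 * h ^+ 3) <= h * (v * (s * r)).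
    suff : `|h * (v * (s * r))| <= C1 * h ^+ 3 by rewrite ler_norml => /andP[].
    have -> : C1 * h ^+ 3 = h * (C1 * h ^+ 2) by ring.
    rewrite normrM (gtr0_norm h0) ler_pM2l// normrM (ger0_norm v0) normrM s1 mul1r.
    by rewrite (le_trans _ rb)// ler_piMl.
  have h2 : 0 <= e * r ^+ 2 by rewrite mulr_ge0 ?sqr_ge0// ltW.
  lra.
have sp := sq rp 1 rpb (normr1 _); have sm := sq rm (-1) rmb (normrN1 _).
have eF : e * Fp ^+ 2 + e * Fm ^+ 2 - 2 * (e * F ^+ 2) = 2 * e * (F * (h ^+ 2 * a)) + 2 * (e * (F * r2)) + e * (1 * (h * (e^-1 * v)) + rp) ^+ 2 + e * (-1 * (h * (e^-1 * v)) + rm) ^+ 2.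
  have -> : h ^+ 2 * a = Fp + Fm - 2 * F - r2 by rewrite /r2; ring.
  by rewrite EFp EFm; ring.
move: sp sm eF cvx b1 b2 c3; set X1 := e * (_ + rp) ^+ 2; set X2 := e * (_ + rm) ^+ 2.
set Y := h ^+ 3; set Z := (e^-1 * v) ^+ 2.
move: X1 X2 Y Z; clear; move=> X1 X2 Y Z; lra.
Qed.

(** [T1] and [T2] are the expectations, at the later and the earlier time, of the energy frozen at
    the later value [u]; [a] and [a'] are those of the smoothed distribution function. Half of [eta]
    pays for the expansion of the reference in time, the other half for all terms quadratic in
    [h]. *)
Lemma energy_time_diff (R : realType) (M C L h eta eta1 ut u u' a a' T1 T2 K0 : R) :
  0 <= M -> 0 <= L -> 0 < h -> 0 < eta1 -> eta1 * (2 * M + 2) = eta / 2 ->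
  (C + 2 * (`|ut| + eta1) * L) * h <= eta / 2 -> `|u| <= M -> 0 <= a <= 1 ->
  `|u' - u - - h * ut| <= eta1 * h -> `|a - a'| <= h * L -> T1 - T2 <= h * K0 + C * h ^+ 2 ->
  T1 + u ^+ 2 - (T2 + 2 * (u - u') * a' + u' ^+ 2) <= h * (K0 + ut * (2 * u - 2 * a) + eta).
Proof.
move=> M0 L0 h0 eta10 HeM hG uM /andP[a0 a1] w1 lip inc.
pose w := u - u'; have w2 : `|w - h * ut| <= eta1 * h.
  by rewrite -normrN; have -> : - (w - h * ut) = u' - u - - h * ut by rewrite /w; ring.
have w3 : (w - h * ut) * (2 * u - 2 * a) <= eta1 * h * (2 * M + 2).
  rewrite (le_trans (ler_norm _))// normrM ler_pM//.
  move: uM; rewrite !ler_norml => /andP[? ?]; apply/andP; split; lra.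
have w4 : w * (a - a') <= (`|ut| + eta1) * L * h ^+ 2.
  have -> : (`|ut| + eta1) * L * h ^+ 2 = ((`|ut| + eta1) * h) * (h * L) by ring.
  rewrite (le_trans (ler_norm _))// normrM ler_pM//.
  have -> : w = (w - h * ut) + h * ut by ring.
  by rewrite (le_trans (ler_normD _ _))// normrM (gtr0_norm h0) mulrDl addrC (mulrC h) lerD2l.
have w5 : 0 <= w ^+ 2 by exact: sqr_ge0.
have E1 : u ^+ 2 - (2 * (u - u') * a' + u' ^+ 2) = h * (ut * (2 * u - 2 * a)) + (w - h * ut) * (2 * u - 2 * a) + 2 * (w * (a - a')) - w ^+ 2.
  by rewrite /w; ring.
have E2 : eta1 * h * (2 * M + 2) = h * (eta / 2) by rewrite -HeM; ring.
have E3 : C * h ^+ 2 + 2 * ((`|ut| + eta1) * L * h ^+ 2) <= h * (eta / 2).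
  have -> : C * h ^+ 2 + 2 * ((`|ut| + eta1) * L * h ^+ 2) = h * ((C + 2 * (`|ut| + eta1) * L) * h) by ring.
  by rewrite ler_pM2l.
lra.
Qed.

Section parabolic_bounds.
Variable R : realType.

(* Differentiability of the discrepancy is not available; bounds on difference
   quotients are enough for the maximum principle. *)
Definition dt_le (D : R -> R -> R) (t x kap : R) := forall eta, 0 < eta ->
  exists2 dl, 0 < dl & forall h, 0 < h < dl -> h <= t -> D t x - D (t - h) x <= h * (kap + eta).

Definition dxx_ge (D : R -> R -> R) (t x nu : R) := forall eta, 0 < eta ->
  exists2 dl, 0 < dl & forall h, 0 < h < dl ->
    h ^+ 2 * (nu - eta) <= D t (x + h) + D t (x - h) - 2 * D t x.

End parabolic_bounds.

Section discrepancy.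
Context (R : realType) (N : nat) d (Omega : measurableType d).
Variables (P : probability Omega R) (xi : R -> Omega -> 'rV[R]_N).
Hypothesis HL : is_L_process P xi.
Hypothesis N2 : (2 <= N)%N.
Variables (e : R).
Hypotheses (e0 : 0 < e) (e1 : e <= 1).

Local Notation E := (Ex P xi).
Local Notation f := (emp 'X e).
Local Notation V := (emp (Vp R) e).
Local Notation A := (lapl e).

(* [N.-1^-1] comes from the missing diagonal of the jump sum, the other term from
   the carre du champ of [f x]. *)
Definition noise : R := N.-1%:R^-1 + N%:R^-1 * (e^-1 ^+ 2 + 2^-1).

Lemma is_C2b_lapl x : is_C2b (@lapl R N e x).
Proof. by apply: is_C2bM; [exact: is_C2b_cst|exact: is_C2b_emp]. Qed.

(** The energy [(f - c) ^+ 2 + e * f ^+ 2] without its constant [c ^+ 2]: with the reference frozen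
    at [c] it does not depend on time, and Dynkin's formula applies. *)
Definition testf (c x : R) (z : 'rV[R]_N) := (1 + e) * (f x z * f x z) + (- 2 * c) * f x z.

(** A smooth majorant, up to [noise], of the generator on [testf]. In the part from [(f - c) ^+ 2]
    the jumps are replaced by [f ^+ 2 - f], at the price [2 * (1 + M) * V]; in the part from
    [e * f ^+ 2] they contribute a nonpositive term, which is dropped. *)
Definition testK (M c x : R) (z : 'rV[R]_N) :=
  (f x z - c) * A x z + 2 * ((f x z - c) * (f x z ^+ 2 - f x z)) + e * (f x z * A x z)
  + 2 * (1 + M) * V x z.

Lemma is_C2b_testf c x : is_C2b (testf c x).
Proof.
apply: is_C2bD; apply: is_C2bM; try exact: is_C2b_cst; last exact: is_C2b_emp.
by apply: is_C2bM; exact: is_C2b_emp.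
Qed.

Lemma is_C2b_fc c x : is_C2b (fun z : 'rV[R]_N => f x z - c).
Proof. by apply: is_C2bB; [exact: is_C2b_emp|exact: is_C2b_cst]. Qed.

Lemma is_C2b_f2f x : is_C2b (fun z : 'rV[R]_N => f x z ^+ 2 - f x z).
Proof. by apply: is_C2bB; [apply: is_C2bX|]; exact: is_C2b_emp. Qed.

Lemma is_C2b_testK M c x : is_C2b (testK M c x).
Proof.
apply: is_C2bD; last by apply: is_C2bM; [exact: is_C2b_cst|exact: is_C2b_emp].
apply: is_C2bD; last first.
  by apply: is_C2bM; [exact: is_C2b_cst|apply: is_C2bM; [exact: is_C2b_emp|exact: is_C2b_lapl]].
apply: is_C2bD; first by apply: is_C2bM; [exact: is_C2b_fc|exact: is_C2b_lapl].
by apply: is_C2bM; [exact: is_C2b_cst|apply: is_C2bM; [exact: is_C2b_fc|exact: is_C2b_f2f]].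
Qed.

Lemma gen_testf M c x z : `|c| <= M ->
  gen (testf c x) z <= testK M c x z + 2 * (2 + M) * noise.
Proof.
move=> cM; have bf := is_C2b_emp N 'X e x.
have bff : is_C2b (fun z : 'rV[R]_N => f x z * f x z) by exact: is_C2bM.
rewrite /testf genD; [|by apply: is_C2bM => //; exact: is_C2b_cst|by apply: is_C2bM => //; exact: is_C2b_cst].
rewrite (genZ _ z bff) (genZ _ z bf).
have h2 := gen_emp_sqr (e := e) x N2 e0 z; have hE := gen_emp (N := N) x e0 z.
have J0 := jumpf_le0 e x z; have JB := jumpf_bound e x N2 z.
have := empX01 e x N2 z; have := empV01 e x N2 z.
move: h2 hE J0 JB; rewrite /testK /noise.
set F := f x z; set G := gen (f x) z; set G2 := gen _ z; set a := A x z; set J := jumpf _ _ _; set v := V x z.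
set p := N.-1%:R^-1; set r := N%:R^-1 * _.
move=> h2 hE J0; rewrite ler_norml => /andP[JB1 JB2] /andP[v0 v1] /andP[F0 F1].
have p0 : 0 <= p by rewrite invr_ge0.
have r0 : 0 <= r by rewrite mulr_ge0// ?invr_ge0// addr_ge0// exprn_ge0// invr_ge0 ltW.
move: cM; rewrite ler_norml => /andP[c1 c2].
have M0 : 0 <= M by lra.
have k1 : G2 <= F * a + r by rewrite hE in h2; nra.
have k0 : e * G2 <= e * (F * a + r) by rewrite ler_wpM2l// ltW.
have k2 : (1 + e) * G2 <= 2 * F * G + r + e * (F * a + r) by lra.
have k3 : (F - c) * J <= (F - c) * (F ^+ 2 - F) + (1 + M) * (v + p).
  have : (F - c) * (J - (F ^+ 2 - F)) <= (1 + M) * (v + p).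
    apply: le_trans (ler_norm _) _; rewrite normrM; apply: ler_pM => //.
      by rewrite ler_norml; apply/andP; split; lra.
    by rewrite ler_norml; apply/andP; split.
  lra.
have k4 : e * r <= r by rewrite ler_piMl.
have k5 : 0 <= M * r by exact: mulr_ge0.
have k6 : 0 <= M * p by exact: mulr_ge0.
have -> : 2 * (2 + M) * (p + r) = 2 * (1 + M) * p + 2 * p + 4 * r + 2 * (M * r) by ring.
have k7 : 2 * F * G - 2 * c * G = (F - c) * a + 2 * ((F - c) * J) by rewrite hE; field.
lra.
Qed.

Lemma testf_incr M c x : `|c| <= M -> exists2 C, 0 <= C & forall s t, 0 <= s -> s <= t ->
  E (testf c x) t - E (testf c x) s <= (t - s) * (E (testK M c x) t + 2 * (2 + M) * noise) + C * (t - s) ^+ 2.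
Proof.
move=> cM.
have bK : is_C2b (fun z => testK M c x z + 2 * (2 + M) * noise).
  by apply: is_C2bD; [exact: is_C2b_testK|exact: is_C2b_cst].
have [C C0 H] := Ex_incr_le HL (is_C2b_testf c x) bK (fun z => gen_testf x z cM).
exists C => // s t s0 st; have := H s t s0 st; by rewrite (ExD HL (is_C2b_bmeas (is_C2b_testK M c x)) (bmeas_cst _ _) (le_trans s0 st)) Ex_cst.
Qed.


Lemma logi_lip (a b : R) : `|logi a - logi b| <= `|a - b|.
Proof.
wlog ab : a b / b <= a => [hw|].
  by have [/hw//|/ltW/hw] := leP b a; rewrite distrC [leRHS]distrC.
have [|c _ ->] := MVT_segment ab (fun x _ => is_derive_logi x).
  apply/continuous_subspaceT => x.
  by apply/differentiable_continuous/derivable1_diffP; have := is_derive_logi x => h; apply: ex_derive.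
have l0 := logi_gt0 c; have l1 := logi_lt1 c.
by rewrite normrM ler_piMl// ler_norml; apply/andP; split; nra.
Qed.

Let n0 : 0 < N%:R :> R. Proof. by rewrite ltr0n; exact: leq_trans N2. Qed.

Lemma norm_mean_le (g : 'I_N -> R) (B : R) : (forall i, `|g i| <= B) -> `|N%:R^-1 * \sum_(i < N) g i| <= B.
Proof.
move=> gB; rewrite normrM gtr0_norm ?invr_gt0// mulrC ler_pdivrMr//.
have -> : B * N%:R = \sum_(i < N) B by rewrite sumr_const card_ord mulr_natr.
by rewrite (le_trans (ler_norm_sum _ _ _))//; apply: ler_sum => i _; exact: gB.
Qed.

Lemma emp_lip x y (z : 'rV[R]_N) : `|f x z - f y z| <= e^-1 * `|x - y|.
Proof.
rewrite !empX -mulrBr -sumrB; apply: norm_mean_le => i.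
rewrite (le_trans (logi_lip _ _))// -mulrBl normrM mulrC gtr0_norm ?invr_gt0//.
by have -> : x - z ord0 i - (y - z ord0 i) = x - y by ring.
Qed.

Lemma emp_taylor1 : exists2 C, 0 <= C & forall x h (z : 'rV[R]_N),
  `|f (x + h) z - f x z - h * (e^-1 * V x z)| <= C * h ^+ 2.
Proof.
have [C HC] := poly_logi_bound (dp (dp ('X : {poly R}))).
have C0 : 0 <= C by rewrite (le_trans _ (HC 0)).
exists (C * e^-1 ^+ 2); first by rewrite mulr_ge0// exprn_ge0// invr_ge0 ltW.
move=> x h z; rewrite /emp.
have -> : N%:R^-1 * (\sum_(i < N) 'X.[logi ((x + h - z ord0 i) / e)]) - N%:R^-1 * (\sum_(i < N) 'X.[logi ((x - z ord0 i) / e)])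
   - h * (e^-1 * (N%:R^-1 * \sum_(i < N) (Vp R).[logi ((x - z ord0 i) / e)])) =
  N%:R^-1 * \sum_(i < N) ('X.[logi ((x - z ord0 i) / e + h / e)] - 'X.[logi ((x - z ord0 i) / e)] - h / e * (dp 'X).[logi ((x - z ord0 i) / e)]).
  rewrite !sumrB -mulr_sumr dpX.
  have -> : \sum_(i < N) 'X.[logi ((x + h - z ord0 i) / e)] = \sum_(i < N) 'X.[logi ((x - z ord0 i) / e + h / e)].
    by apply: eq_bigr => i _; congr ('X.[logi _]); ring.
  ring.
apply: norm_mean_le => i.
have -> : C * e^-1 ^+ 2 * h ^+ 2 = C * (h / e) ^+ 2 by ring.
exact: (taylor1_bound _ _ (is_derive_poly_logi _) (is_derive_poly_logi _) HC).
Qed.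

Lemma emp_taylor2 : exists2 C, 0 <= C & forall x h (z : 'rV[R]_N), 0 <= h ->
  `|f (x + h) z + f (x - h) z - 2 * f x z - h ^+ 2 * A x z| <= C * h ^+ 3.
Proof.
have [C HC] := poly_logi_bound (dp (dp (dp ('X : {poly R})))).
have C0 : 0 <= C by rewrite (le_trans _ (HC 0)).
have ei : 0 <= e^-1 by rewrite invr_ge0 ltW.
exists (2 * C * e^-1 ^+ 3); first by rewrite !mulr_ge0// exprn_ge0.
move=> x h z h0; rewrite /lapl /emp.
have -> : N%:R^-1 * (\sum_(i < N) 'X.[logi ((x + h - z ord0 i) / e)]) + N%:R^-1 * (\sum_(i < N) 'X.[logi ((x - h - z ord0 i) / e)])
   - 2 * (N%:R^-1 * (\sum_(i < N) 'X.[logi ((x - z ord0 i) / e)]))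
   - h ^+ 2 * (e^-1 ^+ 2 * (N%:R^-1 * \sum_(i < N) (dp (Vp R)).[logi ((x - z ord0 i) / e)])) =
  N%:R^-1 * \sum_(i < N) ('X.[logi ((x - z ord0 i) / e + h / e)] + 'X.[logi ((x - z ord0 i) / e - h / e)]
    - 2 * 'X.[logi ((x - z ord0 i) / e)] - (h / e) ^+ 2 * (dp (dp 'X)).[logi ((x - z ord0 i) / e)]).
  rewrite !sumrB big_split /= -!mulr_sumr dpX.
  have -> : \sum_(i < N) 'X.[logi ((x + h - z ord0 i) / e)] = \sum_(i < N) 'X.[logi ((x - z ord0 i) / e + h / e)].
    by apply: eq_bigr => i _; congr ('X.[logi _]); ring.
  have -> : \sum_(i < N) 'X.[logi ((x - h - z ord0 i) / e)] = \sum_(i < N) 'X.[logi ((x - z ord0 i) / e - h / e)].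
    by apply: eq_bigr => i _; congr ('X.[logi _]); ring.
  ring.
apply: norm_mean_le => i.
have -> : 2 * C * e^-1 ^+ 3 * h ^+ 3 = 2 * C * (h / e) ^+ 3 by ring.
apply: (second_diff_bound _ _ (is_derive_poly_logi _) (is_derive_poly_logi _) (is_derive_poly_logi _) HC).
exact: mulr_ge0.
Qed.

(** Lipschitz in [x] uniformly over configurations, and Lipschitz in time at the fixed centre [x0];
    time is clamped at 0 to have a function on the plane. *)
Lemma Ex_param_continuous (phi : R -> 'rV[R]_N -> R) (L : R) : 0 <= L -> (forall x, is_C2b (phi x)) ->
  (forall x y z, `|phi x z - phi y z| <= L * `|x - y|) ->
  continuous (fun p : R * R => E (phi p.2) (Num.max 0 p.1)).
Proof.
move=> L0 bphi lphi [t0 x0]; apply/cvgrPdist_lt => eta eta0 /=.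
have [C C0 HC] := Ex_lipschitz HL (bphi x0).
pose dl := eta / (L + C + 1).
have K0 : 0 < L + C + 1 by lra.
have dl0 : 0 < dl by rewrite divr_gt0.
exists (ball t0 dl, ball x0 dl) => /=; first by split; exact: nbhsx_ballx.
move=> [t x] /= [bt bx]; rewrite /ball /= in bt bx.
pose m (t : R) := Num.max 0 t.
have m0 s : 0 <= m s by rewrite le_max lexx.
have mm : `|m t0 - m t| <= `|t0 - t|.
  by rewrite /m; case: (leP 0 t0); case: (leP 0 t) => ? ?; rewrite ler_norml; apply/andP; split; have := ler_norm (t0 - t); have := ler_norm (t - t0); rewrite (distrC t t0); lra.
have h1 : `|E (phi x0) (m t0) - E (phi x0) (m t)| <= `|m t0 - m t| * C.
  have [le|le] := leP (m t) (m t0).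
    by rewrite [X in X * C]ger0_norm ?subr_ge0//; exact: HC.
  by rewrite distrC [X in X * C]distrC [X in X * C]ger0_norm; [apply: HC => //; exact: ltW|rewrite subr_ge0 ltW].
have h2 : `|E (phi x0) (m t) - E (phi x) (m t)| <= L * `|x0 - x|.
  rewrite -(ExB HL) //; try exact: is_C2b_bmeas.
  by apply: (Ex_norm_le HL) => //; apply: bmeasB; exact: is_C2b_bmeas.
have h3 : L * `|x0 - x| <= L * dl by rewrite ler_wpM2l// ltW.
have h4 : `|m t0 - m t| * C <= dl * C by rewrite ler_wpM2r// (le_trans mm)// ltW.
have h5 : dl * (L + C + 1) = eta by rewrite divfK// gt_eqF.
rewrite -/(m t0) -/(m t).
have -> : E (phi x0) (m t0) - E (phi x) (m t) =
  (E (phi x0) (m t0) - E (phi x0) (m t)) + (E (phi x0) (m t) - E (phi x) (m t)) by ring.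
rewrite (le_lt_trans (ler_normD _ _))//; lra.
Qed.

Section with_reference.
Variables (U : R -> R -> R) (M : R).
Hypothesis M0 : 0 <= M.

Definition dens (t x : R) (z : 'rV[R]_N) := (f x z - U t x) ^+ 2 + e * f x z ^+ 2.

Definition disc (t x : R) := E (dens t x) t.

(** The second [x]-derivative of [dens], without the squared gradient of [f - U] and without the
    term containing the second derivative of [U]. *)
Definition testW (t x : R) (z : 'rV[R]_N) :=
  2 * ((f x z - U t x) * A x z) + 2 * e * (f x z * A x z + (e^-1 * V x z) ^+ 2).

Lemma is_C2b_dens t x : is_C2b (dens t x).
Proof.
apply: is_C2bD; first by apply: is_C2bX; exact: is_C2b_fc.
by apply: is_C2bM; [exact: is_C2b_cst|apply: is_C2bX; exact: is_C2b_emp].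
Qed.

Lemma is_C2b_testW t x : is_C2b (testW t x).
Proof.
apply: is_C2bD; apply: is_C2bM; try exact: is_C2b_cst.
  by apply: is_C2bM; [exact: is_C2b_fc|exact: is_C2b_lapl].
apply: is_C2bD; first by apply: is_C2bM; [exact: is_C2b_emp|exact: is_C2b_lapl].
by apply: is_C2bX; apply: is_C2bM; [exact: is_C2b_cst|exact: is_C2b_emp].
Qed.

Lemma disc_dxx t x : 0 <= t -> (forall y, `|U t y| <= M) -> (forall y, derivable (U t) y 1) ->
  derivable (derive1 (U t)) x 1 ->
  dxx_ge disc t x (E (testW t x) t - 2 * (E (f x) t - U t x) * derive1 (derive1 (U t)) x).
Proof.
move=> t0 UM dU dU' eta eta0.
have [C1 C10 H1] := emp_taylor1; have [C2 C20 H2] := emp_taylor2.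
pose K := 2 * (1 + M) * C2 + 2 * C2 + 4 * C1.
have K0 : 0 <= K by rewrite /K !addr_ge0// !mulr_ge0// addr_ge0.
pose eta1 := eta / 2 / (2 * (1 + M)).
have eta10 : 0 < eta1 by rewrite !divr_gt0// mulr_gt0// ltr_wpDr.
have [d1 d10 HU] := second_diff_approx dU dU' eta10.
pose d2 := eta / 2 / (K + 1).
have d20 : 0 < d2 by rewrite !divr_gt0// ltr_wpDl.
exists (Num.min d1 d2); first by rewrite lt_min d10.
move=> h /andP[h0]; rewrite lt_min => /andP[hd1 hd2].
pose DU := U t (x + h) + U t (x - h) - 2 * U t x.
have pw z : h ^+ 2 * testW t x z + (- 2 * DU) * (f x z - U t x) - K * h ^+ 3 <=
    (dens t (x + h) z + dens t (x - h) z) - 2 * dens t x z.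
  have := empX01 e x N2 z; have := empV01 e x N2 z => v01 F01.
  have h1 := H1 x h z; have h2 := H1 x (- h) z; rewrite sqrrN in h2.
  have := energy_second_diff (U t (x + h)) (U t (x - h)) e0 e1 M0 C20 h0 (UM x) v01 F01 h1 h2 (H2 x h z (ltW h0)).
  by rewrite /testW /dens /DU /K.
have bW := is_C2b_bmeas (is_C2b_testW t x).
have bd y := is_C2b_bmeas (is_C2b_dens t y).
have bf := is_C2b_bmeas (is_C2b_emp N 'X e x).
have bfc := is_C2b_bmeas (is_C2b_fc (U t x) x).
have b1 : bmeas (fun z => h ^+ 2 * testW t x z) by apply: bmeasM => //; exact: bmeas_cst.
have b2 : bmeas (fun z : 'rV[R]_N => (- 2 * DU) * (f x z - U t x)) by apply: bmeasM => //; exact: bmeas_cst.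
have b12 := bmeasD b1 b2.
have bp := bmeasD (bd (x + h)) (bd (x - h)).
have b2d : bmeas (fun z => 2 * dens t x z) by apply: bmeasM => //; exact: bmeas_cst.
have := Ex_le HL (bmeasB b12 (bmeas_cst _ (K * h ^+ 3))) (bmeasB bp b2d) t0 pw.
rewrite (ExB HL b12 (bmeas_cst _ _) t0) (ExD HL b1 b2 t0) (ExZ HL _ bW t0) (ExZ HL _ bfc t0) (ExB HL bf (bmeas_cst _ _) t0) !Ex_cst.
rewrite (ExB HL bp b2d t0) (ExD HL (bd _) (bd _) t0) (ExZ HL _ (bd x) t0).
change (E (dens t (x + h)) t) with (disc t (x + h)); change (E (dens t (x - h)) t) with (disc t (x - h)); change (E (dens t x) t) with (disc t x).
apply: le_trans.
have := HU h; rewrite h0 hd1 => /(_ isT); rewrite -/DU.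
set W := E (testW t x) t; set al := E (f x) t - U t x; set uxx := derive1 (derive1 (U t)) x.
move=> HUU.
have alb : `|al| <= 1 + M.
  have h1 : `|E (f x) t| <= 1.
    by apply: (Ex_norm_le HL) => // z; have /andP[z0 z1] := empX01 e x N2 z; rewrite ler_norml; apply/andP; split; lra.
  by rewrite (le_trans (ler_normB _ _))// lerD.
have e1h : al * (DU - h ^+ 2 * uxx) <= eta / 4 * h ^+ 2.
  rewrite (le_trans (ler_norm _))// normrM.
  apply: (@le_trans _ _ ((1 + M) * (eta1 * h ^+ 2))); first exact: ler_pM.
  rewrite /eta1 le_eqVlt; apply/orP; left; apply/eqP; field.
  by rewrite gt_eqF// ltr_wpDr.
have e2h : K * h ^+ 3 <= eta / 2 * h ^+ 2.
  have -> : h ^+ 3 = h * h ^+ 2 by ring.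
  rewrite mulrA ler_wpM2r ?sqr_ge0//.
  have := hd2; rewrite /d2 ltr_pdivlMr; last lra.
  nra.
lra.
Qed.

Let bmf x := is_C2b_bmeas (is_C2b_emp N 'X e x).

Let bmtf c x := is_C2b_bmeas (is_C2b_testf c x).

Lemma Ex_emp_bound t x : 0 <= t -> 0 <= E (f x) t <= 1.
Proof.
move=> t0; apply/andP; split.
  rewrite -[leLHS](Ex_cst P xi 0 t); apply: (Ex_le HL) => //; first exact: bmeas_cst.
  by move=> z; have /andP[] := empX01 e x N2 z.
rewrite -[leRHS](Ex_cst P xi 1 t); apply: (Ex_le HL) => //; first exact: bmeas_cst.
by move=> z; have /andP[] := empX01 e x N2 z.
Qed.

(** With [c] the value of [U] at the later time this compares two times; with [c = 0] it reduces
    continuity of [disc] to that of two moments. *)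
Lemma discE t x c : 0 <= t ->
  disc t x = E (testf c x) t + 2 * (c - U t x) * E (f x) t + U t x ^+ 2.
Proof.
move=> t0; have b1 : bmeas (fun z : 'rV[R]_N => 2 * (c - U t x) * f x z).
  by apply: bmeasM => //; exact: bmeas_cst.
rewrite -(ExZ HL _ (bmf x) t0) -(ExD HL (bmtf c x) b1 t0) -(Ex_cst P xi (U t x ^+ 2) t).
rewrite -(ExD HL (bmeasD (bmtf c x) b1) (bmeas_cst _ _) t0); congr Ex; apply/funext => z.
rewrite /dens /testf; ring.
Qed.

Lemma disc_dt t x : 0 < t -> (forall s, 0 <= s <= t -> `|U s x| <= M) ->
  derivable (fun s => U s x) t 1 ->
  dt_le disc t x (E (testK M (U t x) x) t + 2 * (2 + M) * noise
    + derive1 (fun s => U s x) t * (2 * U t x - 2 * E (f x) t)).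
Proof.
move=> t0 UM dU eta eta0.
have uM : `|U t x| <= M by apply: UM; rewrite lexx ltW.
have [C C0 HC] := testf_incr x uM.
have [L L0 HLip] := Ex_lipschitz HL (is_C2b_emp N 'X e x).
pose eta1 := eta / 2 / (2 * M + 2).
have M2 : 0 < 2 * M + 2 by rewrite ltr_wpDl// mulr_ge0.
have eta10 : 0 < eta1 by rewrite !divr_gt0.
have [d1 d10 HU] := derivable_approx dU eta10.
set ut := derive1 _ t; pose G := C + 2 * (`|ut| + eta1) * L.
have G0 : 0 <= G by rewrite addr_ge0// !mulr_ge0// addr_ge0// ltW.
pose d2 := eta / 2 / (G + 1).
have d20 : 0 < d2 by rewrite !divr_gt0// ltr_wpDl.
exists (Num.min d1 d2); first by rewrite lt_min d10.
move=> h /andP[h0]; rewrite lt_min => /andP[hd1 hd2] ht.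
have th0 : 0 <= t - h by rewrite subr_ge0.
have tht : t - h <= t by rewrite lerBlDr lerDl ltW.
have := HC _ _ th0 tht; have := HLip _ _ th0 tht; have := HU (- h).
rewrite normrN (gtr0_norm h0) => /(_ hd1).
have -> : t - (t - h) = h by ring.
have hG : G * h <= eta / 2.
  move: hd2; rewrite /d2 ltr_pdivlMr; last by rewrite ltr_wpDl.
  by rewrite mulrDr mulr1 mulrC => hG; rewrite (le_trans _ (ltW hG))// lerDl ltW.
have HeM : eta1 * (2 * M + 2) = eta / 2 by rewrite /eta1 divfK// gt_eqF.
have D1 : disc t x = E (testf (U t x) x) t + U t x ^+ 2.
  by rewrite (discE x (U t x) (ltW t0)) subrr mulr0 mul0r addr0.
have D2 := discE x (U t x) th0.
have ab := Ex_emp_bound x (ltW t0).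
move=> w1 lip inc; rewrite D1 D2.
exact: (energy_time_diff M0 L0 h0 eta10 HeM hG uM ab w1 lip inc).
Qed.

Lemma disc_ge0 t x : 0 <= t -> 0 <= disc t x.
Proof.
move=> t0; rewrite -[leLHS](Ex_cst P xi 0 t); apply: (Ex_le HL) => //; first exact: bmeas_cst.
  exact/is_C2b_bmeas/is_C2b_dens.
by move=> z; rewrite addr_ge0 ?sqr_ge0// mulr_ge0 ?sqr_ge0// ltW.
Qed.

Lemma disc_le t x : 0 <= t -> `|U t x| <= M -> disc t x <= (1 + M) ^+ 2 + 1.
Proof.
move=> t0 uM; rewrite -[leRHS](Ex_cst P xi _ t); apply: (Ex_le HL) => //.
- exact/is_C2b_bmeas/is_C2b_dens.
- exact: bmeas_cst.
move=> z; have /andP[F0 F1] := empX01 e x N2 z; rewrite /dens; apply: lerD.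
  rewrite -real_normK ?num_real// ler_pXn2r ?nnegrE ?addr_ge0//.
  by rewrite (le_trans (ler_normB _ _))// lerD// ger0_norm.
by rewrite mulr_ile1 ?sqr_ge0 ?exprn_ile1// ltW.
Qed.

(** The bound from time differences is set against the one from space differences. The reaction
    terms combine to [2 * (F + u - 1) * (F - u) ^+ 2], whence the rate [2 * (1 + M)]. *)
Lemma disc_compare t x ut uxx : 0 <= t -> `|U t x| <= M -> ut = 2^-1 * uxx + U t x ^+ 2 - U t x ->
  E (testK M (U t x) x) t + 2 * (2 + M) * noise + ut * (2 * U t x - 2 * E (f x) t) <=
  2^-1 * (E (testW t x) t - 2 * (E (f x) t - U t x) * uxx) + 2 * (1 + M) * disc t x
   + (e * (1 + M) ^+ 2 + 2 * (2 + M) * noise).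
Proof.
move=> t0 uM ->; set u := U t x.
pose g (z : 'rV[R]_N) := 2^-1 * testW t x z + (2 * (u ^+ 2 - u)) * (f x z - u) + (2 * (1 + M)) * dens t x z + e * (1 + M) ^+ 2.
have pw z : testK M u x z <= g z.
  rewrite /g /testK /testW /dens -/u.
  have := empX01 e x N2 z; have := empV01 e x N2 z; set F := f x z; set v := V x z; set a := A x z.
  move=> /andP[v0 v1] /andP[F0 F1]; move: uM; rewrite -/u ler_norml => /andP[u1 u2].
  have h1 : 2 * ((F - u) * (F ^+ 2 - F)) - 2 * (u ^+ 2 - u) * (F - u) <= 2 * (1 + M) * (F - u) ^+ 2.
    have -> : 2 * ((F - u) * (F ^+ 2 - F)) - 2 * (u ^+ 2 - u) * (F - u) = 2 * (F + u - 1) * (F - u) ^+ 2 by ring.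
    by rewrite ler_wpM2r ?sqr_ge0// ler_pM2l//; lra.
  (* Completing the square: the gradient term in half of [testW] absorbs the jump error and leaves
     only a multiple of [e]. *)
  have h2 : 2 * (1 + M) * v <= e * (e^-1 * v) ^+ 2 + e * (1 + M) ^+ 2.
    rewrite -subr_ge0.
    have -> : e * (e^-1 * v) ^+ 2 + e * (1 + M) ^+ 2 - 2 * (1 + M) * v = e * (e^-1 * v - (1 + M)) ^+ 2.
      by field; rewrite gt_eqF.
    by rewrite mulr_ge0 ?sqr_ge0// ltW.
  have h3 : 0 <= 2 * (1 + M) * (e * F ^+ 2).
    by apply: mulr_ge0; [apply: mulr_ge0 => //; exact: addr_ge0|apply: mulr_ge0; [exact: ltW|exact: sqr_ge0]].
  lra.
have bW := is_C2b_bmeas (is_C2b_testW t x).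
have bd := is_C2b_bmeas (is_C2b_dens t x).
have bfc := is_C2b_bmeas (is_C2b_fc u x).
have b1 : bmeas (fun z => 2^-1 * testW t x z) by apply: bmeasM => //; exact: bmeas_cst.
have b2 : bmeas (fun z : 'rV[R]_N => (2 * (u ^+ 2 - u)) * (f x z - u)) by apply: bmeasM => //; exact: bmeas_cst.
have b3 : bmeas (fun z => (2 * (1 + M)) * dens t x z) by apply: bmeasM => //; exact: bmeas_cst.
have b12 := bmeasD b1 b2; have b123 := bmeasD b12 b3.
have := Ex_le HL (is_C2b_bmeas (is_C2b_testK M u x)) (bmeasD b123 (bmeas_cst _ _)) t0 pw.
rewrite (ExD HL b123 (bmeas_cst _ _) t0) (ExD HL b12 b3 t0) (ExD HL b1 b2 t0).
rewrite (ExZ HL _ bW t0) (ExZ HL _ bfc t0) (ExZ HL _ bd t0) (ExB HL (bmf x) (bmeas_cst _ _) t0) !Ex_cst.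
change (E (dens t x) t) with (disc t x).
set a := E (f x) t; set W := E (testW t x) t; set D := disc t x; set K := E _ t.
move=> H.
have -> : (2^-1 * uxx + u ^+ 2 - u) * (2 * u - 2 * a) = 2^-1 * (- (2 * (a - u) * uxx)) - 2 * (u ^+ 2 - u) * (a - u) by field.
lra.
Qed.

Lemma disc_continuous : continuous (fun p : R * R => U (Num.max 0 p.1) p.2) ->
  continuous (fun p : R * R => disc (Num.max 0 p.1) p.2).
Proof.
move=> cU.
have -> : (fun p : R * R => disc (Num.max 0 p.1) p.2) = (fun p : R * R =>
    (1 + e) * E (fun z => f p.2 z * f p.2 z) (Num.max 0 p.1)
    + - 2 * U (Num.max 0 p.1) p.2 * E (f p.2) (Num.max 0 p.1) + U (Num.max 0 p.1) p.2 * U (Num.max 0 p.1) p.2).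
  apply/funext => p; have p0 : 0 <= Num.max 0 p.1 by rewrite le_max lexx.
  have bff : bmeas (fun z : 'rV[R]_N => f p.2 z * f p.2 z) by exact: bmeasM.
  rewrite (discE p.2 0 p0) /testf (ExD HL) //; first last.
  - by apply: bmeasM => //; exact: bmeas_cst.
  - by apply: bmeasM => //; exact: bmeas_cst.
  rewrite (ExZ HL _ bff p0) (ExZ HL _ (bmf _) p0); ring.
have ei : 0 <= e^-1 by rewrite invr_ge0 ltW.
have c1 : continuous (fun p : R * R => E (f p.2) (Num.max 0 p.1)).
  apply: (@Ex_param_continuous (fun x => f x) e^-1) => //; first by move=> x; exact: is_C2b_emp.
  by move=> x y z; exact: emp_lip.
have c2 : continuous (fun p : R * R => E (fun z => f p.2 z * f p.2 z) (Num.max 0 p.1)).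
  apply: (@Ex_param_continuous (fun x z => f x z * f x z) (2 * e^-1)) => //; first by rewrite mulr_ge0.
    by move=> x; apply: is_C2bM; exact: is_C2b_emp.
  move=> x y z; have -> : f x z * f x z - f y z * f y z = (f x z + f y z) * (f x z - f y z) by ring.
  rewrite normrM -mulrA; apply: ler_pM => //; last exact: emp_lip.
  have /andP[? ?] := empX01 e x N2 z; have /andP[? ?] := empX01 e y N2 z.
  by rewrite ler_norml; apply/andP; split; lra.
move=> p; apply: cvgD; last by apply: cvgM; exact: cU.
apply: cvgD; first by apply: cvgM; [exact: cvg_cst|exact: c2].
by apply: cvgM; [apply: cvgM; [exact: cvg_cst|exact: cU]|exact: c1].
Qed.

End with_reference.

End discrepancy.

(** * Maximum principle *)

Section max_principle.
Variable R : realType.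
Implicit Types D Z : R -> R -> R.

(** Arithmetic at an interior maximum of [expR (- (c * t)) * D - Z]: [D0] and [Z0] are the values
    there, [D1] and [Z1] those a time [h] earlier, [p] and [m] mark the neighbours at distance [h],
    and [e], [ex] are the weights at the two times. The losses sum to [4 * eta], half of the gap
    [8 * eta]. *)
Lemma max_point_absurd (D0 D1 Dp Dm Z0 Z1 Zp Zm e ex c h kap nu zt zxx eta E0 : R) :
  0 < h -> 0 < e -> e <= 1 -> 0 <= c -> 0 <= D1 -> 0 < eta -> 0 <= E0 ->
  eta * 8 = zt - 2^-1 * zxx - E0 -> kap <= 2^-1 * nu + c * D0 + E0 ->
  D0 - D1 <= h * (kap + eta) -> h ^+ 2 * (nu - eta) <= Dp + Dm - 2 * D0 ->
  - Z0 - - Z1 <= h * (- zt + eta) -> h ^+ 2 * (- zxx - eta) <= - Zp - Zm - 2 * - Z0 ->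
  ex * D1 - Z1 <= e * D0 - Z0 -> e * Dp - Zp <= e * D0 - Z0 -> e * Dm - Zm <= e * D0 - Z0 ->
  c * h * (kap + eta) <= eta -> e * (1 + c * h) <= ex -> False.
Proof.
move=> h0 e0 e1 c0 D10 eta0 E00 etaE cmp H1 H2 H3 H4 M1 M2 M3 hb eh.
have e0' := ltW e0; have h0' := ltW h0.
have eh2 : e * (1 + c * h) * D1 <= ex * D1 by rewrite ler_wpM2r.
have S1 : e * (D0 - D1 - c * h * D1) <= h * (e * (kap + eta - c * D0 + eta)).
  have -> : h * (e * (kap + eta - c * D0 + eta)) = e * (h * (kap + eta - c * D0 + eta)) by ring.
  rewrite ler_wpM2l//.
  have k1 : c * h * (D0 - h * (kap + eta)) <= c * h * D1.
    by apply: ler_wpM2l; [exact: mulr_ge0|clear -H1; lra].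
  have k2 : h * (c * h * (kap + eta)) <= h * eta by rewrite ler_pM2l.
  by clear -k1 k2 H1; lra.
have S2 : h * (zt - eta) <= h * (e * (kap + eta - c * D0 + eta)) by clear -S1 M1 H3 eh2; lra.
have S3 : zt - eta <= e * (kap + eta - c * D0 + eta) by rewrite ler_pM2l in S2.
have S4 : e * (kap + eta - c * D0 + eta) <= e * (2^-1 * nu) + E0 + 2 * eta.
  have k1 : e * (kap - c * D0 - 2^-1 * nu + 2 * eta) <= e * (E0 + 2 * eta).
    by apply: ler_wpM2l => //; clear -cmp; lra.
  have k2 : e * (E0 + 2 * eta) <= E0 + 2 * eta.
    by apply: ler_piMl => //; clear -E00 eta0; lra.
  by clear -k1 k2; lra.
have X2 : h ^+ 2 * (e * (nu - eta)) <= h ^+ 2 * (zxx + eta).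
  have k1 : e * (h ^+ 2 * (nu - eta)) <= e * (Dp + Dm - 2 * D0) by rewrite ler_wpM2l.
  by clear -k1 M2 M3 H4; lra.
have X3 : e * (nu - eta) <= zxx + eta by move: X2; rewrite ler_pM2l// exprn_gt0.
have X4 : e * eta <= eta by rewrite ler_piMl// ltW.
by clear -X3 X4 S3 S4 etaE eta0; lra.
Qed.

(** The exponential weight removes the zero-order term [c * D]. Time differences are taken backwards
    only, so a maximum at the final time [T] needs no separate treatment. *)
Lemma max_principle D Z (T K c E0 : R) : 0 <= T -> 0 < K -> 0 <= c -> 0 <= E0 ->
  continuous (fun p : R * R => D (Num.max 0 p.1) p.2) ->
  continuous (fun p : R * R => Z (Num.max 0 p.1) p.2) ->
  (forall t x, 0 <= t -> 0 <= D t x) ->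
  (forall x, `|x| <= K -> D 0 x < Z 0 x) ->
  (forall t x, 0 <= t <= T -> `|x| = K -> D t x < Z t x) ->
  (forall t x, 0 < t <= T -> exists kap nu,
     [/\ dt_le D t x kap, dxx_ge D t x nu & kap <= 2^-1 * nu + c * D t x + E0]) ->
  (forall t x, 0 < t <= T -> exists zt zxx,
     [/\ dt_le (fun t x => - Z t x) t x (- zt), dxx_ge (fun t x => - Z t x) t x (- zxx) & 2^-1 * zxx + E0 < zt]) ->
  forall t x, 0 <= t <= T -> `|x| <= K -> expR (- (c * t)) * D t x <= Z t x.
Proof.
move=> T0 K0 c0 E00 cD cZ D0 init lat Dineq Zineq t x tT xK.
pose W (p : R * R) := expR (- (c * Num.max 0 p.1)) * D (Num.max 0 p.1) p.2 - Z (Num.max 0 p.1) p.2.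
have cW : continuous W.
  move=> p; apply: cvgB; last exact: cZ.
  apply: cvgM; last exact: cD.
  have cmax : continuous (fun p : R * R => Num.max 0 p.1).
    by move=> q; apply: continuous_max; [exact: cvg_cst|exact: cvg_fst].
  apply: (@cvg_comp _ _ _ (fun p : R * R => - (c * Num.max 0 p.1)) expR); last exact: continuous_expR.
  by apply: cvgN; apply: cvgM; [exact: cvg_cst|exact: cmax].
pose A : set (R * R) := `[0, T]%classic `*` `[- K, K]%classic.
have cA : compact A by apply: compact_setX; exact: segment_compact.
have A0 : A !=set0 by exists (0, 0); split; rewrite /= in_itv /=; apply/andP; split; lra.
have [[t0 x0] /set_mem [/=]] := compact_EVT_max A0 cA (continuous_subspaceT cW).
rewrite !in_itv /= => /andP[t00 t0T] /andP[x0K1 x0K2] maxW.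
have WE s y : 0 <= s -> W (s, y) = expR (- (c * s)) * D s y - Z s y by move=> s0; rewrite /W /= max_r.
have {}maxW s y : 0 <= s <= T -> `|y| <= K -> expR (- (c * s)) * D s y - Z s y <= expR (- (c * t0)) * D t0 x0 - Z t0 x0.
  move=> sT yK; have /andP[s0 _] := sT; rewrite -!WE//; apply: maxW; rewrite inE; split => /=; rewrite in_itv //=.
  by rewrite -ler_norml.
rewrite leNgt; apply/negP => ltZ.
have W0 : 0 < expR (- (c * t0)) * D t0 x0 - Z t0 x0 by rewrite (lt_le_trans _ (maxW _ _ tT xK))// subr_gt0.
have x0K : `|x0| <= K by rewrite ler_norml x0K1.
have ele1 s : 0 <= s -> expR (- (c * s)) <= 1 by move=> s0; rewrite -expR0 ler_expR oppr_le0 mulr_ge0.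
(* The weight is at most 1 and [D] is nonnegative, so a positive maximum can lie neither at time 0
   nor on the sides of the box. *)
have DZ : Z t0 x0 < D t0 x0.
  rewrite subr_gt0 in W0; rewrite (lt_le_trans W0)// ler_piMl ?D0 ?ele1//.
have t0p : 0 < t0.
  rewrite lt_neqAle t00 andbT; apply/eqP => t0E; move: DZ; rewrite -t0E ltNge => /negP; apply.
  exact/ltW/init.
have x0lt : `|x0| < K.
  rewrite lt_neqAle x0K andbT; apply/eqP => xE; move: DZ; rewrite ltNge => /negP; apply.
  by apply/ltW/lat => //; rewrite t00.
have t0i : 0 < t0 <= T by rewrite t0p.
have [kap [nu [Dt Dx cmp]]] := Dineq _ x0 t0i.
have [zt [zxx [Zt Zx gap]]] := Zineq _ x0 t0i.
set e := expR (- (c * t0)) in maxW W0.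
have e0 : 0 < e by exact: expR_gt0.
have e1 : e <= 1 by exact: ele1.
pose eta := (zt - 2^-1 * zxx - E0) / 8.
have eta0 : 0 < eta by rewrite divr_gt0//; lra.
have [d1 d10 H1] := Dt _ eta0; have [d2 d20 H2] := Dx _ eta0.
have [d3 d30 H3] := Zt _ eta0; have [d4 d40 H4] := Zx _ eta0.
pose d5 := eta / (c * `|kap + eta| + 1).
have cb : 0 <= c * `|kap + eta| by exact: mulr_ge0.
have d50 : 0 < d5 by rewrite divr_gt0// ltr_wpDl.
(* Below every threshold for [eta], small enough for the term in [c], and such that the steps stay
   in nonnegative time and inside the box. *)
pose m := Num.min (Num.min (Num.min d1 d2) (Num.min d3 d4)) (Num.min (Num.min d5 t0) (K - `|x0|)).
have m0 : 0 < m by rewrite !lt_min d10 d20 d30 d40 d50 t0p subr_gt0 x0lt.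
pose h := m / 2.
have h0 : 0 < h by rewrite divr_gt0.
have hm : h < m by rewrite /h ltr_pdivrMr// ltr_pMr// ltr1n.
move: hm; rewrite /m !lt_min => /andP[/andP[/andP[hd1 hd2] /andP[hd3 hd4]] /andP[/andP[hd5 ht0] hK]].
have htl := ltW ht0.
have {H1} := H1 h; rewrite h0 hd1 => /(_ isT htl) H1.
have {H2} := H2 h; rewrite h0 hd2 => /(_ isT) H2.
have {H3} := H3 h; rewrite h0 hd3 => /(_ isT htl) H3.
have {H4} := H4 h; rewrite h0 hd4 => /(_ isT) H4.
have th0 : 0 <= t0 - h by rewrite subr_ge0.
have M1 : expR (- (c * (t0 - h))) * D (t0 - h) x0 - Z (t0 - h) x0 <= e * D t0 x0 - Z t0 x0.
  by apply: maxW => //; rewrite th0 (le_trans _ t0T)// lerBlDr lerDl ltW.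
have M2 : e * D t0 (x0 + h) - Z t0 (x0 + h) <= e * D t0 x0 - Z t0 x0.
  apply: maxW; first by rewrite t00.
  by rewrite (le_trans (ler_normD _ _))// (gtr0_norm h0) -lerBrDl ltW.
have M3 : e * D t0 (x0 - h) - Z t0 (x0 - h) <= e * D t0 x0 - Z t0 x0.
  apply: maxW; first by rewrite t00.
  by rewrite (le_trans (ler_normB _ _))// (gtr0_norm h0) -lerBrDl ltW.
have hb : c * h * (kap + eta) <= eta.
  apply: (@le_trans _ _ (h * (c * `|kap + eta|))).
    by rewrite -mulrA mulrCA; apply: ler_wpM2l; [exact: ltW|apply: ler_wpM2l => //; exact: ler_norm].
  move: hd5; rewrite /d5 ltr_pdivlMr ?ltr_wpDl// mulrDr mulr1 => hd5.
  by rewrite (le_trans _ (ltW hd5))// lerDl ltW.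
have eh : e * (1 + c * h) <= expR (- (c * (t0 - h))).
  have -> : - (c * (t0 - h)) = - (c * t0) + c * h by ring.
  by rewrite expRD; apply: ler_wpM2l; [exact: ltW|exact: expR_ge1Dx].
have etaE : eta * 8 = zt - 2^-1 * zxx - E0 by rewrite /eta divfK.
exact: (max_point_absurd h0 e0 e1 c0 (D0 _ x0 th0) eta0 E00 etaE cmp H1 H2 H3 H4 M1 M2 M3 hb eh).
Qed.

End max_principle.

(** * Building blocks of the barrier *)

Section heat.
Variable R : realType.
Implicit Types Z : R -> R -> R.

Definition heat_at Z (t x zt zxx : R) := is_derive t 1 (fun s => Z s x) zt /\
  exists z1 : R -> R, (forall y : R, is_derive y 1 (Z t) (z1 y)) /\ is_derive x 1 z1 zxx.

Lemma heat_at_cst (c t x : R) : heat_at (fun _ _ => c) t x 0 0.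
Proof.
split; first exact: is_derive_cst.
by exists (fun=> 0); split => [y|]; exact: is_derive_cst.
Qed.

Lemma heat_atD Z1 Z2 t x a1 b1 a2 b2 : heat_at Z1 t x a1 b1 -> heat_at Z2 t x a2 b2 ->
  heat_at (fun t x => Z1 t x + Z2 t x) t x (a1 + a2) (b1 + b2).
Proof.
move=> [h1 [z1 [h2 h3]]] [k1 [z2 [k2 k3]]]; split; first exact: is_deriveD.
by exists (fun y => z1 y + z2 y); split => [y|]; exact: is_deriveD.
Qed.

Lemma heat_atZ Z t x a b (k : R) : heat_at Z t x a b -> heat_at (fun t x => k * Z t x) t x (k * a) (k * b).
Proof.
move=> [h1 [z1 [h2 h3]]]; split; first exact: (@is_deriveZ _ _ _ _ k t 1 _ h1).
exists (fun y => k * z1 y); split => [y|].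
  exact: (@is_deriveZ _ _ _ _ k y 1 _ (h2 y)).
exact: (@is_deriveZ _ _ _ _ k x 1 _ h3).
Qed.

Lemma heat_at_sum (I : Type) (r : seq I) (F : I -> R -> R -> R) a b t x :
  (forall i, heat_at (F i) t x (a i) (b i)) ->
  heat_at (fun t x => \sum_(i <- r) F i t x) t x (\sum_(i <- r) a i) (\sum_(i <- r) b i).
Proof.
move=> hF; elim: r => [|i r IH].
  rewrite !big_nil (_ : (fun t x => _) = fun _ _ => 0); first exact: heat_at_cst.
  by apply/funext => s; apply/funext => y; rewrite big_nil.
rewrite !big_cons (_ : (fun t x => _) = fun t x => F i t x + \sum_(i <- r) F i t x); first exact: heat_atD.
by apply/funext => s; apply/funext => y; rewrite big_cons.
Qed.

Lemma heat_at_dt Z t x a b : heat_at Z t x a b -> dt_le (fun t x => - Z t x) t x (- a).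
Proof.
move=> [h1 _] eta eta0.
have dZ := @ex_derive _ _ _ _ _ _ _ h1; have vZ := @derive_val _ _ _ _ _ _ _ h1.
have [dl dl0 H] := derivable_approx dZ eta0; exists dl => // h /andP[h0 hd] _.
have := H (- h); rewrite normrN (gtr0_norm h0) => /(_ hd); rewrite derive1E vZ ler_norml => /andP[k1 k2].
by lra.
Qed.

Lemma heat_at_dxx Z t x a b : heat_at Z t x a b -> dxx_ge (fun t x => - Z t x) t x (- b).
Proof.
move=> [_ [z1 [h1 h2]]] eta eta0.
have dZ y : derivable (Z t) y 1 by exact: (@ex_derive _ _ _ _ _ _ _ (h1 y)).
have E : derive1 (Z t) = z1.
  by apply/funext => y; rewrite derive1E; exact: (@derive_val _ _ _ _ _ _ _ (h1 y)).
have dZ' : derivable (derive1 (Z t)) x 1 by rewrite E; exact: (@ex_derive _ _ _ _ _ _ _ h2).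
have [dl dl0 H] := second_diff_approx dZ dZ' eta0; exists dl => // h hd.
have := H h hd; rewrite E derive1E (@derive_val _ _ _ _ _ _ _ h2) ler_norml => /andP[k1 k2].
lra.
Qed.

Lemma heat_at_sqr (t x : R) : heat_at (fun t x => x ^+ 2 + t) t x 1 2.
Proof.
split.
  have -> : (fun s => x ^+ 2 + s) = (fun=> x ^+ 2) + (@id R) by [].
  by apply: is_derive_eq; rewrite add0r.
exists (fun y => 2 * y); split => [y|].
  have -> : (fun y => y ^+ 2 + t) = (@id R) ^+ 2 + (fun=> t) by [].
  by apply: is_derive_eq; rewrite /GRing.scale /=; ring.
have -> : (fun y : R => 2 * y) = 2 \*: (@id R) by [].
by apply: is_derive_eq; rewrite /GRing.scale /= mulr1.
Qed.

Lemma heat_at_time (k t x : R) : heat_at (fun t _ => k * t) t x k 0.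
Proof.
split.
  have -> : (fun s : R => k * s) = k \*: (@id R) by [].
  by apply: is_derive_eq; rewrite /GRing.scale /= mulr1.
by exists (fun=> 0); split => [y|]; exact: is_derive_cst.
Qed.

(* The Gaussian of variance [s ^+ 2 + t], normalised to be of order one on
   [|x| <= s] at time 0, hence of size O(s) at any later time. *)
Definition gauss (s t x : R) : R :=
  s * expR (- 2^-1 * ln (s ^+ 2 + t) - x ^+ 2 / (2 * (s ^+ 2 + t))).

Lemma gauss_gt0 s t x : 0 < s -> 0 < gauss s t x.
Proof. by move=> s0; rewrite mulr_gt0// expR_gt0. Qed.

Lemma heat_at_gauss (s t x y : R) : 0 < s -> 0 <= t -> exists b,
  heat_at (fun t x => gauss s t (x - y)) t x (2^-1 * b) b.
Proof.
move=> s0 t0; pose q := s ^+ 2 + t.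
have q0 : 0 < q by rewrite ltr_wpDr// exprn_gt0.
have qn : q != 0 by rewrite gt_eqF.
exists (gauss s t (x - y) * ((x - y) ^+ 2 / q ^+ 2 - q^-1)); split.
  have dq : is_derive t 1 (fun t : R => s ^+ 2 + t) 1.
    have -> : (fun t : R => s ^+ 2 + t) = (fun=> s ^+ 2) + (@id R) by [].
    by apply: is_derive_eq; rewrite add0r.
  have dl := @is_derive1_comp _ (@ln R) (fun t : R => s ^+ 2 + t) t _ _ (is_derive1_ln q0) dq.
  have dv := @is_deriveV _ (fun t : R => s ^+ 2 + t) t _ _ qn dq.
  have dphi : is_derive t 1 (fun t : R => - 2^-1 * ln (s ^+ 2 + t) - (x - y) ^+ 2 / (2 * (s ^+ 2 + t)))
     (2^-1 * ((x - y) ^+ 2 / q ^+ 2 - q^-1)).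
    have -> : (fun t : R => - 2^-1 * ln (s ^+ 2 + t) - (x - y) ^+ 2 / (2 * (s ^+ 2 + t))) =
      (- 2^-1) \*: ((@ln R) \o (fun t => s ^+ 2 + t)) - ((x - y) ^+ 2 / 2) \*: (fun t : R => (s ^+ 2 + t)^-1).
      apply/funext => u; change (- 2^-1 * ln (s ^+ 2 + u) - (x - y) ^+ 2 / (2 * (s ^+ 2 + u)) =
        - 2^-1 * ln (s ^+ 2 + u) - (x - y) ^+ 2 / 2 * (s ^+ 2 + u)^-1).
      by rewrite invfM mulrA.
    by apply: is_derive_eq; rewrite /GRing.scale /= -/q; field.
  have de := @is_derive1_comp _ expR _ t _ _ (is_derive_expR _) dphi.
  have := @is_deriveZ _ _ _ _ s t 1 _ de.
  rewrite (_ : _ *: _ = 2^-1 * (gauss s t (x - y) * ((x - y) ^+ 2 / q ^+ 2 - q^-1)))//.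
  by rewrite /GRing.scale /= /gauss -/q; ring.
have dg (z : R) : is_derive z 1 (fun z => gauss s t (z - y)) (gauss s t (z - y) * (- (z - y) / q)).
  have dphi : is_derive z 1 (fun z : R => - 2^-1 * ln q - (z - y) ^+ 2 / (2 * q)) (- (z - y) / q).
    have -> : (fun z : R => - 2^-1 * ln q - (z - y) ^+ 2 / (2 * q)) = (fun=> - 2^-1 * ln q) - (2 * q)^-1 \*: (((@id R) - (fun=> y)) ^+ 2).
      by apply/funext => u; change (- 2^-1 * ln q - (u - y) ^+ 2 / (2 * q) = - 2^-1 * ln q - (2 * q)^-1 * (u - y) ^+ 2); rewrite [(2 * q)^-1 * _]mulrC.
    apply: is_derive_eq; rewrite /GRing.scale /= subr0 expr1 !mulr1.
    change (((@id R) - (fun=> y)) z) with (z - y); field; exact: qn.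
  have de := @is_derive1_comp _ expR _ z _ _ (is_derive_expR _) dphi.
  have := @is_deriveZ _ _ _ _ s z 1 _ de.
  rewrite (_ : _ *: _ = gauss s t (z - y) * (- (z - y) / q))//.
  by rewrite /GRing.scale /= /gauss -/q; ring.
exists (fun z => gauss s t (z - y) * (- (z - y) / q)); split; first exact: dg.
have dl : is_derive x 1 (fun z : R => - (z - y) / q) (- q^-1).
  have -> : (fun z : R => - (z - y) / q) = (- q^-1) \*: ((@id R) - (fun=> y)).
    by apply/funext => u; change (- (u - y) / q = - q^-1 * (u - y)); ring.
  by apply: is_derive_eq; rewrite /GRing.scale /= subr0 mulr1.
have := @is_deriveM _ _ _ _ x 1 _ _ (dg x) dl.
suff -> : gauss s t (x - y) * ((x - y) ^+ 2 / q ^+ 2 - q^-1) = gauss s t (x - y) *: - q^-1 +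
     (- (x - y) / q) *: (gauss s t (x - y) * (- (x - y) / q)) by [].
by rewrite /GRing.scale /=; field.
Qed.

Lemma gauss_continuous (s y : R) : 0 < s -> continuous (fun p : R * R => gauss s (Num.max 0 p.1) (p.2 - y)).
Proof.
move=> s0 p; have cmax : continuous (fun p : R * R => Num.max 0 p.1).
  by move=> q; apply: continuous_max; [exact: cvg_cst|exact: cvg_fst].
have q0 : 0 < s ^+ 2 + Num.max 0 p.1 by rewrite ltr_pwDl ?exprn_gt0// le_max lexx.
have cq : s ^+ 2 + Num.max 0 q.1 @[q --> p] --> s ^+ 2 + Num.max 0 p.1.
  by apply: cvgD; [exact: cvg_cst|exact: cmax].
apply: cvgM; first exact: cvg_cst.
apply: (@cvg_comp _ _ _ _ expR); last exact: continuous_expR.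
apply: cvgB.
  apply: cvgM; first exact: cvg_cst.
  by apply: (@cvg_comp _ _ _ _ (@ln R) _ _ _ cq); exact: continuous_ln.
apply: cvgM.
  have c2 : q.2 - y @[q --> p] --> p.2 - y by apply: cvgB; [exact: cvg_snd|exact: cvg_cst].
  rewrite (_ : (fun q : R * R => _) = fun q : R * R => (q.2 - y) * (q.2 - y)); first exact: cvgM.
  by apply/funext => q; rewrite expr2.
apply: cvgV; first by rewrite gt_eqF// mulr_gt0.
by apply: cvgM; [exact: cvg_cst|exact: cq].
Qed.

Lemma gauss_ge0 (s x : R) : 0 < s -> `|x| <= s -> expR (- 2^-1) <= gauss s 0 x.
Proof.
move=> s0 xs; rewrite /gauss addr0 lnXn//.
have -> : - 2^-1 * (ln s *+ 2) = - ln s by field.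
rewrite expRD expRN lnK ?posrE// mulrA mulfV ?gt_eqF// mul1r ler_expR lerN2.
rewrite ler_pdivrMr ?mulr_gt0 ?exprn_gt0// mulrA mulVf// mul1r.
by rewrite -real_normK ?num_real// ler_pXn2r ?nnegrE// ltW.
Qed.

Lemma gauss_le (s t x : R) : 0 < s -> 0 < t -> gauss s t x <= s * expR (- 2^-1 * ln t).
Proof.
move=> s0 t0; rewrite /gauss; apply: ler_wpM2l; first exact: ltW.
rewrite ler_expR.
have q0 : 0 < s ^+ 2 + t by rewrite ltr_wpDl// exprn_ge0// ltW.
have h1 : ln t <= ln (s ^+ 2 + t) by rewrite ler_ln ?posrE// lerDr exprn_ge0// ltW.
have h2 : 0 <= x ^+ 2 / (2 * (s ^+ 2 + t)).
  by apply: divr_ge0; [exact: sqr_ge0|apply: mulr_ge0 => //; exact: ltW].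
lra.
Qed.

End heat.

Section disc_bound.
Context (R : realType) (N : nat) d (Omega : measurableType d).
Variables (P : probability Omega R) (xi : R -> Omega -> 'rV[R]_N).
Hypothesis HL : is_L_process P xi.
Hypothesis N2 : (2 <= N)%N.

Lemma disc_bound (e : R) (U : R -> R -> R) (M T K a s : R) (n : nat) (c y : nat -> R) :
  0 < e -> e <= 1 -> 0 <= M -> 0 <= T -> 0 < K -> 0 < a -> 0 < s -> (forall k, 0 <= c k) ->
  continuous (fun p : R * R => U (Num.max 0 p.1) p.2) ->
  (forall t x, 0 <= t <= T -> `|U t x| <= M) ->
  (forall t x, 0 < t -> [/\ derivable (fun s => U s x) t 1, derivable (U t) x 1,
     derivable (derive1 (U t)) x 1
     & derive1 (fun s => U s x) t = 2^-1 * derive1 (derive1 (U t)) x + U t x ^+ 2 - U t x]) ->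
  (forall x, `|x| <= K -> disc P xi e U 0 x < \sum_(0 <= k < n) c k * gauss s 0 (x - y k) + a) ->
  forall t x, 0 <= t <= T -> `|x| <= K ->
  disc P xi e U t x <= expR (2 * (1 + M) * t) * (\sum_(0 <= k < n) c k * gauss s t (x - y k)
    + ((1 + M) ^+ 2 + 1) / K ^+ 2 * (x ^+ 2 + t) + a + 2 * (e * (1 + M) ^+ 2 + 2 * (2 + M) * noise N e) * t).
Proof.
move=> e0 e1 M0 T0 K0 a0 s0 c0 cU UM UP init t x tT xK.
set B := (1 + M) ^+ 2 + 1; set E0 := e * _ + _.
have noise0 : 0 <= noise N e.
  by rewrite addr_ge0 ?invr_ge0// mulr_ge0 ?invr_ge0// addr_ge0// exprn_ge0// invr_ge0 ltW.
have E00 : 0 < E0.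
  rewrite ltr_pwDl//; first by rewrite mulr_gt0// exprn_gt0// ltr_wpDr.
  by rewrite !mulr_ge0// addr_ge0.
have B0 : 0 < B by rewrite ltr_wpDl ?sqr_ge0.
have BK : 0 < B / K ^+ 2 by rewrite divr_gt0// exprn_gt0.
(* The Gaussians and [x ^+ 2 + t] solve the heat equation exactly. The coefficient [B / K ^+ 2]
   lifts the barrier to the trivial bound [B] on the sides of the box, [a] makes the comparison
   strict there, and [2 * E0 * t], with twice the required slope, makes [Z] a strict
   supersolution. *)
pose Z (t x : R) := \sum_(0 <= k < n) c k * gauss s t (x - y k) + B / K ^+ 2 * (x ^+ 2 + t) + a + 2 * E0 * t.
have sum0 t' x' : 0 <= \sum_(0 <= k < n) c k * gauss s t' (x' - y k).
  by apply: sumr_ge0 => k _; rewrite mulr_ge0// ltW// gauss_gt0.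
suff : expR (- (2 * (1 + M) * t)) * disc P xi e U t x <= Z t x.
  by rewrite expRN -ler_pdivlMl ?invr_gt0 ?expR_gt0// invrK.
apply: (@max_principle R (disc P xi e U) Z T K (2 * (1 + M)) E0) => //.
- by rewrite mulr_ge0// addr_ge0.
- exact: ltW.
- exact: disc_continuous.
- move=> p; have cmax : continuous (fun p : R * R => Num.max 0 p.1).
    by move=> q; apply: continuous_max; [exact: cvg_cst|exact: cvg_fst].
  apply: cvgD; last by apply: cvgM; [exact: cvg_cst|exact: cmax].
  apply: cvgD; last exact: cvg_cst.
  apply: cvgD.
    apply: cvgr_sum => k; apply: cvgM; first exact: cvg_cst.
    exact: gauss_continuous.
  apply: cvgM; first exact: cvg_cst.
  apply: cvgD; last exact: cmax.
  rewrite (_ : (fun q : R * R => _) = fun q : R * R => q.2 * q.2); last by apply/funext => q; rewrite expr2.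
  by rewrite expr2; apply: cvgM; exact: cvg_snd.
- by move=> t' x' t0'; exact: disc_ge0.
- move=> x' x'K; apply: (lt_le_trans (init x' x'K)); rewrite /Z mulr0 addr0 addr0.
  by rewrite lerD2r lerDl mulr_ge0 ?sqr_ge0// ltW.
- move=> t' x' /andP[t0' tT'] x'K; rewrite (@le_lt_trans _ _ B)//.
    by apply: disc_le => //; apply: UM; rewrite t0'.
  have -> : Z t' x' = (\sum_(0 <= k < n) c k * gauss s t' (x' - y k) + B / K ^+ 2 * t' + 2 * E0 * t') + B + a.
    have : B / K ^+ 2 * x' ^+ 2 = B by rewrite -[x' ^+ 2]real_normK ?num_real// x'K divfK// gt_eqF// exprn_gt0.
    by rewrite /Z => h; rewrite mulrDr h; ring.
  have : 0 <= \sum_(0 <= k < n) c k * gauss s t' (x' - y k) + B / K ^+ 2 * t' + 2 * E0 * t'.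
    apply: addr_ge0; first by apply: addr_ge0 => //; apply: mulr_ge0 => //; exact: ltW.
    by apply: mulr_ge0 => //; apply: mulr_ge0 => //; exact: ltW.
  lra.
- move=> t' x' /andP[t0' tT'].
  have [Ut Ux Uxx Ueq] := UP t' x' t0'.
  have UMt s' y' : 0 <= s' <= t' -> `|U s' y'| <= M.
    by move=> /andP[s1 s2]; apply: UM; rewrite s1 (le_trans s2).
  do 2 eexists; split.
  + apply: (disc_dt HL N2 e0 e1 M0 t0' _ Ut) => s' hs; exact: UMt.
  + apply: (disc_dxx HL N2 e0 e1 M0 (ltW t0') _ _ Uxx) => y'; first by apply: UMt; rewrite lexx ltW.
    by case: (UP t' y' t0').
  + by apply: disc_compare => //; [exact: ltW|apply: UMt; rewrite lexx ltW].
- move=> t' x' /andP[t0' tT'].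
  have /choice[b hb] : forall k, exists b, heat_at (fun t x => gauss s t (x - y k)) t' x' (2^-1 * b) b.
    by move=> k; apply: heat_at_gauss => //; exact: ltW.
  have h1 := heat_at_sum (index_iota 0 n) (fun k => heat_atZ (c k) (hb k)).
  have h2 := heat_atZ (B / K ^+ 2) (heat_at_sqr t' x').
  have h := heat_atD (heat_atD (heat_atD h1 h2) (heat_at_cst a t' x')) (heat_at_time (2 * E0) t' x').
  do 2 eexists; split; [exact: (heat_at_dt h)|exact: (heat_at_dxx h)|].
  have -> : \sum_(i <- index_iota 0 n) c i * (2^-1 * b i) = 2^-1 * \sum_(i <- index_iota 0 n) c i * b i.
    by rewrite mulr_sumr; apply: eq_bigr => k _; ring.
  have aux (S Q r : R) : 0 < r -> 2^-1 * (S + Q * 2 + 0 + 0) + r < 2^-1 * S + Q * 1 + 0 + 2 * r by lra.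
  exact: aux.
Qed.

End disc_bound.

(** * Initial discrepancy *)

Section real_prelim.
Variable R : realType.

(** Only [x] is confined to the segment; [y] may leave it, which avoids edge effects at the ends of
    the box. *)
Lemma heine (v : R -> R) (a b eps : R) : continuous v -> 0 < eps -> exists2 dl, 0 < dl &
  forall x y, a <= x <= b -> `|x - y| < dl -> `|v x - v y| < eps.
Proof.
move=> cv eps0; pose P (d x : R) := forall y, `|x - y| < d -> `|v x - v y| < eps.
have := (compact_near_coveringP `[a, b]%classic).1 (@segment_compact R a b) R (0^'+) P _.
have H x : `[a, b]%classic x -> \forall x' \near x & d \near 0^'+, P d x'.
  move=> _; have eps2 : 0 < eps / 2 by rewrite divr_gt0.
  have := cv x; move/cvgrPdist_lt => /(_ _ eps2) [r /= r0 Hr].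
  have r2 : 0 < r / 2 by rewrite divr_gt0.
  exists (ball x (r / 2), [set d | d < r / 2]) => /=.
    split; first exact: nbhsx_ballx.
    by exists (r / 2) => // d /=; rewrite sub0r normrN => h d0; rewrite (le_lt_trans (ler_norm _)).
  move=> [x' d] /= [bx dr] y hy; rewrite /ball /= in bx.
  have h1 : `|v x - v x'| < eps / 2 by apply: Hr; rewrite /ball_ /= (lt_trans bx)//; lra.
  have h2 : `|v x - v y| < eps / 2.
    apply: Hr; rewrite /ball_ /=.
    have -> : x - y = (x - x') + (x' - y) by ring.
    by rewrite (le_lt_trans (ler_normD _ _))//; lra.
  have -> : v x' - v y = (v x - v y) - (v x - v x') by ring.
  by rewrite (le_lt_trans (ler_normB _ _))//; lra.
move=> /(_ _ H) [dl /= dl0 Hd].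
exists (dl / 2); first by rewrite divr_gt0.
move=> x y xab; have d2 : 0 < dl / 2 by rewrite divr_gt0.
apply: (Hd (dl / 2) _ d2) => /=; last by rewrite in_itv.
by rewrite sub0r normrN gtr0_norm//; lra.
Qed.

(** Monotonicity provides both one-sided limits, with [F x] between them, so continuity can only
    fail by a jump, which is what [discontinuity] records. *)
Lemma nd_continuous (F : R -> R) (x : R) : {homo F : x y / x <= y} -> ~ discontinuity F x ->
  {for x, continuous F}.
Proof.
move=> ndF nd.
have cr : cvg (F y @[y --> x^'+]).
  apply: nondecreasing_at_right_is_cvgr.
    by apply: nearW => z; move=> p q _ _; exact: ndF.
  apply: nearW => z; exists (F x) => _ [y /= + <-].
  by rewrite in_itv /= => /andP[xy _]; apply: ndF; exact: ltW.
have cl : cvg (F y @[y --> x^'-]).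
  apply: nondecreasing_at_left_is_cvgr.
    by apply: nearW => z; move=> p q _ _; exact: ndF.
  apply: nearW => z; exists (F x) => _ [y /= + <-].
  by rewrite in_itv /= => /andP[_ xy]; apply: ndF; exact: ltW.
have ll : lim (F y @[y --> x^'-]) <= F x.
  apply: limr_le => //; near=> y; apply: ndF; apply: ltW; near: y; exact: nbhs_left_lt.
have lr : F x <= lim (F y @[y --> x^'+]).
  apply: limr_ge => //; near=> y; apply: ndF; apply: ltW; near: y; exact: nbhs_right_gt.
have E : lim (F y @[y --> x^'-]) = lim (F y @[y --> x^'+]).
  by apply/eqP; apply: contrapT => /negP ne; apply: nd; split.
apply/left_right_continuousP; split.
  by have -> : F x = lim (F y @[y --> x^'-]) by apply/eqP; rewrite eq_le ll andbT E.
by have -> : F x = lim (F y @[y --> x^'+]) by apply/eqP; rewrite eq_le lr /= -E.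
Unshelve. all: by end_near. Qed.

Lemma df01 (F : R -> R) : distribution_function F -> forall x, 0 <= F x <= 1.
Proof.
move=> [ndF _ cN cP] x; apply/andP; split; rewrite leNgt; apply/negP => h.
  have : \forall y \near -oo, F y <= F x.
    by exists x; split; [exact: num_real|move=> y yx; apply: ndF; exact: ltW].
  have : \forall y \near -oo, F x < F y.
    by apply: (cvgr_gt _ cN).
  move=> h1 h2; have [y [h3 h4]] := @filter_ex _ _ _ _ (filterI h1 h2).
  by move: h3; rewrite ltNge h4.
have : \forall y \near +oo, F x <= F y.
  by exists x; split; [exact: num_real|move=> y yx; apply: ndF; exact: ltW].
have : \forall y \near +oo, F y < F x.
  by apply: (cvgr_lt _ cP).
move=> h1 h2; have [y [h3 h4]] := @filter_ex _ _ _ _ (filterI h1 h2).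
by move: h3; rewrite ltNge h4.
Qed.

Lemma itv_fin (a b : R) : ((@lebesgue_measure R) `[a, b]%classic < +oo)%E.
Proof. by rewrite /= lebesgue_measure_itv /=; case: ifP => _; rewrite ?ltry. Qed.

(** Convergence holds at the continuity points of [u0], hence off a countable null set, and
    boundedness turns it into L^1 convergence along the times [n.+1^-1]. *)
Lemma L1_initial (u : R -> R -> R) (u0 : R -> R) (K M eta s1 : R) :
  {homo u0 : x y / x <= y} -> (forall x, 0 <= u0 x <= 1) ->
  (forall t, 0 < t -> continuous (u t)) -> (forall t x, 0 < t <= 1 -> `|u t x| <= M) ->
  (forall x, {for x, continuous u0} -> u t x @[t --> 0^'+] --> u0 x) ->
  0 < eta -> 0 < s1 ->
  exists s, [/\ 0 < s, s < s1, s <= 1 & Rintegral lebesgue_measure `[- K, K] (fun x => `|u s x - u0 x|) < eta].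
Proof.
move=> nd01 b01 cu uM uc eta0 s10.
pose mu := @lebesgue_measure R; pose D := `[- K, K]%classic : set R.
have mD : measurable D by exact: measurable_itv.
pose g n x := `|u n.+1%:R^-1 x - u0 x|.
have mu0 : measurable_fun D u0 by exact: nondecreasing_measurable.
have sn n : 0 < (n.+1%:R^-1 : R) by rewrite invr_gt0.
have mg n : measurable_fun D (g n).
  rewrite /g; apply: measurableT_comp => //; apply: measurable_funB => //.
  by apply: (measurable_funS measurableT) => //; apply: continuous_measurable_fun; exact: cu.
have gM n x : `|g n x| <= M + 1.
  rewrite normr_id (le_trans (ler_normB _ _))// lerD//.
    by apply: uM; rewrite sn /= invf_le1// ler1n.
  by have /andP[? ?] := b01 x; rewrite ger0_norm.
have ae0 : {ae mu, forall x, D x -> (fun n => (g n x)%:E) @ \oo --> (0 : R)%:E}.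
  pose B := [set x | x \in (`](- K - 1), (K + 1)[) /\ discontinuity u0 x].
  have cB : countable B by apply: discontinuity_countable => p q _ _; exact: nd01.
  have B0 : mu.-negligible B by apply/negligibleP; [exact: countable_measurable|exact: countable_lebesgue_measure0].
  apply: (negligibleS _ B0) => x /= hx; apply: contrapT => nB; apply: hx => Dx.
  have cx : {for x, continuous u0}.
    apply: nd_continuous => // dx; apply: nB; split => //.
    by move: Dx; rewrite /D /= !in_itv /= => /andP[h1 h2]; apply/andP; split; lra.
  apply: cvg_EFin; first exact: nearW.
  have h : u n.+1%:R^-1 x @[n --> \oo] --> u0 x.
    apply: (@cvg_comp _ _ _ (fun n => n.+1%:R^-1 : R) (fun t => u t x)); last exact: uc.
    move=> A [e /= e0 Ae]; have : \forall n \near \oo, (n.+1%:R^-1 : R) < e.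
      by apply: (near_infty_natSinv_lt (PosNum e0)).
    apply: filterS => n ne; apply: Ae => //=.
    by rewrite sub0r normrN gtr0_norm.
  rewrite -(normr0 R) -(subrr (u0 x)); apply: cvg_norm; apply: cvgB => //; exact: cvg_cst.
have ig : mu.-integrable D (EFin \o cst (M + 1)).
  apply: (@bounded_integrable _ _ _ mu D mD (itv_fin _ _) _ `|M + 1|) => //.
have gae : {ae mu, forall x n, D x -> (`|(g n x)%:E| <= (EFin \o cst (M + 1)%R) x)%E}.
  by apply: aeW => x n Dx; rewrite /= lee_fin; exact: gM.
have [_ _ h] := @dominated_convergence _ _ _ mu D mD (fun n x => (g n x)%:E) (cst 0%E)
  (EFin \o cst (M + 1)) (fun n => (measurable_EFinP _ _).2 (mg n)) (measurable_cst _) ae0 ig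
  gae.
rewrite integral_cst// mul0e in h.
have {}h : Rintegral mu D (g n) @[n --> \oo] --> (0 : R) by exact: fine_cvg h.
have h1 : \forall n \near \oo, `|Rintegral mu D (g n)| < eta.
  by move/cvgr0Pnorm_lt : h => /(_ _ eta0).
have h2 : \forall n \near \oo, (n.+1%:R^-1 : R) < s1 by apply: (near_infty_natSinv_lt (PosNum s10)).
have [n [n1 n2]] := @filter_ex _ _ _ _ (filterI h1 h2).
exists n.+1%:R^-1; split => //; first by rewrite invf_le1// ler1n.
exact: le_lt_trans (ler_norm _) n1.
Qed.

End real_prelim.

(** * Smoothed versus sharp distribution function *)

Section emp_FN.
Variables (R : realType) (N : nat) (e : R).
Hypotheses (N2 : (2 <= N)%N) (e0 : 0 < e).

Let n0 : 0 < N%:R :> R. Proof. by rewrite ltr0n; exact: leq_trans N2. Qed.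

Lemma FNE (z : 'rV[R]_N) y : FN z y = N%:R^-1 * \sum_(i < N) (z ord0 i <= y)%R%:R.
Proof.
rewrite /FN mulrC; congr (_ * _).
rewrite -sum1_card natr_sum big_mkcond /=; apply: eq_bigr => i _.
have -> : (i \in in_set [set i0 | z ord0 i0 <= y]) = (z ord0 i <= y) by apply/asboolP/idP.
by case: (_ <= _).
Qed.

Lemma FN01 (z : 'rV[R]_N) y : 0 <= FN z y <= 1.
Proof.
rewrite FNE mulrC divr_ge0 ?sumr_ge0 ?ler_pdivrMr ?mul1r//=.
rewrite (@le_trans _ _ (\sum_(i < N) 1))//; last by rewrite sumr_const card_ord.
by apply: ler_sum => i _; case: (_ <= y).
Qed.

Lemma FN_nd (z : 'rV[R]_N) x y : x <= y -> FN z x <= FN z y.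
Proof.
move=> xy; rewrite !FNE ler_pM2l ?invr_gt0//; apply: ler_sum => i _.
by case: (leP (z ord0 i) x) => // h; rewrite (le_trans h xy).
Qed.

(** A particle left of [x + h] contributes at most 1 to the smoothed sum, any other at most
    [expR (- (h / e))]. *)
Lemma emp_le_FN (z : 'rV[R]_N) x h : 0 < h -> emp 'X e x z <= FN z (x + h) + expR (- (h / e)).
Proof.
move=> h0; rewrite empX FNE.
have -> : expR (- (h / e)) = N%:R^-1 * \sum_(i < N) expR (- (h / e)).
  by rewrite sumr_const card_ord -(mulr_natl (expR _)) mulrA mulVf ?mul1r// gt_eqF.
rewrite -mulrDr ler_pM2l ?invr_gt0// -big_split /=; apply: ler_sum => i _.
case: (leP (z ord0 i) (x + h)) => hi.
  by rewrite (le_trans (ltW (logi_lt1 _)))// lerDl expR_ge0.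
rewrite add0r (le_trans (logi_le_expR _))// ler_expR -mulNr ler_pM2r ?invr_gt0//; lra.
Qed.

Lemma emp_ge_FN (z : 'rV[R]_N) x h : 0 < h -> FN z (x - h) - expR (- (h / e)) <= emp 'X e x z.
Proof.
move=> h0; rewrite empX FNE.
have -> : expR (- (h / e)) = N%:R^-1 * \sum_(i < N) expR (- (h / e)).
  by rewrite sumr_const card_ord -(mulr_natl (expR _)) mulrA mulVf ?mul1r// gt_eqF.
rewrite -mulrBr ler_pM2l ?invr_gt0// -sumrB /=; apply: ler_sum => i _.
case: (leP (z ord0 i) (x - h)) => hi.
  rewrite (le_trans _ (logi_ge_expR _))// lerD2l lerN2 ler_expR lerN2 ler_pM2r ?invr_gt0//; lra.
by rewrite sub0r (le_trans _ (ltW (logi_gt0 _)))// oppr_le0 expR_ge0.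
Qed.

End emp_FN.

(** * Cells of the box *)

Section cells.
Variables (R : realType) (K s : R) (n : nat).
Hypotheses (s0 : 0 < s) (nK : n%:R * s = 2 * K).
Variables (g u0 : R -> R) (B : R).
Hypotheses (mg : measurable_fun `[- K, K] g) (gB : forall x, 0 <= g x <= B).
Hypotheses (nd0 : {homo u0 : x y / x <= y}) (b01 : forall x, 0 <= u0 x <= 1).

Definition cell (k : nat) : R := - K + k%:R * s.

Let Phi (b : R) := Rintegral lebesgue_measure `[- K, b] g.

Definition cellavg (k : nat) : R := s^-1 * (Phi (cell k.+1) - Phi (cell k)).

(* The window exceeds the cell by [s] on both sides because the smoothed and the
   sharp distribution functions are compared at distance [s]. *)
Definition celljump (k : nat) : R := u0 (cell k + 2 * s) - u0 (cell k - s).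

Lemma cellS k : cell k.+1 = cell k + s.
Proof. by rewrite /cell -natr1; ring. Qed.

Lemma cell_le k : (k <= n)%N -> - K <= cell k <= K.
Proof.
move=> kn; rewrite /cell lerDl mulr_ge0 ?(ltW s0)//=.
have : k%:R * s <= n%:R * s by rewrite ler_pM2r// ler_nat.
by rewrite nK; lra.
Qed.

Let g_int a b : - K <= a -> b <= K -> (@lebesgue_measure R).-integrable `[a, b] (EFin \o g).
Proof.
move=> aK bK; apply: (@bounded_integrable _ _ _ _ _ _ (itv_fin a b) _ B) => //.
  apply: measurable_funS mg => //; apply: subset_itvScc; rewrite bnd_simp //.
by move=> x _; have /andP[? ?] := gB x; rewrite ger0_norm.
Qed.

Lemma celljump_ge0 k : 0 <= celljump k.
Proof. by rewrite subr_ge0; apply: nd0; have := s0; lra. Qed.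

(** Turns an estimate with a free point [y] of the cell into one with the cell average, so that only
    the integral of [g] has to be small. *)
Lemma cellavg_ge k q : (k < n)%N -> (forall y, cell k <= y <= cell k.+1 -> q <= g y) -> q <= cellavg k.
Proof.
move=> kn qg; rewrite /cellavg mulrC ler_pdivlMr//.
have /andP[k1 k2] := cell_le (ltnW kn); have /andP[k3 k4] := cell_le kn.
have kk : cell k <= cell k.+1 by rewrite cellS lerDl ltW.
rewrite /Phi Rintegral_itvB; [|exact: g_int|by rewrite bnd_simp|by rewrite bnd_simp].
have -> : q * s = Rintegral (@lebesgue_measure R) `]cell k, cell k.+1] (fun=> q).
  rewrite Rintegral_cst//= lebesgue_measure_itv /= lte_fin cellS ltrDl s0 /=.
  by congr (_ * _); ring.
have sub : `]cell k, cell k.+1]%classic `<=` `[cell k, cell k.+1]%classic.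
  by move=> x /=; rewrite !in_itv /= => /andP[/ltW -> ->].
apply: le_Rintegral => //.
- apply: (@integrableS _ _ _ (@lebesgue_measure R) `[cell k, cell k.+1]%classic) => //.
  exact: (@bounded_integrable _ _ _ _ _ _ (itv_fin _ _) _ `|q|).
- apply: (@integrableS _ _ _ (@lebesgue_measure R) `[cell k, cell k.+1]%classic) => //.
  exact: g_int.
- by move=> x; rewrite /= in_itv /= => /andP[h1 h2]; apply: qg; rewrite (ltW h1).
Qed.

Lemma cellavg_ge0 k : (k < n)%N -> 0 <= cellavg k.
Proof. by move=> kn; apply: cellavg_ge => // y _; have /andP[] := gB y. Qed.

Lemma sum_cellavg : \sum_(0 <= k < n) cellavg k * s = Rintegral lebesgue_measure `[- K, K] g.
Proof.
rewrite (eq_bigr (fun k => Phi (cell k.+1) - Phi (cell k))); last first.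
  by move=> k _; rewrite /cellavg mulrC mulrA mulfV ?mul1r// gt_eqF.
rewrite telescope_sumr// /Phi.
have -> : cell n = K by rewrite /cell nK; ring.
have -> : cell 0 = - K by rewrite /cell mul0r addr0.
by rewrite set_itv1 Rintegral_set1 subr0.
Qed.

(** The window has length [3 * s], so the sum splits into three telescoping sums, each at most 1
    because [u0] takes values in [0, 1]. *)
Lemma sum_celljump : \sum_(0 <= k < n) celljump k <= 3.
Proof.
have T (c : R) : \sum_(0 <= k < n) (u0 (cell k + c + s) - u0 (cell k + c)) <= 1.
  rewrite (eq_bigr (fun k => u0 (cell k.+1 + c) - u0 (cell k + c))); last first.
    by move=> k _; rewrite cellS; congr (u0 _ - _); ring.
  rewrite telescope_sumr//.
  by have /andP[? ?] := b01 (cell n + c); have /andP[? ?] := b01 (cell 0 + c); lra.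
rewrite (eq_bigr (fun k => (u0 (cell k + s + s) - u0 (cell k + s)) + ((u0 (cell k + 0 + s) - u0 (cell k + 0)) + (u0 (cell k + - s + s) - u0 (cell k + - s))))).
  rewrite big_split /= [X in _ + X]big_split /=; apply: (@le_trans _ _ (1 + (1 + 1))); last lra.
  apply: lerD; [exact: (T s)|apply: lerD; [exact: (T 0)|exact: (T (- s))]].
move=> k _; rewrite /celljump addr0 subrK.
have -> : cell k + 2 * s = cell k + s + s by ring.
ring.
Qed.

Lemma cell_cover x : (0 < n)%N -> `|x| <= K -> exists2 k, (k < n)%N & cell k <= x <= cell k.+1.
Proof.
move=> n0; rewrite ler_norml => /andP[x1 x2].
have xs : 0 <= (x + K) / s by rewrite divr_ge0 ?(ltW s0)//; lra.
have /truncn_itv/andP[t1 t2] := xs; set k := Num.trunc _ in t1 t2.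
rewrite ler_pdivlMr// in t1; rewrite ltr_pdivrMr// in t2.
have [kn|nk] := ltnP k n.
  exists k => //; rewrite cellS /cell; rewrite -natr1 in t2; apply/andP; split; lra.
(* Truncation overshoots at the right end of the box, which belongs to the last cell. *)
exists n.-1; first by rewrite prednK.
rewrite prednK//.
have h1 : n%:R * s <= k%:R * s by rewrite ler_pM2r// ler_nat.
have h2 : n.-1%:R * s <= n%:R * s by rewrite ler_pM2r// ler_nat leq_pred.
have aux (p q r : R) : p <= q -> q <= r -> r <= x + K -> - K + p <= x by lra.
rewrite /cell (aux _ _ _ h2 h1 t1) /= nK.
by have -> : - K + 2 * K = K by ring.
Qed.

End cells.

(** * Exceptional events *)

Section exceptional_events.
Context (R : realType) (N : nat) d (Omega : measurableType d).
Variables (P : probability Omega R) (xi : R -> Omega -> 'rV[R]_N).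
Hypothesis HL : is_L_process P xi.

Lemma supnorm_le (g : R -> R) (c : R) : ~ (c%:E < supnorm g)%E -> forall y, `|g y| <= c.
Proof.
move=> /negP; rewrite -leNgt => h y; rewrite -lee_fin (le_trans _ h)//.
by apply: ereal_sup_ubound; exists y.
Qed.

Lemma Ex_exceptional g t (A : set Omega) (b C p : R) : bmeas g -> 0 <= t -> measurable A ->
  (forall w, ~ A w -> g (xi t w) <= b) -> (forall z, g z <= C) -> 0 <= b -> 0 <= C ->
  (P A < p%:E)%E -> Ex P xi g t <= b + C * p.
Proof.
move=> bg t0 mA gb gC b0 C0 PA.
have fP : (P setT < +oo)%E by rewrite [X in (X < _)%E](_ : _ = 1%E) ?ltry//; exact: probability_setT.
have i1 : P.-integrable setT (EFin \o (fun=> b)).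
  exact: (@bounded_integrable _ _ _ P setT measurableT fP _ `|b|).
have i2 : P.-integrable setT (EFin \o (\1_A : Omega -> R)).
  apply: (@bounded_integrable _ _ _ P setT measurableT fP _ 1) => // w _.
  by rewrite indicE; case: (_ \in _); rewrite ?normr1 ?normr0.
have i3 : P.-integrable setT (EFin \o (fun w => C * (\1_A w : R))).
  apply: (@bounded_integrable _ _ _ P setT measurableT fP _ C) => //.
    by apply: measurable_funM => //; exact: measurable_indic.
  move=> w _; rewrite normrM (ger0_norm C0) indicE.
  by case: (_ \in _); rewrite ?normr1 ?normr0 ?mulr1 ?mulr0.
apply: (@le_trans _ _ (Rintegral P setT (fun w => b + C * (\1_A w : R)))).
  apply: le_Rintegral => //; first exact: (integrable_xi HL).
    apply: (@bounded_integrable _ _ _ P setT measurableT fP _ (b + C)) => //.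
      by apply: measurable_funD => //; apply: measurable_funM => //; exact: measurable_indic.
    move=> w _; rewrite indicE ger0_norm; case: (_ \in _); rewrite ?mulr1 ?mulr0 ?addr0 ?addr_ge0//.
    by rewrite lerDl.
  move=> w _; rewrite indicE; case: (boolP (w \in A)) => wA; rewrite ?mulr1 ?mulr0 ?addr0.
    by rewrite (le_trans (gC _))// lerDr.
  by apply: gb => /mem_set; exact/negP.
rewrite RintegralD// RintegralZl// lerD//; first by rewrite -[leRHS](Ex_cst P xi b t).
rewrite ler_wpM2l// /Rintegral integral_indic// setIT.
by rewrite -lee_fin fineK ?(ltW PA)// fin_num_measure.
Qed.

Lemma Ex_markov g t (a : R) : bmeas g -> 0 <= t -> (forall z, 0 <= g z) -> 0 < a ->
  measurable [set w | a < g (xi t w)] /\ (P [set w | (a < g (xi t w))%R] <= (Ex P xi g t / a)%:E)%E.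
Proof.
move=> bg t0 g0 a0.
have fP : (P setT < +oo)%E by rewrite [X in (X < _)%E](_ : _ = 1%E) ?ltry//; exact: probability_setT.
have mg := measurable_xi HL bg t0.
have mA : measurable [set w | a < g (xi t w)].
  have -> : [set w | a < g (xi t w)] = setT `&` (fun w => g (xi t w)) @^-1` `]a, +oo[%classic.
    by rewrite setTI; apply/seteqP; split => w /=; rewrite in_itv /= andbT.
  exact: mg.
split => //; set A := [set _ | _] in mA *.
have i2 : P.-integrable setT (EFin \o (fun w => a * (\1_A w : R))).
  apply: (@bounded_integrable _ _ _ P setT measurableT fP _ a) => //.
    by apply: measurable_funM => //; exact: measurable_indic.
  move=> w _; rewrite normrM (ger0_norm (ltW a0)) indicE.
  by case: (_ \in _); rewrite ?normr1 ?normr0 ?mulr1 ?mulr0// ltW.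
have i1 : P.-integrable setT (EFin \o (\1_A : Omega -> R)).
  apply: (@bounded_integrable _ _ _ P setT measurableT fP _ 1) => // w _.
  by rewrite indicE; case: (_ \in _); rewrite ?normr1 ?normr0.
have fA : P A \is a fin_num by exact: fin_num_measure.
rewrite -(fineK fA) lee_fin ler_pdivlMr// mulrC.
have -> : a * fine (P A) = Rintegral P setT (fun w => a * (\1_A w : R)).
  by rewrite RintegralZl// /Rintegral integral_indic// setIT.
apply: le_Rintegral => //; first exact: (integrable_xi HL).
move=> w _; rewrite indicE; case: (boolP (w \in A)) => wA; rewrite ?mulr1 ?mulr0//.
by move: wA; rewrite inE => /ltW.
Qed.

End exceptional_events.

Section initial_discrepancy.
Context (R : realType) (N : nat) d (Omega : measurableType d).
Variables (P : probability Omega R) (xi : R -> Omega -> 'rV[R]_N).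
Hypothesis HL : is_L_process P xi.
Hypothesis N2 : (2 <= N)%N.
Variables (e M K s kap : R) (n : nat) (u0 v : R -> R).
Hypotheses (e0 : 0 < e) (e1 : e <= 1) (M0 : 0 <= M) (s0 : 0 < s) (n0 : (0 < n)%N) (nK : n%:R * s = 2 * K).
Hypotheses (nd0 : {homo u0 : x y / x <= y}) (b01 : forall x, 0 <= u0 x <= 1).
Hypotheses (mv : measurable_fun `[- K, K] v) (vM : forall x, `|v x| <= M).
Hypothesis unif : forall x y, - K <= x <= K -> `|x - y| <= s -> `|v x - v y| <= kap.

Let g y := `|v y - u0 y|.

Let gB y : 0 <= g y <= M + 1.
Proof.
rewrite normr_ge0 /= (le_trans (ler_normB _ _))// lerD//.
by have /andP[? ?] := b01 y; rewrite ger0_norm.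
Qed.

Let mg : measurable_fun `[- K, K] g.
Proof.
rewrite /g; apply: measurableT_comp => //; apply: measurable_funB => //.
exact: nondecreasing_measurable.
Qed.

(** With [x] fixed and [y] free in the same cell, the smoothed value is within one window jump of
    [u0 y], then [u0 y] is compared with [v y] and [v y] with [v x]. The two [kap] come from the
    empirical distribution function and from the modulus of continuity of [v]. *)
Lemma initial_pointwise (z : 'rV[R]_N) k x : (k < n)%N -> cell K s k <= x <= cell K s k.+1 ->
  (forall y, `|FN z y - u0 y| <= kap) ->
  `|emp 'X e x z - v x| <= 2 * kap + expR (- (s / e)) + (celljump K s u0 k + cellavg K s g k).
Proof.
move=> kn /andP[x1 x2] hF.
suff : `|emp 'X e x z - v x| - (2 * kap + expR (- (s / e)) + celljump K s u0 k) <= cellavg K s g k by lra.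
apply: (cellavg_ge s0 nK mg gB kn) => y /andP[y1 y2].
rewrite cellS in x2 y2.
have /andP[k1 _] := cell_le s0 nK (ltnW kn).
have /andP[_ k2] := cell_le s0 nK kn; rewrite cellS in k2.
have h1 : `|emp 'X e x z - u0 y| <= kap + expR (- (s / e)) + celljump K s u0 k.
  have ub := emp_le_FN N2 e0 z x s0; have lb := emp_ge_FN N2 e0 z x s0.
  have /ler_normlP[_ p1] := hF (x + s); have /ler_normlP[p2 _] := hF (x - s).
  have q1 : u0 (x + s) <= u0 (cell K s k + 2 * s) by apply: nd0; lra.
  have q2 : u0 (cell K s k - s) <= u0 (x - s) by apply: nd0; lra.
  have q3 : u0 (cell K s k - s) <= u0 y by apply: nd0; have := s0; lra.
  have q4 : u0 y <= u0 (cell K s k + 2 * s) by apply: nd0; have := s0; lra.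
  by rewrite /celljump; apply/ler_normlP; split; lra.
have h2 : `|v x - v y| <= kap.
  by apply: unif; [apply/andP; split; lra|apply/ler_normlP; split; lra].
have -> : emp 'X e x z - v x = (emp 'X e x z - u0 y) - (v y - u0 y) - (v x - v y) by ring.
have := ler_normB ((emp 'X e x z - u0 y) - (v y - u0 y)) (v x - v y).
have := ler_normB (emp 'X e x z - u0 y) (v y - u0 y).
by rewrite /g; lra.
Qed.

(** The square is bounded by [1 + M] times the modulus, which makes the estimate linear in the cell
    quantities, so that smallness in L^1 can be used. On the exceptional event the trivial bound is
    paid with weight [p]. *)
Lemma initial_disc (A : set Omega) (p : R) (U : R -> R -> R) k x : U 0 = v ->
  measurable A -> (P A < p%:E)%E ->
  (forall w, ~ A w -> forall y, `|FN (xi 0 w) y - u0 y| <= kap) ->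
  (k < n)%N -> cell K s k <= x <= cell K s k.+1 ->
  disc P xi e U 0 x <= (1 + M) * (2 * kap + expR (- (s / e)) + (celljump K s u0 k + cellavg K s g k)) + e
    + ((1 + M) ^+ 2 + 1) * p.
Proof.
move=> U0 mA PA hA kn xk.
have kap0 : 0 <= kap.
  have K0 : 0 <= 2 * K by rewrite -nK mulr_ge0// ltW.
  rewrite -[leLHS](normr0 R) -(subrr (v K)); apply: unif; last by rewrite subrr normr0 ltW.
  by rewrite lexx andbT; lra.
have M1 : 0 <= 1 + M by rewrite addr_ge0.
set Q := _ + (_ + cellavg _ _ _ _).
have Q0 : 0 <= Q.
  apply: addr_ge0; first by rewrite addr_ge0 ?expR_ge0// mulr_ge0.
  by rewrite addr_ge0 ?(celljump_ge0 _ s0 nd0)//; exact: (cellavg_ge0 s0 nK mg gB kn).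
apply: (@Ex_exceptional _ _ _ _ P xi HL _ 0 A) => //.
- exact/is_C2b_bmeas/is_C2b_dens.
- move=> w Aw; have /andP[F0 F1] := empX01 e x N2 (xi 0 w).
  have := initial_pointwise kn xk (hA w Aw); rewrite -/Q /dens U0 => h.
  set F := emp _ _ _ _ in F0 F1 h *.
  have h1 : `|F - v x| <= 1 + M.
    by rewrite (le_trans (ler_normB _ _))// lerD// ger0_norm.
  apply: lerD.
    by rewrite -real_normK ?num_real// expr2 ler_pM.
  by rewrite ler_piMr ?(ltW e0)// exprn_ile1.
- move=> z; rewrite /dens U0; have /andP[F0 F1] := empX01 e x N2 z.
  set F := emp _ _ _ _ in F0 F1 *.
  have h1 : `|F - v x| <= 1 + M.
    by rewrite (le_trans (ler_normB _ _))// lerD// ger0_norm.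
  apply: lerD; first by rewrite -real_normK ?num_real// ler_pXn2r ?nnegrE.
  by rewrite mulr_ile1 ?(ltW e0)// ?exprn_ge0 ?exprn_ile1.
- by rewrite addr_ge0 ?mulr_ge0// ltW.
- by rewrite addr_ge0 ?sqr_ge0.
Qed.

End initial_discrepancy.

Section final_discrepancy.
Context (R : realType) (N : nat) d (Omega : measurableType d).
Variables (P : probability Omega R) (xi : R -> Omega -> 'rV[R]_N).
Hypothesis HL : is_L_process P xi.
Hypothesis N2 : (2 <= N)%N.
Variables (e M K s kap p T a : R) (n : nat) (u0 : R -> R) (U : R -> R -> R) (A : set Omega).
Hypotheses (e0 : 0 < e) (e1 : e <= 1) (M0 : 0 <= M) (s0 : 0 < s) (n0 : (0 < n)%N) (nK : n%:R * s = 2 * K).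
Hypotheses (nd0 : {homo u0 : x y / x <= y}) (b01 : forall x, 0 <= u0 x <= 1).
Hypotheses (K0 : 0 < K) (T0 : 0 < T).
Hypothesis cU : continuous (fun p : R * R => U (Num.max 0 p.1) p.2).
Hypothesis cU0 : continuous (U 0).
Hypothesis UM : forall t x, 0 <= t <= T -> `|U t x| <= M.
Hypothesis UP : forall t x, 0 < t -> [/\ derivable (fun s => U s x) t 1, derivable (U t) x 1,
     derivable (derive1 (U t)) x 1
     & derive1 (fun s => U s x) t = 2^-1 * derive1 (derive1 (U t)) x + U t x ^+ 2 - U t x].
Hypothesis unif : forall x y, - K <= x <= K -> `|x - y| <= s -> `|U 0 x - U 0 y| <= kap.
Hypotheses (mA : measurable A) (PA : (P A < p%:E)%E).
Hypothesis hA : forall w, ~ A w -> forall y, `|FN (xi 0 w) y - u0 y| <= kap.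
Hypothesis ha : (1 + M) * (2 * kap + expR (- (s / e))) + e + ((1 + M) ^+ 2 + 1) * p < a.

(** The Gaussian attached to cell [k] dominates the initial discrepancy on that cell, but by time
    [T] has decayed to a multiple of [w k * s]; these sum to at most [3 * s] plus the L^1 distance
    between [U 0] and [u0]. *)
Lemma final_disc x : `|x| <= K -> disc P xi e U T x <= expR (2 * (1 + M) * T) *
  ((1 + M) * expR 2^-1 * expR (- 2^-1 * ln T) * (3 * s + Rintegral lebesgue_measure `[- K, K] (fun y => `|U 0 y - u0 y|))
   + ((1 + M) ^+ 2 + 1) / K ^+ 2 * (x ^+ 2 + T) + a + 2 * (e * (1 + M) ^+ 2 + 2 * (2 + M) * noise N e) * T).
Proof.
move=> xK; set g := fun y => `|U 0 y - u0 y|.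
have M1 : 0 <= 1 + M by rewrite addr_ge0.
have mU0 : measurable_fun `[- K, K] (U 0).
  by apply: (measurable_funS measurableT) => //; exact: continuous_measurable_fun.
have U0M y : `|U 0 y| <= M by apply: UM; rewrite lexx ltW.
have gB y : 0 <= g y <= M + 1.
  rewrite normr_ge0 /= (le_trans (ler_normB _ _))// lerD//.
  by have /andP[? ?] := b01 y; rewrite ger0_norm.
have mg : measurable_fun `[- K, K] g.
  rewrite /g; apply: measurableT_comp => //; apply: measurable_funB => //.
  exact: nondecreasing_measurable.
pose w k := celljump K s u0 k + cellavg K s g k.
have w0 k : (k < n)%N -> 0 <= w k.
  by move=> kn; rewrite addr_ge0 ?(celljump_ge0 _ s0 nd0)//; exact: (cellavg_ge0 s0 nK mg gB kn).
(* [expR 2^-1] undoes the lower bound [expR (- 2^-1)] of the Gaussian on its cell; the value 0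
   beyond [n] keeps every weight nonnegative. *)
pose c k := if (k < n)%N then (1 + M) * expR 2^-1 * w k else 0.
have c0 k : 0 <= c k.
  by rewrite /c; case: ifP => // kn; rewrite !mulr_ge0 ?expR_ge0// w0.
have p0 : 0 <= p by rewrite -lee_fin (le_trans _ (ltW PA)).
have a0 : 0 < a.
  apply: le_lt_trans ha; rewrite addr_ge0//; last by rewrite mulr_ge0// addr_ge0// sqr_ge0.
  rewrite addr_ge0// ?(ltW e0)// mulr_ge0// addr_ge0 ?expR_ge0// mulr_ge0//.
  by rewrite (le_trans _ (unif (x := K) (y := K) _ _))//; [rewrite lexx andbT ge0_cp// ltW|rewrite subrr normr0 ltW].
have init y : `|y| <= K -> disc P xi e U 0 y < \sum_(0 <= k < n) c k * gauss s 0 (y - cell K s k) + a.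
  move=> yK; have [k kn yk] := cell_cover s0 nK n0 yK.
  have h := initial_disc HL N2 e0 e1 M0 s0 nK nd0 b01 mU0 U0M unif erefl mA PA hA kn yk.
  apply: (le_lt_trans h); rewrite mulrDr -/(w k).
  have h1 : (1 + M) * w k <= \sum_(0 <= k < n) c k * gauss s 0 (y - cell K s k).
    rewrite (bigD1_seq k) ?iota_uniq ?mem_index_iota//=.
    apply: ler_wpDr.
      by apply: sumr_ge0 => i _; rewrite mulr_ge0// ltW// gauss_gt0.
    have /andP[y1 y2] := yk; rewrite cellS in y2.
    have hg : expR (- 2^-1) <= gauss s 0 (y - cell K s k).
      by apply: gauss_ge0 => //; rewrite ger0_norm; lra.
    apply: (@le_trans _ _ (c k * expR (- 2^-1))); last by rewrite ler_wpM2l.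
    rewrite /c kn (_ : _ * _ * _ * _ = (1 + M) * w k * (expR 2^-1 * expR (- 2^-1))); last by ring.
    by rewrite -expRD subrr expR0 mulr1.
  have aux (q r t0 S S' z : R) : t0 + q + r < z -> S <= S' -> t0 + S + q + r < S' + z by lra.
  exact: aux ha h1.
have hb := disc_bound HL N2 e0 e1 M0 (ltW T0) K0 a0 s0 c0 cU UM UP init (t := T) (x := x).
apply: le_trans (hb _ xK) _; first by rewrite lexx ltW.
rewrite ler_wpM2l ?expR_ge0// lerD2r lerD2r lerD2r.
have -> : 3 * s + Rintegral lebesgue_measure `[- K, K] g = 3 * s + \sum_(0 <= k < n) cellavg K s g k * s.
  by rewrite (sum_cellavg s0 nK).
apply: (@le_trans _ _ (\sum_(0 <= k < n) (1 + M) * expR 2^-1 * expR (- 2^-1 * ln T) * (w k * s))).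
  apply: ler_sum_nat => k /andP[_ kn]; rewrite /c kn.
  have -> : (1 + M) * expR 2^-1 * expR (- 2^-1 * ln T) * (w k * s) = (1 + M) * expR 2^-1 * w k * (s * expR (- 2^-1 * ln T)) by ring.
  by rewrite ler_wpM2l ?gauss_le// !mulr_ge0 ?expR_ge0 ?w0.
rewrite -mulr_sumr ler_wpM2l ?mulr_ge0 ?expR_ge0//.
rewrite (eq_bigr (fun k => celljump K s u0 k * s + cellavg K s g k * s)); last by move=> k _; rewrite mulrDl.
rewrite big_split /= lerD2r -mulr_suml ler_wpM2r ?(ltW s0)//.
exact: sum_celljump.
Qed.

End final_discrepancy.

(** * Mean-square convergence at a point *)

Section mesh.
Variable R : realType.

Lemma ex_mesh (K dl : R) : 0 < K -> 0 < dl -> exists s (n : nat), [/\ 0 < s, s < dl, (0 < n)%N & n%:R * s = 2 * K].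
Proof.
move=> K0 dl0; pose n := (Num.trunc (2 * K / dl)).+1.
have K2 : 0 < 2 * K by rewrite mulr_gt0.
have n0 : 0 < n%:R :> R by rewrite ltr0n.
exists (2 * K / n%:R), n; split => //; first by rewrite divr_gt0.
  rewrite ltr_pdivrMr// [X in _ < X]mulrC -ltr_pdivrMr//.
  have q0 : 0 <= 2 * K / dl by rewrite divr_ge0// ltW.
  by have /andP[] := truncn_itv q0.
by rewrite mulrC divfK// gt_eqF.
Qed.

Lemma expRN_div_le (s e kap : R) : 0 < s -> 0 < e -> e <= kap * s -> expR (- (s / e)) <= kap.
Proof.
move=> s0 e0 es; have q0 : 0 < s / e by rewrite divr_gt0.
rewrite expRN; apply: (@le_trans _ _ (s / e)^-1).
  rewrite lef_pV2 ?posrE ?expR_gt0//; have := expR_ge1Dx (s / e); lra.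
by rewrite invf_div ler_pdivrMr.
Qed.

Lemma ex_noise_le (e th : R) : 0 < th -> exists N0, forall N, (N0 <= N)%N -> (2 <= N)%N -> noise N e <= th.
Proof.
(* Since [N.-1^-1 <= 2 / N], the noise is at most [(2 + c) / N]. *)
move=> th0; set c := e^-1 ^+ 2 + 2^-1; exists (Num.trunc ((2 + c) / th)).+1 => N hN N2.
have c0 : 0 <= c by rewrite addr_ge0// sqr_ge0.
have n0 : 0 < N%:R :> R by rewrite ltr0n (leq_trans _ N2).
have h : (2 + c) / th < N%:R.
  have q0 : 0 <= (2 + c) / th by rewrite divr_ge0 ?(ltW th0)// addr_ge0.
  have /andP[_ h] := truncn_itv q0.
  by apply: lt_le_trans h _; rewrite ler_nat.
rewrite ltr_pdivrMr// in h.
have n1 : 0 < N.-1%:R :> R by rewrite ltr0n; case: N N2 {hN n0 h} => [|[]].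
have nE : N.-1%:R = N%:R - 1 :> R by case: N N2 {hN n0 h n1} => // n _; rewrite -natr1 addrK.
apply: (@le_trans _ _ (N%:R^-1 * (2 + c))); last by rewrite mulrC ler_pdivrMr// mulrC ltW.
rewrite /noise [leRHS]mulrDr lerD2r -[leLHS]mul1r ler_pdivrMr// -mulrA ler_pdivlMl// mulr1 nE.
have : 2 <= N%:R :> R by rewrite ler_nat.
lra.
Qed.

End mesh.

(** * The solution restarted at a positive time *)

Section time_shift.
Context (R : realType) (u : R -> R -> R) (u0 : R -> R) (s : R).
Hypotheses (Hu : FKPP_solution u u0) (s0 : 0 < s).

Lemma shift_pde t x : 0 < t -> [/\ derivable (fun r => u (s + r) x) t 1, derivable (u (s + t)) x 1,
     derivable (derive1 (u (s + t))) x 1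
     & derive1 (fun r => u (s + r) x) t = 2^-1 * derive1 (derive1 (u (s + t))) x + u (s + t) x ^+ 2 - u (s + t) x].
Proof.
move=> t0; have st : 0 < s + t by rewrite addr_gt0.
have [H _ _ _] := Hu; have [h1 h2 h3 h4] := H _ x st.
have d1 := derivableP h1.
have d2 : is_derive t 1 (shift s) (1 : R) := is_derive_shift t 1 s.
rewrite addrC in d1.
have d := @is_derive1_comp _ (fun r => u r x) (shift s) t _ _ d1 d2.
rewrite mulr1 in d.
have E : (fun r => u r x) \o shift s = (fun r => u (s + r) x) by apply/funext => r /=; rewrite addrC.
rewrite E in d.
split; [|exact: h2|exact: h3|]; first by case: d.
rewrite -h4 !derive1E addrC; exact: (@derive_val _ _ _ _ _ _ _ d).
Qed.

Lemma shift_continuous : continuous (fun p : R * R => u (s + Num.max 0 p.1) p.2).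
Proof.
move=> p; have [_ H _ _] := Hu.
have h : {for (s + Num.max 0 p.1, p.2), continuous (fun p : R * R => u p.1 p.2)}.
  by apply: H; rewrite ltr_pwDl// le_max lexx.
apply: (@continuous2_cvg _ _ _ _ (nbhs p) _ (fun p : R * R => s + Num.max 0 p.1) snd u _ _ h); last exact: cvg_snd.
apply: cvgD; first exact: cvg_cst.
by apply: (@continuous_max _ _ (fun=> 0) fst); [exact: cvg_cst|exact: cvg_fst].
Qed.

Lemma solution_continuous t : 0 < t -> continuous (u t).
Proof.
move=> t0 x; have [H _ _ _] := Hu; have [_ h2 _ _] := H t x t0.
exact/differentiable_continuous/derivable1_diffP.
Qed.

Lemma solution_continuous_time t x : 0 < t -> {for t, continuous (fun r => u r x)}.
Proof.
move=> t0; have [H _ _ _] := Hu; have [h2 _ _ _] := H t x t0.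
exact/differentiable_continuous/derivable1_diffP.
Qed.

End time_shift.

Section mean_square.
Variables (R : realType) (d : nat -> measure_display) (Omega : forall N : nat, measurableType (d N)).
Variables (P : forall N : nat, probability (Omega N) R) (xi : forall N : nat, R -> Omega N -> 'rV[R]_N).
Variables (u0 : R -> R) (u : R -> R -> R).
Hypothesis HP : forall N : nat, (2 <= N)%N -> is_L_process (P N) (@xi N).
Hypothesis Hu0 : distribution_function u0.
Hypothesis Hini : cvg_in_prob0 P (fun N w => supnorm (fun x => FN (@xi N 0 w) x - u0 x)).
Hypothesis Hu : FKPP_solution u u0.
Variable T : R.
Hypothesis T0 : 0 < T.

(** Every [e] below the threshold works, so that later finitely many points and further constraints
    can share one [e]. *)
Lemma mean_square_cvg x dl : 0 < dl -> exists2 e1, 0 < e1 & forall e, 0 < e -> e <= e1 ->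
  exists N0, forall N, (N0 <= N)%N -> (2 <= N)%N ->
  Ex (P N) (@xi N) (fun z => (emp 'X e x z - u T x) ^+ 2) T <= dl.
Proof.
move=> dl0.
have nd0 : {homo u0 : x y / x <= y} by case: Hu0.
have b01 := df01 Hu0.
have [_ _ /(_ (T + 1)) UB uc] := Hu.
have T10 : 0 < T + 1 by rewrite addr_gt0.
have [M' HM'] := UB T10; pose M := `|M'|.
have M0 : 0 <= M by exact: normr_ge0.
have HM t y : 0 < t <= T + 1 -> `|u t y| <= M by move=> ht; rewrite (le_trans (HM' _ y ht))// ler_norm.
have M1 : 0 < 1 + M by rewrite ltr_pwDl.
pose EC := expR (2 * (1 + M) * T); have EC0 : 0 < EC by exact: expR_gt0.
(* Four contributions of at most [th] each, multiplied by [EC], must stay below [dl / 4]: Gaussians,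
   side barrier, initial slack, and the error accumulated in time. *)
pose th := dl / (16 * EC); have th0 : 0 < th by rewrite divr_gt0// mulr_gt0.
pose C0 := (1 + M) * expR 2^-1 * expR (- 2^-1 * ln T).
have C00 : 0 < C0 by rewrite !mulr_gt0 ?expR_gt0.
pose B := (1 + M) ^+ 2 + 1; have B0 : 0 < B by rewrite ltr_wpDl ?sqr_ge0.
have q0 : 0 <= B * (x ^+ 2 + T) / th.
  by apply: divr_ge0; [apply: mulr_ge0; [exact: ltW|apply: addr_ge0; [exact: sqr_ge0|exact: ltW]]|exact: ltW].
(* Large enough to contain [x] and to push the side barrier at [x] below [th]. *)
pose K := 1 + `|x| + B * (x ^+ 2 + T) / th.
have K1 : 1 <= K by rewrite /K -addrA lerDl addr_ge0.
have K0 : 0 < K by exact: lt_le_trans K1.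
have xK : `|x| <= K by rewrite /K addrAC lerDr addr_ge0.
have KB : B / K ^+ 2 * (x ^+ 2 + T) <= th.
  rewrite mulrAC ler_pdivrMr ?exprn_gt0// -ler_pdivrMl// mulrC.
  rewrite (@le_trans _ _ K)//; first by rewrite /K lerDr addr_ge0.
  by rewrite expr2 ler_peMl// ltW.
pose et := Num.min 1 (dl / 4); have et0 : 0 < et by rewrite lt_min ltr01 divr_gt0.
have /cvgrPdist_lt/(_ _ et0) [s1 /= s10 Hs1] := @solution_continuous_time _ _ _ Hu T x T0.
have eta0 : 0 < th / (2 * C0) by rewrite divr_gt0// mulr_gt0.
have HM1 t y : 0 < t <= 1 -> `|u t y| <= M.
  by move=> /andP[h1 h2]; apply: HM; rewrite h1 (le_trans h2)// lerDr ltW.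
have [s [s0 ss1 s1' HI]] := L1_initial K nd0 b01 (fun t => @solution_continuous _ _ _ Hu t) HM1 uc eta0 s10.
have Us : (u (s + T) x - u T x) ^+ 2 <= dl / 4.
  have h : `|u (s + T) x - u T x| <= et.
    rewrite distrC; apply: ltW; apply: Hs1 => /=.
    by rewrite opprD addrCA subrr addr0 normrN gtr0_norm.
  rewrite -real_normK ?num_real// expr2.
  apply: (@le_trans _ _ (1 * et)); last by rewrite mul1r ge_min lexx orbT.
  by apply: ler_pM => //; rewrite (le_trans h)// ge_min lexx.
(* The initial error, [3 * kap] once the exponential is bounded by [kap], then costs [3 * th / 8],
   leaving room for [th / 8] from [e] and [th / 4] from the exceptional event. *)
pose kap := th / (8 * (1 + M)); have kap0 : 0 < kap by rewrite divr_gt0// mulr_gt0.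
have kapE : (1 + M) * kap = th / 8 by rewrite /kap; field; rewrite gt_eqF.
have [dl1 dl10 Hdl1] := @heine _ (u s) (- K) K kap (@solution_continuous _ _ _ Hu s s0) kap0.
pose dl2 := Num.min dl1 (th / (6 * C0)).
have dl20 : 0 < dl2 by rewrite lt_min dl10 divr_gt0// mulr_gt0.
have [sg [n [sg0 sgd n0 nK]]] := ex_mesh K0 dl20.
have [sgd1 sgd2] : sg < dl1 /\ sg < th / (6 * C0) by move: sgd; rewrite lt_min => /andP[].
have unif y z : - K <= y <= K -> `|y - z| <= sg -> `|u s y - u s z| <= kap.
  by move=> yK yz; apply/ltW/Hdl1 => //; exact: le_lt_trans yz sgd1.
pose m1 := th / (4 * (1 + M) ^+ 2 * T).
have m10 : 0 < m1 by rewrite divr_gt0// !mulr_gt0// exprn_gt0.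
(* In order: [e <= 1]; the summand [e] of the initial slack; the error accumulated up to [T]; and
   [expR (- (sg / e)) <= kap]. *)
exists (Num.min (Num.min 1 (th / 8)) (Num.min m1 (kap * sg))).
  by rewrite !lt_min ltr01 m10 divr_gt0// mulr_gt0.
move=> e e0; rewrite !le_min => /andP[/andP[e1 e2] /andP[e3 e4]].
have hexp := expRN_div_le sg0 e0 e4.
pose p := th / (4 * B); have p0 : 0 < p by rewrite divr_gt0// mulr_gt0.
have pE : B * p = th / 4 by rewrite /p; field; rewrite gt_eqF.
have [N1 HN1] := Hini kap0 p0.
have M2 : 0 < 2 + M by rewrite ltr_pwDl.
pose nth := th / (8 * (2 + M) * T); have nth0 : 0 < nth by rewrite divr_gt0// !mulr_gt0.
have [N2 HN2] := ex_noise_le e nth0.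
exists (maxn N1 N2) => N; rewrite geq_max => /andP[hN1 hN2] N2'.
have [A [mA AS PA]] := HN1 N hN1; have hno := HN2 N hN2 N2'.
pose U t y := u (s + t) y.
have UM t y : 0 <= t <= T -> `|U t y| <= M.
  move=> /andP[t1 t2]; apply: HM; rewrite ltr_pwDl//=.
  by rewrite addrC lerD.
have hA w : ~ A w -> forall y, `|FN (@xi N 0 w) y - u0 y| <= kap.
  by move=> Aw; apply: supnorm_le => h; apply: Aw; exact: AS.
have U0 : U 0 = u s by rewrite /U addr0.
have ha : (1 + M) * (2 * kap + expR (- (sg / e))) + e + ((1 + M) ^+ 2 + 1) * p < th.
  rewrite -/B pE.
  have h1 : (1 + M) * (2 * kap + expR (- (sg / e))) <= (1 + M) * (3 * kap).
    rewrite ler_wpM2l ?(ltW M1)//; have -> : 3 * kap = 2 * kap + kap by ring.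
    by rewrite lerD2l.
  rewrite [leRHS]mulrCA kapE in h1.
  have aux (q e' t : R) : 0 < t -> q <= 3 * (t / 8) -> e' <= t / 8 -> q + e' + t / 4 < t by lra.
  exact: aux.
have cU0 : continuous (U 0) by rewrite U0; exact: (@solution_continuous _ _ _ Hu s s0).
have := @final_disc _ _ _ _ (P N) (@xi N) (HP N2') N2' e M K sg kap p T th n u0 U A e0 e1 M0 sg0 n0 nK nd0 b01
  K0 T0 (shift_continuous Hu s0) cU0 UM (fun t y t0 => @shift_pde _ _ _ _ Hu s0 t y t0) _ mA PA hA ha x xK.
rewrite U0 => /(_ unif) hd.
set D := disc _ _ _ _ _ _ in hd.
have hD : D <= dl / 4.
  apply: (le_trans hd).
  have -> : dl / 4 = EC * (4 * th) by rewrite /th; field; rewrite gt_eqF.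
  rewrite -/EC -/C0 -/B ler_wpM2l ?(ltW EC0)//.
  have auxC (c q r t k : R) : 0 < c -> 0 < k -> k * q = 2 * r -> q <= t / (k * c) -> c * r <= t / 2.
    move=> c0 k0 E; rewrite ler_pdivlMr ?mulr_gt0// => h.
    have -> : r = k * q / 2 by lra.
    by have -> : c * (k * q / 2) = q * (k * c) / 2; [ring|lra].
  have h1 : C0 * (3 * sg) <= th / 2.
    by apply: (auxC _ sg _ _ 6) => //; [ring|exact: ltW].
  have h2 : C0 * Rintegral lebesgue_measure `[- K, K] (fun y => `|u s y - u0 y|) <= th / 2.
    by apply: auxC (ltW HI).
  have h3 : 2 * (e * (1 + M) ^+ 2 + 2 * (2 + M) * noise N e) * T <= th.
    have h4 : e * (4 * (1 + M) ^+ 2 * T) <= th by rewrite -ler_pdivlMr// !mulr_gt0// exprn_gt0.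
    have h5 : noise N e * (8 * (2 + M) * T) <= th by rewrite -ler_pdivlMr// !mulr_gt0.
    have -> : 2 * (e * (1 + M) ^+ 2 + 2 * (2 + M) * noise N e) * T =
      2^-1 * (e * (4 * (1 + M) ^+ 2 * T)) + 2^-1 * (noise N e * (8 * (2 + M) * T)) by field.
    have aux (q r t : R) : q <= t -> r <= t -> 2^-1 * q + 2^-1 * r <= t by lra.
    exact: aux.
  rewrite mulrDr.
  have aux (q r v w t : R) : q <= t / 2 -> r <= t / 2 -> v <= t -> w <= t -> q + r + v + t + w <= 4 * t by lra.
  exact: aux.
have HL := HP N2'.
have bf (c : R) : bmeas (fun z : 'rV[R]_N => (emp 'X e x z - c) ^+ 2).
  by apply/is_C2b_bmeas/is_C2bX/is_C2b_fc.
have bd : bmeas (fun z : 'rV[R]_N => 2 * dens e U T x z) by apply: bmeasM; [exact: bmeas_cst|exact/is_C2b_bmeas/is_C2b_dens].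
(* Returns from the shifted time [s + T] to [T], by bounding the square of a sum by twice the sum of
   squares. *)
apply: (@le_trans _ _ (Ex (P N) (@xi N) (fun z => 2 * dens e U T x z + dl / 2) T)).
  apply: (Ex_le HL) => //; [|exact: ltW|].
    by apply: bmeasD => //; exact: bmeas_cst.
  move=> z; rewrite /dens /U.
  set F := emp _ _ _ _; have F2 : 0 <= e * F ^+ 2 by rewrite mulr_ge0 ?sqr_ge0// ltW.
  have h : 0 <= (F - u (s + T) x - (u (s + T) x - u T x)) ^+ 2 by exact: sqr_ge0.
  have -> : (F - u T x) ^+ 2 = 2 * (F - u (s + T) x) ^+ 2 + 2 * (u (s + T) x - u T x) ^+ 2 -
     (F - u (s + T) x - (u (s + T) x - u T x)) ^+ 2 by ring.
  have aux (p1 p2 p3 p4 : R) : 0 <= p4 -> 0 <= p3 -> p2 <= dl / 4 -> 2 * p1 + 2 * p2 - p3 <= 2 * (p1 + p4) + dl / 2 by lra.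
  exact: aux.
rewrite (ExD HL bd (bmeas_cst _ _) (ltW T0)) Ex_cst (ExZ HL) ?(ltW T0)//; last exact/is_C2b_bmeas/is_C2b_dens.
have aux : D <= dl / 4 -> 2 * D + dl / 2 <= dl by lra.
exact: aux.
Qed.

End mean_square.

(** * Tails and convergence in sup norm *)

Section monotone_tools.
Variable R : realType.

(** No regularity of [q] is used: on an interval of length 1/2 its supremum is at most the initial
    value plus half of itself plus [dl / 2], hence at most twice the initial value plus [dl]. So
    [q + dl] at most doubles per half unit of time. *)
Lemma gronwall_half (q : R -> R) (dl : R) : 0 <= dl -> (forall t, 0 <= t -> 0 <= q t <= 1) ->
  (forall s t c, 0 <= s -> s <= t -> (forall r, s <= r <= t -> q r <= c) -> q t - q s <= (t - s) * (dl + c)) ->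
  forall (n : nat) t, 0 <= t -> t <= n%:R / 2 -> q t + dl <= 2 ^+ n * (q 0 + dl).
Proof.
move=> dl0 q01 Hq.
have step s t : 0 <= s -> s <= t -> t <= s + 2^-1 -> q t <= 2 * q s + dl.
  move=> s0 st ts; pose Q := [set q r | r in `[s, s + 2^-1]%classic].
  have Qub : has_ubound Q.
    exists 1 => _ [r /= + <-]; rewrite in_itv /= => /andP[sr _].
    by have /andP[] := q01 r (le_trans s0 sr).
  have inQ r : s <= r <= s + 2^-1 -> q r <= sup Q.
    by move=> hr; apply: ub_le_sup => //; exists r => //=; rewrite in_itv.
  have hs : s <= s <= s + 2^-1 by apply/andP; split => //; rewrite lerDl invr_ge0.
  have S0 : 0 <= sup Q by apply: le_trans (inQ s hs); have /andP[] := q01 s s0.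
  have h r : s <= r <= s + 2^-1 -> q r <= q s + 2^-1 * (dl + sup Q).
    move=> /andP[r1 r2]; rewrite -lerBlDl.
    apply: (le_trans (Hq s r (sup Q) s0 r1 _)).
      by move=> r' /andP[a b]; apply: inQ; rewrite a (le_trans b).
    by rewrite ler_wpM2r ?addr_ge0// lerBlDl.
  have hS : sup Q <= q s + 2^-1 * (dl + sup Q).
    apply: ge_sup; first by exists (q s), s => //=; rewrite in_itv.
    by move=> _ [r /= + <-]; rewrite in_itv /= => hr; exact: h.
  have := inQ t; rewrite st ts => /(_ erefl) ht.
  have aux (a b c e' : R) : a <= b -> b <= c + 2^-1 * (e' + b) -> a <= 2 * c + e' by lra.
  exact: aux ht hS.
elim=> [|n IH] t t0 tn.
  have -> : t = 0 by apply/eqP; rewrite eq_le t0 andbT (le_trans tn)// mul0r.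
  by rewrite expr0 mul1r.
have b0 : 0 <= q 0 + dl by rewrite addr_ge0//; have /andP[] := q01 0 (lexx _).
have [th|th] := leP t 2^-1.
  have := step 0 t (lexx _) t0; rewrite add0r => /(_ th) h.
  have h2 : 2 * (q 0 + dl) <= 2 ^+ n.+1 * (q 0 + dl).
    by rewrite ler_wpM2r// exprS ler_peMr// exprn_ege1// ler1n.
  by apply: le_trans h2; lra.
have t1 : 0 <= t - 2^-1 by rewrite subr_ge0 ltW.
have h1 : q (t - 2^-1) + dl <= 2 ^+ n * (q 0 + dl).
  by apply: IH => //; rewrite -natr1 in tn; lra.
have := step (t - 2^-1) t t1; rewrite subrK lexx => /(_ _ isT) h.
have {}h : q t <= 2 * q (t - 2^-1) + dl by apply: h; rewrite gerBl.
by rewrite exprS -mulrA; lra.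
Qed.

(** Between nodes [F] is enclosed by its values at the neighbouring nodes; [c] is the error at the
    nodes and [kap] bounds both the oscillation of [v] over a cell and its tails outside the box. *)
Lemma polya (F v : R -> R) (K s c kap : R) (n : nat) :
  {homo F : x y / x <= y} -> (forall x, 0 <= F x <= 1) ->
  {homo v : x y / x <= y} -> (forall x, 0 <= v x <= 1) ->
  0 < s -> (0 < n)%N -> n%:R * s = 2 * K -> 0 <= c ->
  (forall k, (k <= n)%N -> `|F (cell K s k) - v (cell K s k)| <= c) ->
  (forall x y, - K <= x <= K -> `|x - y| <= s -> `|v x - v y| <= kap) ->
  v (- K) <= kap -> 1 - kap <= v K -> forall x, `|F x - v x| <= c + kap.
Proof.
move=> ndF F01 ndv v01 s0 n0 nK c0 hc hv vl vr x.
have cell0 : cell K s 0 = - K by rewrite /cell mul0r addr0.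
have celln : cell K s n = K by rewrite /cell nK; ring.
have /andP[Fx0 Fx1] := F01 x; have /andP[vx0 vx1] := v01 x.
have [xK|Kx] := leP x (- K).
  have h1 := ndF _ _ xK; have h2 := ndv _ _ xK.
  have := hc 0 (leq0n _); rewrite cell0 => /ler_normlP[h3 h4].
  by apply/ler_normlP; split; lra.
have [Kx'|xK] := leP K x.
  have h1 := ndF _ _ Kx'; have h2 := ndv _ _ Kx'.
  have := hc n (leqnn _); rewrite celln => /ler_normlP[h3 h4].
  by apply/ler_normlP; split; lra.
have xK' : `|x| <= K by rewrite ler_norml !ltW.
have [k kn /andP[k1 k2]] := cell_cover s0 nK n0 xK'.
have /ler_normlP[a1 a2] := hc k (ltnW kn); have /ler_normlP[b1 b2] := hc k.+1 kn.
have f1 := ndF _ _ k1; have f2 := ndF _ _ k2.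
rewrite cellS in k2 b1 b2 f2.
have xK2 : - K <= x <= K by rewrite !ltW.
have /ler_normlP[d1 d2] : `|v x - v (cell K s k)| <= kap.
  by apply: hv => //; rewrite ger0_norm; lra.
have /ler_normlP[e1 e2] : `|v x - v (cell K s k + s)| <= kap.
  by apply: hv => //; apply/ler_normlP; split; lra.
by apply/ler_normlP; split; lra.
Qed.

End monotone_tools.

(** * Propagation of the tails *)

Section tails.
Context (R : realType) (N : nat) d (Omega : measurableType d).
Variables (P : probability Omega R) (xi : R -> Omega -> 'rV[R]_N).
Hypothesis HL : is_L_process P xi.
Hypothesis N2 : (2 <= N)%N.

Notation E := (Ex P xi).

Let n0 : 0 < N%:R :> R. Proof. by rewrite ltr0n; exact: leq_trans N2. Qed.

Lemma emp_nd (e : R) (z : 'rV[R]_N) : 0 < e -> {homo (fun x => emp 'X e x z) : x y / x <= y}.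
Proof.
move=> e0 x y xy; rewrite !empX ler_pM2l ?invr_gt0//; apply: ler_sum => i _.
by apply: logi_nd; rewrite ler_pM2r ?invr_gt0// lerD2r.
Qed.

(** For [y <= 0] the larger scale raises the argument; for positive [y] the right side is already at
    least 1. Tails propagate well only at a large scale [r], while convergence to the solution is
    known at small [e]. *)
Lemma logi_scale_le (y e r : R) : 0 < e -> e <= r -> logi (y / e) <= 2 * logi (y / r).
Proof.
move=> e0 er; have r0 : 0 < r by exact: lt_le_trans er.
have p0 := logi_gt0 (y / r).
have [y0|y0] := leP y 0.
  apply: (@le_trans _ _ (logi (y / r))); last by lra.
  by apply: logi_nd; rewrite ler_wnM2l// lef_pV2.
apply: (@le_trans _ _ 1); first exact/ltW/logi_lt1.
have h : logi 0 <= logi (y / r) by apply: logi_nd; rewrite divr_ge0 ?ltW.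
by rewrite logi0 in h; lra.
Qed.

Lemma emp_scale_le (e r x : R) (z : 'rV[R]_N) : 0 < e -> e <= r -> emp 'X e x z <= 2 * emp 'X r x z.
Proof.
move=> e0 er; rewrite !empX mulrCA ler_pM2l ?invr_gt0// mulr_sumr; apply: ler_sum => i _.
exact: logi_scale_le.
Qed.

Lemma emp_scale_compl_le (e r x : R) (z : 'rV[R]_N) : 0 < e -> e <= r ->
  1 - emp 'X e x z <= 2 * (1 - emp 'X r x z).
Proof.
move=> e0 er; rewrite !empX.
have one : 1 = N%:R^-1 * \sum_(i < N) 1 :> R by rewrite sumr_const card_ord mulVf// gt_eqF.
rewrite [X in X - _ <= _]one [X in _ <= _ * (X - _)]one -!mulrBr -!sumrB mulrCA ler_pM2l ?invr_gt0// mulr_sumr; apply: ler_sum => i _.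
by rewrite -!logiN -!mulNr; exact: logi_scale_le.
Qed.

(** Jumps only lower the smoothed distribution function, so mass moves left by diffusion alone, at a
    rate at most [2^-1 * r^-1 ^+ 2]. *)
Lemma left_tail (r x T : R) : 0 < r -> 0 <= T ->
  E (emp 'X r x) T <= E (emp 'X r x) 0 + T * (2^-1 * r^-1 ^+ 2).
Proof.
move=> r0 T0; rewrite -lerBlDl.
have := @Ex_incr_le_cst _ _ _ _ _ _ HL (emp 'X r x) (2^-1 * r^-1 ^+ 2) 0 T (is_C2b_emp N 'X r x) (lexx _) T0.
rewrite subr0; apply => t /andP[t0 _].
rewrite -[leRHS](Ex_cst P xi _ t); apply: (Ex_le HL) => //.
- exact/bmeas_gen/is_C2b_emp.
- exact: bmeas_cst.
move=> z; rewrite gen_emp// /lapl.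
have /andP[_ h] := empW01 r x N2 z; have h2 := jumpf_le0 r x z.
have h3 : 0 <= r^-1 ^+ 2 by exact: sqr_ge0.
apply: (@le_trans _ _ (2^-1 * (r^-1 ^+ 2 * emp (dp (Vp R)) r x z))); first by rewrite gerDl.
by rewrite ler_pM2l// ler_piMr.
Qed.

(** Jumps do push mass to the right, at a rate at most the mass already there: a Gronwall bound
    replaces the linear one of the left tail. *)
Lemma right_tail (r x T : R) (n : nat) : 0 < r -> 0 <= T -> T <= n%:R / 2 ->
  1 - E (emp 'X r x) T <= 2 ^+ n * (1 - E (emp 'X r x) 0 + 2^-1 * r^-1 ^+ 2).
Proof.
move=> r0 T0 Tn; set dl := 2^-1 * _.
have dl0 : 0 <= dl by rewrite mulr_ge0// sqr_ge0.
have bf := is_C2b_emp N 'X r x.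
apply: (@le_trans _ _ (1 - E (emp 'X r x) T + dl)); first by rewrite lerDl.
apply: (@gronwall_half _ (fun t => 1 - E (emp 'X r x) t) dl dl0 _ _ n T T0 Tn).
  move=> t t0; have /andP[h1 h2] := Ex_emp_bound HL N2 r x t0.
  by apply/andP; split; lra.
move=> s t c s0 st hc.
have hN q : 0 <= q -> E (fun z => - emp 'X r x z) q = - E (emp 'X r x) q.
  move=> q0; have := ExZ HL (-1) (is_C2b_bmeas bf) q0; rewrite mulN1r => <-.
  by congr Ex; apply/funext => z; rewrite mulN1r.
have := @Ex_incr_le_cst _ _ _ _ _ _ HL (fun z => - emp 'X r x z) (dl + c) s t (is_C2bN bf) s0 st _.
rewrite !hN//; last exact: le_trans st.
have aux0 (a b : R) : 1 - a - (1 - b) = - a - - b by ring.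
move=> h; rewrite aux0.
apply: h => q /andP[sq qt]; have q0 := le_trans s0 sq.
have := hc q; rewrite sq qt => /(_ isT) hq.
apply: (@le_trans _ _ (dl + (1 - E (emp 'X r x) q))); last by rewrite lerD2l.
have -> : dl + (1 - E (emp 'X r x) q) = E (fun z => (dl + 1) + - emp 'X r x z) q.
  by rewrite (ExD HL (bmeas_cst _ _) (is_C2b_bmeas (is_C2bN bf)) q0) Ex_cst hN// addrA.
apply: (Ex_le HL) => //.
- exact/bmeas_gen/is_C2bN.
- by apply: bmeasD; [exact: bmeas_cst|exact/is_C2b_bmeas/is_C2bN].
move=> z; rewrite genN// gen_emp// /lapl.
have /andP[h _] := empW01 r x N2 z; have h2 := jumpf_ge r x N2 z.
have h3 : 0 <= r^-1 ^+ 2 by exact: sqr_ge0.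
have h4 : - (r^-1 ^+ 2) <= r^-1 ^+ 2 * emp (dp (Vp R)) r x z.
  by rewrite -[leLHS]mulr1 mulNr -mulrN ler_wpM2l.
rewrite /dl; have aux (a b j f : R) : - a <= b -> - (1 - f) <= j -> - (2^-1 * b + j) <= 2^-1 * a + 1 - f by lra.
exact: aux.
Qed.

Section initial_tails.
Variables (A : set Omega) (p kap r h x : R) (u0 : R -> R).
Hypotheses (mA : measurable A) (PA : (P A < p%:E)%E) (r0 : 0 < r) (h0 : 0 < h).
Hypothesis hA : forall w, ~ A w -> forall y, `|FN (xi 0 w) y - u0 y| <= kap.
Hypotheses (kap0 : 0 <= kap) (b01 : forall x, 0 <= u0 x <= 1).

Lemma initial_left_tail : E (emp 'X r x) 0 <= u0 (x + h) + kap + expR (- (h / r)) + p.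
Proof.
rewrite -[X in _ + X]mul1r; apply: (Ex_exceptional HL (A := A)) => //.
- exact/is_C2b_bmeas/is_C2b_emp.
- move=> w Aw; have := emp_le_FN N2 r0 (xi 0 w) x h0; have /ler_normlP[_ +] := hA Aw (x + h).
  by lra.
- by move=> z; have /andP[] := empX01 r x N2 z.
- by rewrite addr_ge0 ?expR_ge0// addr_ge0//; have /andP[] := b01 (x + h).
Qed.

Lemma initial_right_tail : 1 - E (emp 'X r x) 0 <= (1 - u0 (x - h)) + kap + expR (- (h / r)) + p.
Proof.
have bf := is_C2b_bmeas (is_C2b_emp N 'X r x).
rewrite -{1}(Ex_cst P xi 1 0) -(ExB HL (bmeas_cst _ _) bf (lexx _)).
rewrite -[X in _ + X]mul1r; apply: (Ex_exceptional HL (A := A)) => //.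
- by apply: bmeasB => //; exact: bmeas_cst.
- move=> w Aw; have := emp_ge_FN N2 r0 (xi 0 w) x h0; have /ler_normlP[+ _] := hA Aw (x - h).
  by lra.
- by move=> z; have /andP[? ?] := empX01 r x N2 z; rewrite gerBl.
- by rewrite addr_ge0 ?expR_ge0// addr_ge0//; have /andP[? ?] := b01 (x - h); rewrite subr_ge0.
Qed.

End initial_tails.

End tails.

(** * Convergence in sup norm *)

Section convergence.
Variables (R : realType) (d : nat -> measure_display) (Omega : forall N : nat, measurableType (d N)).
Variables (P : forall N : nat, probability (Omega N) R) (xi : forall N : nat, R -> Omega N -> 'rV[R]_N).
Variables (u0 : R -> R) (u : R -> R -> R).
Hypothesis HP : forall N : nat, (2 <= N)%N -> is_L_process (P N) (@xi N).
Hypothesis Hu0 : distribution_function u0.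
Hypothesis Hini : cvg_in_prob0 P (fun N w => supnorm (fun x => FN (@xi N 0 w) x - u0 x)).
Hypothesis Hu : FKPP_solution u u0.
Variable T : R.
Hypothesis T0 : 0 < T.

Let T0' : 0 <= T := ltW T0.

Lemma mean_square_sum (l : seq R) dl : 0 < dl -> exists2 e1, 0 < e1 & forall e, 0 < e -> e <= e1 ->
  exists N0, forall N, (N0 <= N)%N -> (2 <= N)%N ->
  Ex (P N) (@xi N) (fun z => \sum_(x <- l) (emp 'X e x z - u T x) ^+ 2) T <= dl.
Proof.
elim: l dl => [|x l IH] dl dl0.
  exists 1 => // e e0 e1; exists 0%N => N _ N2.
  rewrite (_ : (fun z => _) = fun=> 0); first by rewrite Ex_cst ltW.
  by apply/funext => z; rewrite big_nil.
have d2 : 0 < dl / 2 by rewrite divr_gt0.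
have [a a0 Ha] := mean_square_cvg HP Hu0 Hini Hu T0 x d2.
have [b b0 Hb] := IH _ d2.
exists (Num.min a b); first by rewrite lt_min a0.
move=> e e0; rewrite le_min => /andP[ea eb].
have [N1 H1] := Ha e e0 ea; have [N2 H2] := Hb e e0 eb.
exists (maxn N1 N2) => N; rewrite geq_max => /andP[n1 n2] hN.
have h1 := H1 N n1 hN; have h2 := H2 N n2 hN.
rewrite (_ : (fun z => _) = fun z => (emp 'X e x z - u T x) ^+ 2 + \sum_(x <- l) (emp 'X e x z - u T x) ^+ 2); last first.
  by apply/funext => z; rewrite big_cons.
rewrite (ExD (HP hN))//.
- by rewrite (le_trans (lerD h1 h2))// -splitr.
- by apply/is_C2b_bmeas/is_C2bX/is_C2b_fc.
- by apply/is_C2b_bmeas/is_C2b_sum => i; apply/is_C2bX/is_C2b_fc.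
Qed.

Lemma mean_cvg x et : 0 < et -> exists2 e1, 0 < e1 & forall e, 0 < e -> e <= e1 ->
  exists N0, forall N, (N0 <= N)%N -> (2 <= N)%N ->
  `|Ex (P N) (@xi N) (emp 'X e x) T - u T x| <= et.
Proof.
move=> et0; have et2 : 0 < et ^+ 2 by rewrite exprn_gt0.
have [a a0 Ha] := mean_square_cvg HP Hu0 Hini Hu T0 x et2.
exists a => // e e0 ea; have [N0 HN] := Ha e e0 ea; exists N0 => N n0 n2.
have := HN N n0 n2; have HL := HP n2.
set m := Ex _ _ (emp _ _ _) T; set c := u T x => h.
have bf := is_C2b_bmeas (is_C2b_emp N 'X e x).
have b2 : bmeas (fun z : 'rV[R]_N => (emp 'X e x z - c) ^+ 2) by apply/is_C2b_bmeas/is_C2bX/is_C2b_fc.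
have b3 : bmeas (fun z : 'rV[R]_N => 2 * (m - c) * emp 'X e x z) by apply: bmeasM => //; exact: bmeas_cst.
have b4 : bmeas (fun z : 'rV[R]_N => 2 * (m - c) * emp 'X e x z + - (m ^+ 2 - c ^+ 2)).
  by apply: bmeasD => //; exact: bmeas_cst.
(* Jensen, through the tangent line of the square at [m] *)
have : Ex (P N) (@xi N) (fun z => 2 * (m - c) * emp 'X e x z + - (m ^+ 2 - c ^+ 2)) T
    <= Ex (P N) (@xi N) (fun z => (emp 'X e x z - c) ^+ 2) T.
  apply: (Ex_le HL) => // z; set F := emp _ _ _ _.
  by rewrite -subr_ge0 (_ : _ - _ = (F - m) ^+ 2) ?sqr_ge0//; ring.
rewrite (ExD HL b3 (bmeas_cst _ _))// Ex_cst (ExZ HL)// -/m.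
have -> : 2 * (m - c) * m + - (m ^+ 2 - c ^+ 2) = (m - c) ^+ 2 by ring.
move=> h2; have := le_trans h2 h.
by rewrite -real_normK ?num_real// ler_pXn2r ?nnegrE// ltW.
Qed.

Lemma ex_common x y et : 0 < et -> exists e N (n2 : (2 <= N)%N), [/\ 0 < e,
  `|Ex (P N) (@xi N) (emp 'X e x) T - u T x| <= et & `|Ex (P N) (@xi N) (emp 'X e y) T - u T y| <= et].
Proof.
move=> et0; have [a a0 Ha] := mean_cvg x et0; have [b b0 Hb] := mean_cvg y et0.
have e0 : 0 < Num.min a b by rewrite lt_min a0.
have [|N1 H1] := Ha _ e0 _; first by rewrite ge_min lexx.
have [|N2 H2] := Hb _ e0 _; first by rewrite ge_min lexx orbT.
have n2 : (2 <= maxn 2 (maxn N1 N2))%N by exact: leq_maxl.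
exists (Num.min a b), (maxn 2 (maxn N1 N2)), n2; split => //.
  by apply: H1 => //; rewrite !leq_max leqnn !orbT.
by apply: H2 => //; rewrite !leq_max leqnn !orbT.
Qed.

(** Inherited from the expectation of the smoothed distribution function, which lies in [0, 1] and
    approximates [u T x] within any [et]; monotonicity below follows the same way. *)
Lemma solution01 x : 0 <= u T x <= 1.
Proof.
apply/andP; split; apply/ler_addgt0Pl => et et0; have [e [N [n2 [e0 + _]]]] := ex_common x x et0;
  have /andP[h1 h2] := Ex_emp_bound (HP n2) n2 e x T0'; move/ler_normlP => [h3 h4]; lra.
Qed.

Lemma solution_nd : {homo u T : x y / x <= y}.
Proof.
have aux (a b v w q : R) : a <= b -> - (a - v) <= q / 2 -> b - w <= q / 2 -> v <= q + w by lra.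
move=> x y xy; apply/ler_addgt0Pl => et et0.
have et2 : 0 < et / 2 by rewrite divr_gt0.
have [e [N [n2 [e0 /ler_normlP[h1 h2] /ler_normlP[h3 h4]]]]] := ex_common x y et2.
have h : Ex (P N) (@xi N) (emp 'X e x) T <= Ex (P N) (@xi N) (emp 'X e y) T.
  by apply: (Ex_le (HP n2)) => //; [exact/is_C2b_bmeas/is_C2b_emp..|move=> z; apply: emp_nd].
exact: aux h h1 h4.
Qed.

Let ex_tail_params et y : 0 < et -> exists r h N (n2 : (2 <= N)%N) e, exists2 A : set (Omega N),
  [/\ 0 < r, 0 < h, T * (2^-1 * r^-1 ^+ 2) <= et, 2^-1 * r^-1 ^+ 2 <= et & expR (- (h / r)) <= et] /\
  [/\ 0 < e, e <= r & forall x, x \in [:: y - h; y + h] -> `|Ex (P N) (@xi N) (emp 'X e x) T - u T x| <= et] &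
  [/\ measurable A, (P N A < et%:E)%E & forall w, ~ A w -> forall y, `|FN (@xi N 0 w) y - u0 y| <= et].
Proof.
(* The factor [T + 1] covers the diffusion bounds with and without [T]; below, [h = r / et] yields
   [expR (- (h / r)) <= r / h = et]. *)
move=> et0; pose r := 1 + (T + 1) / et; have q0 : 0 < (T + 1) / et by rewrite divr_gt0// addr_gt0.
have r1 : 1 <= r by rewrite lerDl ltW.
have r0 : 0 < r by exact: lt_le_trans r1.
pose h := r / et; have h0 : 0 < h by rewrite divr_gt0.
have hr : (T + 1) * (2^-1 * r^-1 ^+ 2) <= et.
  rewrite mulrA exprVn ler_pdivrMr ?exprn_gt0//.
  rewrite (@le_trans _ _ (et * r))//; last by rewrite ler_pM2l// expr2 ler_peMl// ltW.
  have -> : et * r = et + (T + 1) by rewrite /r; field; rewrite gt_eqF.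
  have aux (p q : R) : 0 <= p -> 0 <= q -> p / 2 <= q + p by lra.
  by apply: aux; rewrite ?addr_ge0// ltW.
have rr : 0 <= 2^-1 * r^-1 ^+ 2 by rewrite mulr_ge0// sqr_ge0.
have [a a0 Ha] := mean_cvg (y - h) et0; have [b b0 Hb] := mean_cvg (y + h) et0.
pose e := Num.min r (Num.min a b).
have e0 : 0 < e by rewrite !lt_min r0 a0.
have [|N1 H1] := Ha _ e0 _; first by rewrite !ge_min lexx orbT.
have [|N2 H2] := Hb _ e0 _; first by rewrite !ge_min lexx !orbT.
have [N3 H3] := Hini et0 et0.
pose N := maxn 2 (maxn N1 (maxn N2 N3)).
have n2 : (2 <= N)%N by exact: leq_maxl.
have [|A [mA AS PA]] := H3 N _; first by rewrite !leq_max leqnn !orbT.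
exists r, h, N, n2, e; exists A; [split|]; split => //.
- by apply: le_trans hr; rewrite ler_wpM2r// lerDl.
- by apply: le_trans hr; rewrite -[leLHS]mul1r ler_wpM2r// lerDr ltW.
- by apply: expRN_div_le => //; rewrite /h mulrC divfK// gt_eqF.
- by rewrite ge_min lexx.
- move=> x; rewrite !inE => /orP[] /eqP ->.
    by apply: H1 => //; rewrite !leq_max leqnn !orbT.
  by apply: H2 => //; rewrite !leq_max leqnn !orbT.
- by move=> w Aw; apply: supnorm_le => hw; apply: Aw; exact: AS.
Qed.

Lemma solution_left_tail et : 0 < et -> exists x, u T x <= et.
Proof.
have aux (q a b c v e1 e2 w : R) : - (a - v) <= q -> b <= w + q + e1 + q -> c <= b + e2 -> a <= 2 * c -> e1 <= q ->
  e2 <= q -> w <= q -> v <= 11 * q by lra.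
(* Four errors at time 0 and one from diffusion, doubled by the change of scale, and one for the
   approximation of [u T]. *)
move=> et0; pose k := et / 11; have k0 : 0 < k by rewrite divr_gt0.
have [_ _ cN _] := Hu0.
have [y hy] : exists y, u0 y < k.
  by apply: (@filter_ex _ (-oo)); exact: (cvgr_lt _ cN).
have [r [h [N [n2 [e [A [[r0 h0 hr _ hh] [e0 er He]] [mA PA hA]]]]]]] := ex_tail_params y k0.
exists (y - h); have := He (y - h); rewrite inE eqxx => /(_ isT)/ler_normlP[h1 _].
have HL := HP n2.
have h2 := initial_left_tail HL n2 (y - h) mA PA r0 h0 hA (ltW k0) (df01 Hu0).
have h3 := left_tail HL n2 (y - h) r0 T0'.
have b1 := is_C2b_bmeas (is_C2b_emp N 'X r (y - h)).
have h4 : Ex (P N) (@xi N) (emp 'X e (y - h)) T <= 2 * Ex (P N) (@xi N) (emp 'X r (y - h)) T.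
  rewrite -(ExZ HL)//; apply: (Ex_le HL) => //; first exact/is_C2b_bmeas/is_C2b_emp.
    by apply: bmeasM => //; exact: bmeas_cst.
  by move=> z; exact: emp_scale_le.
rewrite subrK in h2.
have -> : et = 11 * k by rewrite /k; field.
exact: aux h1 h2 h3 h4 hh hr (ltW hy).
Qed.

Lemma solution_right_tail et : 0 < et -> exists x, 1 - et <= u T x.
Proof.
have aux1 (q b dl e1 w : R) : 1 - b <= 1 - w + q + e1 + q -> dl <= q -> e1 <= q -> 1 - q < w ->
  1 - b + dl <= 5 * q by lra.
have aux2 (q q' a c v : R) : a - v <= q -> 1 - a <= 2 * (1 - c) -> 1 - c <= 5 * q' -> q <= q' -> 1 - 11 * q' <= v by lra.
move=> et0; pose n := (Num.trunc (2 * T)).+1.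
have Tn : T <= n%:R / 2.
  have q0 : 0 <= 2 * T by rewrite mulr_ge0.
  by have /andP[_ /ltW] := truncn_itv q0; rewrite -/n; lra.
have p1 : 1 <= 2 ^+ n :> R by rewrite exprn_ege1// ler1n.
have p0 : 0 < 2 ^+ n :> R by exact: lt_le_trans p1.
(* The eleven errors of the left tail, with the growth factor [2 ^+ n] up to time [T]. *)
pose k := et / (11 * 2 ^+ n); have k0 : 0 < k by rewrite divr_gt0// mulr_gt0.
have [_ _ _ cP] := Hu0.
have [y hy] : exists y, 1 - k < u0 y.
  by apply: (@filter_ex _ (+oo)); apply: (cvgr_gt _ cP); rewrite ltrBlDr ltrDl.
have [r [h [N [n2 [e [A [[r0 h0 _ hr hh] [e0 er He]] [mA PA hA]]]]]]] := ex_tail_params y k0.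
exists (y + h); have := He (y + h); rewrite !inE eqxx orbT => /(_ isT)/ler_normlP[_ h1].
have HL := HP n2.
have h2 := initial_right_tail HL n2 (y + h) mA PA r0 h0 hA (ltW k0) (df01 Hu0).
have h3 := right_tail HL n2 (y + h) r0 T0' Tn.
have b1 := is_C2b_bmeas (is_C2b_emp N 'X r (y + h)).
have b2 := is_C2b_bmeas (is_C2b_emp N 'X e (y + h)).
have h4 : 1 - Ex (P N) (@xi N) (emp 'X e (y + h)) T <= 2 * (1 - Ex (P N) (@xi N) (emp 'X r (y + h)) T).
  have cE (g : 'rV[R]_N -> R) : bmeas g -> 1 - Ex (P N) (@xi N) g T = Ex (P N) (@xi N) (fun z => 1 - g z) T.
    by move=> bg; rewrite (ExB HL (bmeas_cst _ _) bg)// Ex_cst.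
  rewrite !cE//.
  rewrite -(ExZ HL)//; last by apply: bmeasB => //; exact: bmeas_cst.
  apply: (Ex_le HL) => //; first by apply: bmeasB => //; exact: bmeas_cst.
    by apply: bmeasM; [exact: bmeas_cst|apply: bmeasB => //; exact: bmeas_cst].
  by move=> z; exact: emp_scale_compl_le.
rewrite addrK in h2.
have etE : et = 11 * (2 ^+ n * k) by rewrite /k; field; rewrite gt_eqF.
have h5 := aux1 _ _ _ _ _ h2 hr hh hy.
have h6 : k <= 2 ^+ n * k by rewrite ler_peMl// ltW.
rewrite -(ler_pM2l p0) in h5; rewrite [leRHS]mulrCA in h5.
rewrite etE; exact: aux2 h1 h4 (le_trans h3 h5) h6.
Qed.

Lemma cdf_cvg : cvg_in_prob0 P (fun N w => supnorm (fun x => FN (@xi N T w) x - u T x)).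
Proof.
have aux (k F v vm vp am ap x : R) : am <= F + x -> F - x <= ap -> v - vm <= k -> - (v - vp) <= k ->
    ap - vp <= k -> - (am - vm) <= k -> x <= k -> `|F - v| <= 3 * k.
  by move=> *; apply/ler_normlP; split; lra.
(* At a node three errors of size [k] occur, from the exponential, the mean square and the modulus
   of [u T]; a fourth between the nodes. *)
move=> eps dlt eps0 dlt0; pose k := eps / 4; have k0 : 0 < k by rewrite divr_gt0.
have [xl hl] := solution_left_tail k0; have [xr hr] := solution_right_tail k0.
pose K := 1 + Num.max `|xl| `|xr|.
have K0 : 0 < K by rewrite ltr_pwDl// le_max normr_ge0.
have vl : u T (- K) <= k.
  apply: le_trans hl; apply: solution_nd; rewrite lerNl.
  have h : `|xl| <= K by rewrite /K ler_wpDl// le_max lexx.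
  by rewrite (le_trans _ h)// -normrN ler_norm.
have vr : 1 - k <= u T K.
  apply: (le_trans hr); apply: solution_nd.
  by rewrite (le_trans (ler_norm _))// /K ler_wpDl// le_max lexx orbT.
have [dl1 dl10 Hdl] := @heine _ (u T) (- K) K k (@solution_continuous _ _ _ Hu T T0) k0.
have [h [n [h0 hdl n0 nK]]] := ex_mesh K0 dl10.
have unif y z : - K <= y <= K -> `|y - z| <= h -> `|u T y - u T z| <= k.
  by move=> yK yz; apply/ltW/Hdl => //; exact: le_lt_trans yz hdl.
(* [FN] at a node is enclosed by smoothed values at distance [h] on either side, so the mean square
   is controlled at the shifted nodes. *)
pose l := [seq cell K h i + h | i <- iota 0 n.+1] ++ [seq cell K h i - h | i <- iota 0 n.+1].
have k2 : 0 < k ^+ 2 by rewrite exprn_gt0.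
(* Sized for the Markov inequality at level [k ^+ 2], which then gives probability at most
   [dlt / 2]. *)
have kd : 0 < k ^+ 2 * (dlt / 2) by rewrite mulr_gt0// divr_gt0.
have [a a0 Ha] := mean_square_sum l kd.
pose e := Num.min a (k * h); have e0 : 0 < e by rewrite lt_min a0 mulr_gt0.
have [|N1 H1] := Ha e e0 _; first by rewrite ge_min lexx.
have hexp : expR (- (h / e)) <= k by apply: expRN_div_le => //; rewrite ge_min lexx orbT.
exists (maxn 2 N1) => N; rewrite geq_max => /andP[n2 hN1].
have HL := HP n2; have hE := H1 N hN1 n2.
pose G (z : 'rV[R]_N) := \sum_(x <- l) (emp 'X e x z - u T x) ^+ 2.
have bG : bmeas G by apply/is_C2b_bmeas/is_C2b_sum => i; apply/is_C2bX/is_C2b_fc.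
have G0 z : 0 <= G z by apply: sumr_ge0 => i _; exact: sqr_ge0.
have [mA PA] := Ex_markov HL bG T0' G0 k2.
exists [set w | (k ^+ 2 < G (@xi N T w))%R]; split => //; last first.
  apply: (le_lt_trans PA); rewrite lte_fin ltr_pdivrMr//.
  apply: (le_lt_trans hE); rewrite mulrC ltr_pM2r// gtr_pMr// invf_lt1// ltr1n.
  by [].
move=> w /= hw; rewrite ltNge; apply/negP => Gk; move: hw; apply/negP; rewrite -leNgt.
apply: ge_ereal_sup => _ [y _ <-]; rewrite lee_fin.
have hpt x : x \in l -> `|emp 'X e x (@xi N T w) - u T x| <= k.
  move=> xl'; rewrite -(ler_pXn2r (n := 2))// ?nnegrE ?(ltW k0)// real_normK ?num_real//.
  apply: le_trans Gk; rewrite /G (big_rem x)//= lerDl.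
  by apply: sumr_ge0 => i _; exact: sqr_ge0.
have hc i : (i <= n)%N -> `|FN (@xi N T w) (cell K h i) - u T (cell K h i)| <= 3 * k.
  move=> ilen; have iK := cell_le h0 nK ilen.
  have i1 : cell K h i + h \in l.
    by rewrite mem_cat; apply/orP; left; apply/mapP; exists i => //; rewrite mem_iota.
  have i2 : cell K h i - h \in l.
    by rewrite mem_cat; apply/orP; right; apply/mapP; exists i => //; rewrite mem_iota.
  have := emp_le_FN n2 e0 (@xi N T w) (cell K h i - h) h0; rewrite subrK => p1.
  have := emp_ge_FN n2 e0 (@xi N T w) (cell K h i + h) h0; rewrite addrK => p2.
  have /ler_normlP[_ q1] : `|u T (cell K h i) - u T (cell K h i - h)| <= k.
    by apply: unif => //; rewrite opprB addrC subrK gtr0_norm.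
  have /ler_normlP[q2 _] : `|u T (cell K h i) - u T (cell K h i + h)| <= k.
    by apply: unif => //; rewrite opprD addNKr normrN gtr0_norm.
  have /ler_normlP[_ r1] := hpt _ i1; have /ler_normlP[r2 _] := hpt _ i2.
  exact: aux p1 p2 q1 q2 r1 r2 hexp.
have := @polya _ (FN (@xi N T w)) (u T) K h (3 * k) k n (FN_nd n2 (@xi N T w)) (FN01 n2 (@xi N T w)) solution_nd solution01
  h0 n0 nK _ hc unif vl vr y.
move=> hp; have -> : eps = 3 * k + k by rewrite /k; field.
by apply: hp; rewrite mulr_ge0// ltW.
Qed.

End convergence.

Theorem theorem2p1 (R : realType)
  (d : nat -> measure_display) (Omega : forall N : nat, measurableType (d N))
  (P : forall N : nat, probability (Omega N) R)
  (xi : forall N : nat, R -> Omega N -> 'rV[R]_N)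
  (u0 : R -> R) (u : R -> R -> R) :
  (forall N : nat, (2 <= N)%N -> is_L_process (P N) (xi N)) ->
  distribution_function u0 ->
  cvg_in_prob0 P (fun N w => supnorm (fun x => FN (xi N 0 w) x - u0 x)) ->
  FKPP_solution u u0 ->
  forall t : R, 0 < t ->
    cvg_in_prob0 P (fun N w => supnorm (fun x => FN (xi N t w) x - u t x)).
Proof. by move=> HP Hu0 Hini Hu t t0; exact: (@cdf_cvg R d Omega P xi u0 u HP Hu0 Hini Hu t t0). Qed.
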